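(* Let $N=2$, $p\in[1,\infty)$, and for $i=1,2$ let $\mu_i\in\mathcal P(X_i)$ satisfy $\int\exp(\alpha\,d_{X_i}(\hat x_i,x_i)^p)\,\mu_i(dx_i)<\infty$ for some $\alpha>0$ and $\hat x_i\in X_i$. Let $\pi^*$ be the optimizer of $S_{\rm ent}(\mu_1,\mu_2,c)$ and $(\pi^n)_{n\ge0}$ the Sinkhorn iterates. (i) If $c:X\to[0,\infty)$ is continuous with growth of order $p$, then $\mathcal F(\pi^n)\to\mathcal F(\pi^* )$ and $\pi^n\to\pi^*$ in $W_p$ as $n\to\infty$. (ii) Let $1\le q\le p$ and $c=fg\ge0$ where $f,g:X\to\mathbb R$ are Lipschitz with growth of order $p-1$ (i.e. $|f(x)|,|g(x)|\le C(1+d_{X,p}(x,\hat x)^{p-1})$). Then there is a constant $c_0$ (independent of $n$) such that for all $n\ge2$, $$|\mathcal F(\pi^* )-\mathcal F(\pi^n)|\le c_0n^{-\frac1{2p}},\qquad W_q(\pi^*,\pi^n)\le c_0n^{-\frac1{4pq}}.$$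
   Context: $(X_1,d_{X_1}),(X_2,d_{X_2})$ Polish, $X=X_1\times X_2$, $d_{X,r}(x,y)=(d_{X_1}(x_1,y_1)^r+d_{X_2}(x_2,y_2)^r)^{1/r}$, $W_r$ on $X$ w.r.t. $d_{X,r}$. Growth of order $p$: $|c(x)|\le C(1+d_{X,p}(x,\hat x)^p)$. $S_{\rm ent}(\mu_1,\mu_2,c)=\inf_{\pi\in\Pi(\mu_1,\mu_2)}\int c\,d\pi+D_{\rm KL}(\pi,\mu_1\otimes\mu_2)$, $\Pi$ = couplings. $\mathcal F(\pi):=\int c\,d\pi+D_{\rm KL}(\pi,\mu_1\otimes\mu_2)$ for $\pi\in\mathcal P(X)$. Sinkhorn iterates: $\pi^0=P_c$ with $\frac{dP_c}{d(\mu_1\otimes\mu_2)}=e^{-c}/\int e^{-c}\,d(\mu_1\otimes\mu_2)$; for $n\ge1$, $\frac{d\pi^n}{d\pi^{n-1}}(x)=\frac{d\mu_1}{d\pi^{n-1}_1}(x_1)$ for $n$ odd and $\frac{d\pi^n}{d\pi^{n-1}}(x)=\frac{d\mu_2}{d\pi^{n-1}_2}(x_2)$ for $n$ even, where $\pi^{n-1}_i$ is the $i$-th marginal of $\pi^{n-1}$. *)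

(* Defs.v *)
From HB Require Import structures.
From mathcomp Require Import all_boot all_order all_algebra.
From mathcomp Require Import all_classical all_reals all_analysis.
Set Implicit Arguments. Unset Strict Implicit. Unset Printing Implicit Defensive.
Import Order.TTheory GRing.Theory Num.Theory.
Local Open Scope classical_set_scope.
Local Open Scope ring_scope.

Section Polish.
Context {R : realType} {dT : measure_display} (T : measurableType dT).
Variable dist : T -> T -> R.

Definition is_metric :=
  [/\ forall x y, 0 <= dist x y,
      forall x y, dist x y = 0 <-> x = y,
      forall x y, dist x y = dist y x &
      forall x y z, dist x z <= dist x y + dist y z].

Definition metric_open (A : set T) :=
  forall x, A x -> exists2 e : R, 0 < e & [set y | dist x y < e] `<=` A.

Definition metric_separable :=
  exists D : set T, countable D /\
    forall x (e : R), 0 < e -> exists2 y, D y & dist x y < e.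

Definition metric_complete :=
  forall u : nat -> T,
    (forall e : R, 0 < e -> exists N, forall m n, (N <= m)%N -> (N <= n)%N ->
        dist (u m) (u n) < e) ->
    exists l, forall e : R, 0 < e -> exists N, forall n, (N <= n)%N -> dist (u n) l < e.

Definition metric_borel :=
  (@measurable _ T) = <<s metric_open >>.

Definition polish_borel :=
  [/\ is_metric, metric_separable, metric_complete & metric_borel].

End Polish.

Section Product.
Context {R : realType} {d1 d2 : measure_display}
  (X1 : measurableType d1) (X2 : measurableType d2).
Variables (dist1 : X1 -> X1 -> R) (dist2 : X2 -> X2 -> R).

Definition dXr (r : R) (x y : X1 * X2) : R :=
  (dist1 x.1 y.1 `^ r + dist2 x.2 y.2 `^ r) `^ r^-1.

Definition growth_order (r e : R) (xh : X1 * X2) (h : X1 * X2 -> R) :=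
  exists C : R, forall x, `|h x| <= C * (1 + dXr r x xh `^ e).

(* continuity w.r.t. the product topology (metrised by d_{X,p}) *)
Definition dX_continuous (r : R) (h : X1 * X2 -> R) :=
  forall x (e : R), 0 < e -> exists2 del : R, 0 < del &
    forall y, dXr r x y < del -> `|h x - h y| < e.

Definition dX_lipschitz (r : R) (h : X1 * X2 -> R) :=
  exists L : R, forall x y, `|h x - h y| <= L * dXr r x y.

End Product.

Section Transport.
Local Open Scope ereal_scope.
Context {R : realType} {d1 d2 : measure_display}
  (X1 : measurableType d1) (X2 : measurableType d2).

Definition is_coupling (mu1 : probability X1 R) (mu2 : probability X2 R)
  (pi : probability (X1 * X2)%type R) :=
  (forall A, measurable A -> pi (A `*` setT) = mu1 A) /\
  (forall B, measurable B -> pi (setT `*` B) = mu2 B).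

Definition is_density {dT} {T : measurableType dT}
  (m : set T -> \bar R) (nu : {measure set T -> \bar R}) (h : T -> R) :=
  [/\ measurable_fun setT h, forall x, (0 <= h x)%R &
      forall A, measurable A -> m A = \int[nu]_(x in A) (h x)%:E].

(* D_KL(m, nu) = \int log (dm/dnu) dm if m << nu, +oo otherwise
   (the value does not depend on the version of the density) *)
Definition KL {dT} {T : measurableType dT}
  (m : {measure set T -> \bar R}) (nu : {measure set T -> \bar R}) : \bar R :=
  ereal_inf [set v | exists h, is_density m nu h /\ v = \int[m]_x (ln (h x))%:E].

Variables (mu1 : probability X1 R) (mu2 : probability X2 R).
Variable c : X1 * X2 -> R.

Definition Fent (pi : probability (X1 * X2)%type R) : \bar R :=
  \int[pi]_x (c x)%:E + KL pi (mu1 \x mu2).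

Definition Sent : \bar R :=
  ereal_inf [set Fent pi | pi in [set pi | is_coupling mu1 mu2 pi]].

(* Sinkhorn iterates:
   pi^0 = P_c with d P_c / d(mu1 (x) mu2) = e^{-c} / \int e^{-c} d(mu1 (x) mu2);
   n odd : d pi^n / d pi^(n-1) (x) = (d mu1 / d pi^(n-1)_1)(x1),
   n even: d pi^n / d pi^(n-1) (x) = (d mu2 / d pi^(n-1)_2)(x2). *)
Definition sinkhorn_iterates (pin : nat -> probability (X1 * X2)%type R) :=
  [/\ forall A, measurable A ->
        pin 0%N A = \int[mu1 \x mu2]_(x in A)
          ((expR (- c x))%:E / \int[mu1 \x mu2]_y (expR (- c y))%:E),
      forall n, odd n -> exists r : X1 -> R,
        [/\ measurable_fun setT r, forall x1, (0 <= r x1)%R,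
            forall B, measurable B ->
              mu1 B = \int[pin n.-1]_(x in B `*` setT) (r x.1)%:E &
            forall A, measurable A ->
              pin n A = \int[pin n.-1]_(x in A) (r x.1)%:E] &
      forall n, (0 < n)%N -> ~~ odd n -> exists r : X2 -> R,
        [/\ measurable_fun setT r, forall x2, (0 <= r x2)%R,
            forall B, measurable B ->
              mu2 B = \int[pin n.-1]_(x in setT `*` B) (r x.2)%:E &
            forall A, measurable A ->
              pin n A = \int[pin n.-1]_(x in A) (r x.2)%:E]].

End Transport.

Section Wasserstein.
Local Open Scope ereal_scope.
Context {R : realType} {d1 d2 : measure_display}
  (X1 : measurableType d1) (X2 : measurableType d2).
Variables (dist1 : X1 -> X1 -> R) (dist2 : X2 -> X2 -> R).

Definition Wass (r : R) (pi pi' : probability (X1 * X2)%type R) : \bar R :=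
  poweR (ereal_inf [set \int[gam]_z ((dXr dist1 dist2 r z.1 z.2) `^ r)%:E
                   | gam in [set gam | is_coupling pi pi' gam]]) r^-1.

End Wasserstein.

(* Main.v *)
Require Import Defs.
From HB Require Import structures.
From mathcomp Require Import all_boot all_order all_algebra.
From mathcomp Require Import all_classical all_reals all_analysis.
From mathcomp Require Import measurable_realfun.
From mathcomp Require Import ring lra.
Set Implicit Arguments. Unset Strict Implicit. Unset Printing Implicit Defensive.
Import Order.TTheory GRing.Theory Num.Theory.
Local Open Scope classical_set_scope.
Local Open Scope ring_scope.

(**
All measures are compared through their densities with respect to
M = mu1 (x) mu2, and distances are measured in total variation weighted by
1 + d1(xh1, .)^p + d2(xh2, .)^p, which controls every W_q with q <= p.

The n-th iterate has density H_n = u_n(x1) v_n(x2) exp(- c), one marginal of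
which is exact. Write a_n for the density of its other marginal. The successive
updates increase D_n = \int ln u_n dmu1 + \int ln v_n dmu2 by the reverse entropy
of a_n, and D_n is bounded by the optimal value; since Jensen's inequality makes
these increments decrease every two steps, the entropy of a_n is O(1/n).

A density with a wrong marginal a is moved to a prescribed marginal b by keeping
min(a, b) / a of its mass in place and redistributing the rest; this does not
increase the conditional entropy, and exponential moments (through the convex
conjugate of t ln t - t + 1) bound the cost of the move by O(n^(-1/2)). Moving the
optimizer to the marginals of H_n, where H_n is itself optimal because of its
product form, and moving H_n to the exact marginals give
|F(pi^n) - F(pistar)| = O(n^(-1/2)). The convexity defect of the entropy at the
midpoint dominates a Hellinger distance, so the weighted total variation distance
to pistar is O(n^(-1/4)), whence W_q = O(n^(-1/(4q))). Both rates are at least as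
good as the required ones because p >= 1.
*)

(** * Scalar inequalities for the entropy integrand *)

(** The obstacle is that the cost is unbounded: the potentials [ln u] and [ln v] are integrable but
    only bounded above, by multiples of 1 + phi, and entropies may a priori be infinite. Integrals
    are therefore kept in the extended reals with nonnegative integrands: [klfun] has the same
    integral as t ln t for densities of total mass one, and identities containing logarithms are
    integrated only after their negative parts have been moved to the other side. The natural scale
    is e = n^(-1/4). The entropy of the wrong marginal is of order e^4; Young's inequality costs a
    square root and gives e^2 for masses moved and for values; the midpoint argument costs another
    and gives e for the weighted total variation. Only updates of the first factor are analysed;
    [pswap] transfers the results to the second. Part (i) is read off from the same quantitative
    estimate as part (ii). *)

Section scalar.
Context {R : realType}.
Implicit Types a h s t x y : R.

(* The integrand of the relative entropy, made nonnegative by adding [1 - t];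
   recall that [ln 0 = 0] here, so [klfun 0 = 1] as it should. *)
Definition klfun (t : R) : R := t * ln t - t + 1.

(** Integrand of the entropy in the opposite direction, of mu relative to t mu; this is what one
    Sinkhorn update adds to the dual value. *)
Definition rklfun (t : R) : R := t - 1 - ln t.

Lemma ln_le_subr1 t : 0 < t -> ln t <= t - 1.
Proof.
move=> t0; have := @le_ln1Dx R (t - 1).
rewrite (_ : 1 + (t - 1) = t); last by ring.
by apply; lra.
Qed.

Lemma ln_ge_1subV t : 0 < t -> 1 - t^-1 <= ln t.
Proof.
move=> t0; have := @ln_le_subr1 t^-1; rewrite invr_gt0 lnV ?posrE// => /(_ t0).
lra.
Qed.

Lemma klfun0 : klfun 0 = 1.
Proof. by rewrite /klfun mul0r subr0 add0r. Qed.

Lemma klfun1 : klfun 1 = 0.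
Proof. by rewrite /klfun ln1 mulr0 add0r addNr. Qed.

(** Hellinger lower bound: write t = s^2, so ln t = 2 ln s, and use ln s >= 1 - 1/s. *)
Lemma klfun_ge_sqrt t : 0 <= t -> (Num.sqrt t - 1) ^+ 2 <= klfun t.
Proof.
rewrite le_eqVlt => /predU1P[<-|t0].
  by rewrite sqrtr0 klfun0 sub0r sqrrN expr1n.
have s0 : 0 < Num.sqrt t by rewrite sqrtr_gt0.
set s := Num.sqrt t in s0 *.
have -> : t = s ^+ 2 by rewrite sqr_sqrtr// ltW.
rewrite /klfun lnXn//.
have h := ln_ge_1subV s0.
have h2 : s ^+ 2 * (1 - s^-1) <= s ^+ 2 * ln s by rewrite ler_wpM2l// sqr_ge0.
have h3 : s ^+ 2 * (1 - s^-1) = s ^+ 2 - s by field; rewrite gt_eqF.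
rewrite h3 in h2; rewrite mulrnAr; nra.
Qed.

Lemma klfun_ge0 t : 0 <= t -> 0 <= klfun t.
Proof. by move=> t0; rewrite (le_trans _ (klfun_ge_sqrt t0))// sqr_ge0. Qed.

Lemma rklfun_ge0 t : 0 < t -> 0 <= rklfun t.
Proof. by move=> t0; rewrite /rklfun subr_ge0 ln_le_subr1. Qed.

(** Pointwise chain rule of the entropy, changing the reference mass from 1 to a; [entropy_chain] is
    its integrated form. *)
Lemma klfun_chain a y : 0 < a -> 0 <= y ->
  klfun y = a * klfun (y / a) + y * ln a - a + 1.
Proof.
move=> a0; rewrite le_eqVlt => /predU1P[<-|y0].
  by rewrite !(mul0r, klfun0); ring.
rewrite /klfun ln_div ?posrE//; field; by rewrite gt_eqF.
Qed.

(** The chain rule with the nonnegative term [a * klfun (y / a)] discarded. *)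
Lemma klfun_tangent a y : 0 < a -> 0 <= y ->
  klfun a + ln a * (y - a) <= klfun y.
Proof.
move=> a0 y0; rewrite (klfun_chain a0 y0).
have := klfun_ge0 (divr_ge0 y0 (ltW a0)); set q := klfun (y / a).
move=> q0; have := mulr_ge0 (ltW a0) q0; rewrite /klfun; nra.
Qed.

Lemma rklfun_tangent a y : 0 < a -> 0 < y ->
  rklfun a + (1 - a^-1) * (y - a) <= rklfun y.
Proof.
move=> a0 y0; rewrite /rklfun.
have := @ln_le_subr1 (y / a); rewrite divr_gt0// => /(_ isT).
rewrite ln_div ?posrE// => H.
have -> : (1 - a^-1) * (y - a) = y - a - (y / a - 1) by field; rewrite gt_eqF.
lra.
Qed.

(** The perspective transform, sending F(t) to t F(1/t), exchanges the two entropies; in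
    [marginal_contraction] this is what makes them alternate. *)
Lemma rklfunV a : 0 < a -> a * rklfun a^-1 = klfun a.
Proof. by move=> a0; rewrite /rklfun /klfun lnV ?posrE//; field; rewrite gt_eqF. Qed.

Lemma klfunV a : 0 < a -> a * klfun a^-1 = rklfun a.
Proof. by move=> a0; rewrite /rklfun /klfun lnV ?posrE//; field; rewrite gt_eqF. Qed.

(** Average the two tangent inequalities at the barycentre. The barycentre 0, where the true slope
    is infinite, is treated apart: both weighted points then vanish. *)
Lemma klfun_convex t x y : 0 <= t <= 1 -> 0 <= x -> 0 <= y ->
  klfun (t * x + (1 - t) * y) <= t * klfun x + (1 - t) * klfun y.
Proof.
move=> /andP[t0 t1] x0 y0.
have [m0|m0] := ltP 0 (t * x + (1 - t) * y).
  have hx := klfun_tangent m0 x0; have hy := klfun_tangent m0 y0.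
  set m := t * x + _ in m0 hx hy *.
  have h1 := ler_wpM2l t0 hx.
  have h2 : (1 - t) * (klfun m + ln m * (y - m)) <= (1 - t) * klfun y.
    by rewrite ler_wpM2l// subr_ge0.
  have : t * (klfun m + ln m * (x - m)) + (1 - t) * (klfun m + ln m * (y - m))
     = klfun m by rewrite {3 6}/m; ring.
  lra.
have tx : t * x = 0 by have := mulr_ge0 t0 x0; nra.
have ty : (1 - t) * y = 0 by have := mulr_ge0 t0 x0; nra.
rewrite tx ty addr0 klfun0.
have e1 : t * klfun x = t.
  move/eqP: tx; rewrite mulf_eq0 => /orP[/eqP ->|/eqP ->]; first by rewrite mul0r.
  by rewrite klfun0 mulr1.
have e2 : (1 - t) * klfun y = 1 - t.
  move/eqP: ty; rewrite mulf_eq0 => /orP[/eqP ->|/eqP ->]; first by rewrite mul0r.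
  by rewrite klfun0 mulr1.
by rewrite e1 e2; lra.
Qed.

(** With [klfun_sqr_ge1], bounds a ((a - b)^+ / a)^2 by 4 klfun h for the two moves (a, b) = (1, h)
    and (h, 1). Both follow from the Hellinger bound by factoring 1 - h through the square root of
    h. *)
Lemma klfun_sqr_le1 h : 0 <= h <= 1 -> (1 - h) ^+ 2 <= 4 * klfun h.
Proof.
move=> /andP[h0 h1]; have := klfun_ge_sqrt h0.
have s0 := sqrtr_ge0 h; have := sqr_sqrtr h0.
set s := Num.sqrt h in s0 *; move=> e.
have s1 : s <= 1 by nra.
have -> : (1 - h) ^+ 2 = (s - 1) ^+ 2 * (1 + s) ^+ 2 by rewrite -e; ring.
have : (1 + s) ^+ 2 <= 4 by nra.
have := sqr_ge0 (s - 1); nra.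
Qed.

Lemma klfun_sqr_ge1 h : 1 <= h -> h * (1 - h^-1) ^+ 2 <= 4 * klfun h.
Proof.
move=> h1; have h0 : 0 <= h by lra.
have := klfun_ge_sqrt h0.
have s0 : 0 < Num.sqrt h by rewrite sqrtr_gt0; lra.
have := sqr_sqrtr h0.
set s := Num.sqrt h in s0 *; move=> e.
have s1 : 1 <= s by nra.
have -> : h * (1 - h^-1) ^+ 2 = (s - 1) ^+ 2 * (1 + s^-1) ^+ 2.
  by rewrite -e; field; rewrite gt_eqF.
have si : 0 < s^-1 <= 1 by rewrite invr_gt0 s0 invf_le1.
have : (1 + s^-1) ^+ 2 <= 4 by nra.
have := sqr_ge0 (s - 1); nra.
Qed.

(* The midpoint convexity defect of [klfun] dominates the squared Hellinger
   distance to the midpoint. *)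
Lemma klfun_midpoint_gap x y s : 0 <= x -> 0 <= y -> 0 <= s ->
  2 * klfun ((x + y) / 2) + s * `|x - y|
    <= klfun x + klfun y + s ^+ 2 * (3 * x + y).
Proof.
move=> x0 y0 s0; pose m := (x + y) / 2.
have [m0|] := ltP 0 m; last first.
  move=> m0; have -> : x = 0 by rewrite /m in m0; lra.
  have -> : y = 0 by rewrite /m in m0; lra.
  have -> : (0 + 0) / 2 = 0 :> R by lra.
  by rewrite subrr normr0 klfun0; lra.
rewrite -/m.
have cx := klfun_chain m0 x0; have cy := klfun_chain m0 y0.
have hx : (Num.sqrt x - Num.sqrt m) ^+ 2 <= m * klfun (x / m).
  have -> : (Num.sqrt x - Num.sqrt m) ^+ 2 = m * (Num.sqrt (x / m) - 1) ^+ 2.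
    have sm0 : Num.sqrt m != 0 by rewrite gt_eqF// sqrtr_gt0.
    have -> : m * (Num.sqrt (x / m) - 1) ^+ 2 =
              Num.sqrt m ^+ 2 * (Num.sqrt (x / m) - 1) ^+ 2.
      by rewrite sqr_sqrtr// ltW.
    by rewrite [Num.sqrt (x / m)]sqrtrM// [Num.sqrt m^-1]sqrtrV ?(ltW m0)//; field.
  by rewrite ler_pM2l// klfun_ge_sqrt// divr_ge0// ltW.
have hy : 0 <= m * klfun (y / m).
  by rewrite mulr_ge0 ?(ltW m0)// klfun_ge0// divr_ge0// ltW.
(* The defect is the sum of the entropies of x and y relative to m; only that of x is kept. *)
have gap : (Num.sqrt x - Num.sqrt m) ^+ 2 <= klfun x + klfun y - 2 * klfun m.
  have : klfun x + klfun y - 2 * klfun m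
     = m * klfun (x / m) + m * klfun (y / m).
    rewrite cx cy (_ : klfun m = m * ln m - m + 1)//.
    by have -> : x = 2 * m - y; [rewrite /m; lra | ring].
  by move=> ->; lra.
(* As x - y = 2 (x - m), its absolute value is 2 A B with A and B the absolute difference and the
   sum of the roots of x and m. Then 2 s A B <= A^2 + s^2 B^2, and B^2 <= 2 (x + m) = 3 x + y
   explains the asymmetric weight. *)
have e : s * `|x - y| =
    2 * (s * (`|Num.sqrt x - Num.sqrt m| * (Num.sqrt x + Num.sqrt m))).
  have -> : x - y = 2 * (x - m) by rewrite /m; lra.
  have -> : x - m = (Num.sqrt x - Num.sqrt m) * (Num.sqrt x + Num.sqrt m).
    have := sqr_sqrtr x0; have := sqr_sqrtr (ltW m0).
    by move=> {1}<- {1}<-; ring.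
  rewrite !normrM (ger0_norm (_ : 0 <= 2 :> R))//.
  rewrite (ger0_norm (_ : 0 <= Num.sqrt x + Num.sqrt m)) ?addr_ge0 ?sqrtr_ge0//.
  by ring.
have q : (Num.sqrt x + Num.sqrt m) ^+ 2 <= 3 * x + y.
  have := sqr_sqrtr x0; have := sqr_sqrtr (ltW m0).
  have := sqr_ge0 (Num.sqrt x - Num.sqrt m).
  have -> : 3 * x + y = 2 * (x + m) by rewrite /m; lra.
  nra.
rewrite e; have := real_normK (num_real (Num.sqrt x - Num.sqrt m)).
move=> nk; rewrite -nk in gap.
set A := `|_| in gap *; set B := Num.sqrt x + Num.sqrt m in q *.
have := sqr_ge0 (A - s * B).
have : s ^+ 2 * B ^+ 2 <= s ^+ 2 * (3 * x + y) by rewrite ler_wpM2l// sqr_ge0.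
nra.
Qed.

(** Fenchel-Young inequality: exp s - 1 is the convex conjugate of [klfun], and s has been
    subtracted on both sides. *)
Lemma klfun_young h s : 0 <= h -> (h - 1) * s <= klfun h + (expR s - 1 - s).
Proof.
rewrite le_eqVlt => /predU1P[<-|h0].
  by rewrite klfun0; have := expR_ge0 s; lra.
have := expR_ge1Dx (s - ln h); rewrite expRD expRN lnK ?posrE// => H.
have : h * (1 + (s - ln h)) <= h * (expR s / h) by rewrite ler_pM2l.
rewrite mulrCA divff ?gt_eqF// mulr1 /klfun; nra.
Qed.

Lemma sqr_le_expR t : 0 <= t -> t ^+ 2 <= 4 * expR t.
Proof.
move=> t0; have := expR_ge1Dx (t / 2).
have -> : expR t = expR (t / 2) ^+ 2 by rewrite expr2 -expRD -splitr.
set u := expR _; nra.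
Qed.

Lemma expR_sub1_le t : 0 <= t -> expR t - 1 <= t * expR t.
Proof.
move=> t0; have := expR_ge1Dx (- t); rewrite expRN => H.
have := ler_wpM2l (expR_ge0 t) H; rewrite divff ?gt_eqF ?expR_gt0//; nra.
Qed.

(** Young's inequality at slope e s or - e s according to the sign of h - 1. The left side is linear
    in e while the remainder exp x - 1 - x is quadratic, whence the square root lost later; e <= 1
    keeps exp (e s) below exp s, and s^2 is absorbed by another exp s. *)
Lemma klfun_weighted_pinsker h s e : 0 <= h -> 0 <= s -> 0 <= e <= 1 ->
  e * s * `|h - 1| <= klfun h + 4 * e ^+ 2 * expR (2 * s).
Proof.
move=> h0 s0 /andP[e0 e1].
have x0 : 0 <= e * s by exact: mulr_ge0.
have es : expR (e * s) <= expR s by rewrite ler_expR; nra.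
have sq := sqr_le_expR s0.
have e2s : expR (2 * s) = expR s ^+ 2 by rewrite mulr2n mulrDl mul1r expRD.
have ex1 := @expR_ge1Dx R s.
have bnd : (e * s) ^+ 2 * expR s <= 4 * e ^+ 2 * expR (2 * s).
  rewrite e2s; have := ler_wpM2l (sqr_ge0 e) (ler_wpM2r (expR_ge0 s) sq).
  by congr (_ <= _); ring.
have [h1|h1] := leP 1 h.
  rewrite ger0_norm ?subr_ge0// mulrC.
  apply: (le_trans (klfun_young _ h0)); rewrite lerD2l.
  apply: le_trans bnd.
  have h2 := expR_sub1_le x0; have h3 := ler_wpM2l x0 h2.
  have h4 := ler_wpM2l (sqr_ge0 (e * s)) es.
  by apply: le_trans h4; set u := expR (e * s) in h2 h3 *; nra.
rewrite ltr0_norm ?subr_lt0//.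
have := klfun_young (- (e * s)) h0.
have : expR (- (e * s)) <= 1 - e * s + (e * s) ^+ 2.
  have := expR_ge1Dx (e * s); rewrite expRN => H.
  have : (expR (e * s))^-1 <= (1 + e * s)^-1 by rewrite lef_pV2 ?posrE//; nra.
  have : (1 + e * s)^-1 <= 1 - e * s + (e * s) ^+ 2.
    rewrite -[X in X <= _]mul1r ler_pdivrMr; last by lra.
    rewrite (_ : _ * (1 + e * s) = 1 + (e * s) ^+ 3); last by ring.
    by rewrite lerDl exprn_ge0.
  lra.
have : (e * s) ^+ 2 <= (e * s) ^+ 2 * expR s by have := sqr_ge0 (e * s); nra.
lra.
Qed.

End scalar.

(** * Integrals and densities *)

Ltac mfun := repeat first
  [ assumption
  | exact: measurable_cst
  | exact: measurable_id
  | exact: measurable_fst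
  | exact: measurable_snd
  | apply: measurable_funD | apply: measurable_funB
  | apply: measurable_funM | apply: measurable_funX
  | apply: measurable_maxr | apply: measurable_minr
  | apply: measurable_fun_pair
  | apply: (measurableT_comp (@normr_measurable _ _))
  | apply: (measurableT_comp (@measurable_ln _))
  | apply: (measurableT_comp (@measurable_expR _))
  | apply: (measurableT_comp (@oppr_measurable _ _))
  | apply: (measurableT_comp (@measurable_powR _ _)) ].

Section real_integrals.
Context d (T : measurableType d) (R : realType) (mu : {measure set T -> \bar R}).
Implicit Types f g : T -> R.
Local Open Scope ereal_scope.

Lemma le_integralR f g : (forall x, 0 <= f x)%R -> measurable_fun setT f ->
  measurable_fun setT g -> (forall x, f x <= g x)%R ->
  \int[mu]_x (f x)%:E <= \int[mu]_x (g x)%:E.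
Proof.
move=> f0 mf mg fg; apply: ge0_le_integral => //.
- by move=> x _; rewrite lee_fin.
- exact/measurable_EFinP.
- exact/measurable_EFinP.
- by move=> x _; rewrite lee_fin.
Qed.

Lemma integralR_ge0 f : (forall x, 0 <= f x)%R -> 0 <= \int[mu]_x (f x)%:E.
Proof. by move=> f0; apply: integral_ge0 => x _; rewrite lee_fin. Qed.

Lemma integralRD f g : (forall x, 0 <= f x)%R -> measurable_fun setT f ->
  (forall x, 0 <= g x)%R -> measurable_fun setT g ->
  \int[mu]_x (f x + g x)%:E = \int[mu]_x (f x)%:E + \int[mu]_x (g x)%:E.
Proof.
move=> f0 mf g0 mg; under eq_integral do rewrite EFinD.
rewrite ge0_integralD//.
- by move=> x _; rewrite lee_fin.
- exact/measurable_EFinP.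
- by move=> x _; rewrite lee_fin.
- exact/measurable_EFinP.
Qed.

Lemma integralRZ f (k : R) : (0 <= k)%R -> (forall x, 0 <= f x)%R ->
  measurable_fun setT f ->
  \int[mu]_x (k * f x)%:E = k%:E * \int[mu]_x (f x)%:E.
Proof.
move=> k0 f0 mf; under eq_integral do rewrite EFinM.
rewrite ge0_integralZl_EFin//.
- by move=> x _; rewrite lee_fin.
- exact/measurable_EFinP.
Qed.

Lemma integrableR f : measurable_fun setT f ->
  \int[mu]_x (`|f x|%R)%:E < +oo -> mu.-integrable setT (EFin \o f).
Proof. by move=> mf fi; apply/integrableP; split; [exact/measurable_EFinP|]. Qed.

Lemma integrableR_ge0 f : (forall x, 0 <= f x)%R -> measurable_fun setT f ->
  \int[mu]_x (f x)%:E < +oo -> mu.-integrable setT (EFin \o f).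
Proof.
move=> f0 mf fi; apply: integrableR => //.
by under eq_integral do rewrite ger0_norm//.
Qed.

Lemma integrableR_abs f : mu.-integrable setT (EFin \o f) ->
  \int[mu]_x (`|f x|%R)%:E < +oo.
Proof. by move=> /integrableP[_]. Qed.

Lemma le_integrableR f g : measurable_fun setT f ->
  mu.-integrable setT (EFin \o g) -> (forall x, `|f x| <= g x)%R ->
  mu.-integrable setT (EFin \o f).
Proof.
move=> mf gi fg; apply: le_integrable gi => //; first exact/measurable_EFinP.
move=> x _ /=; rewrite lee_fin (le_trans (fg x))//.
exact: ler_norm.
Qed.

Lemma integral_lincomb f g (a b : R) :
  mu.-integrable setT (EFin \o f) -> mu.-integrable setT (EFin \o g) ->
  \int[mu]_x (a * f x + b * g x)%:E =
  a%:E * \int[mu]_x (f x)%:E + b%:E * \int[mu]_x (g x)%:E.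
Proof.
move=> fi gi.
under eq_integral do rewrite EFinD !EFinM.
rewrite (@integralD _ _ _ mu setT measurableT (fun x => a%:E * (f x)%:E)
  (fun x => b%:E * (g x)%:E)).
- by rewrite !integralZl.
- exact: integrableZl.
- exact: integrableZl.
Qed.

Lemma integrable_lincomb f g (a b : R) :
  mu.-integrable setT (EFin \o f) -> mu.-integrable setT (EFin \o g) ->
  mu.-integrable setT (fun x => (a * f x + b * g x)%:E).
Proof.
move=> fi gi.
have -> : (fun x => (a * f x + b * g x)%:E) =
          ((fun x => a%:E * (f x)%:E) \+ (fun x => b%:E * (g x)%:E)).
  by apply/funext => x /=; rewrite EFinD !EFinM.
by apply: integrableD => //; exact: integrableZl.
Qed.

(* Jensen's inequality for the probability [w mu] in the form of an affine
   minorant [c + s (y - a)] whose value at the barycentre [a] is [c]. *)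
Lemma integral_affine_minorant (w y F : T -> R) (a c s : R) :
  (forall x, 0 <= w x)%R -> measurable_fun setT w -> \int[mu]_x (w x)%:E = 1 ->
  measurable_fun setT y -> (forall x, 0 <= y x)%R ->
  \int[mu]_x (y x * w x)%:E = a%:E ->
  measurable_fun setT F -> (forall x, 0 <= F x)%R ->
  (forall x, c + s * (y x - a) <= F x)%R ->
  c%:E <= \int[mu]_x (F x * w x)%:E.
Proof.
move=> w0 mw w1 my y0 ya mF F0 H.
(* Once the right side is finite, all terms are integrable and the minorant, which has no sign, may
   be integrated. *)
have [->|Foo] := eqVneq (\int[mu]_x (F x * w x)%:E) +oo; first by rewrite leey.
have mFw : measurable_fun setT (fun x => F x * w x)%R by mfun.
have Fw0 x : (0 <= F x * w x)%R by rewrite mulr_ge0.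
have iF : mu.-integrable setT (fun x => (F x * w x)%:E).
  by apply: (@integrableR_ge0 (fun x => F x * w x)%R) => //; rewrite ltey.
have iw : mu.-integrable setT (EFin \o w).
  by apply: integrableR_ge0 => //; rewrite w1 ltry.
have iy : mu.-integrable setT (EFin \o (fun x => y x * w x)%R).
  apply: integrableR_ge0 => //; [by move=> x; rewrite mulr_ge0|by mfun|].
  by rewrite ya ltry.
have -> : c%:E = \int[mu]_x ((c - s * a) * w x + s * (y x * w x))%:E.
  rewrite (@integral_lincomb w (fun x => y x * w x)%R)// w1 ya mule1 -EFinM -EFinD.
  by congr EFin; ring.
apply: le_integral => //.
  exact: (@integrable_lincomb w (fun x => y x * w x)%R).
move=> x _; rewrite lee_fin.
have := ler_wpM2r (w0 x) (H x); apply: le_trans.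
by rewrite le_eqVlt; apply/orP; left; apply/eqP; ring.
Qed.

End real_integrals.

Section densities.
Context d (T : measurableType d) (R : realType).
Local Open Scope ereal_scope.

Definition mdensity (M : {measure set T -> \bar R}) (H : T -> R)
  (A : set T) : \bar R := \int[M]_(x in A) (H x)%:E.

Section measure_of_density.
Variables (M : {measure set T -> \bar R}) (H : T -> R).
Hypotheses (mH : measurable_fun setT H) (H0 : forall x, (0 <= H x)%R).

Let mdensity0 : mdensity M H set0 = 0.
Proof. by rewrite /mdensity integral_set0. Qed.

Let mdensity_ge0 A : 0 <= mdensity M H A.
Proof. by apply: integral_ge0 => x _; rewrite lee_fin. Qed.

Let mdensity_sigma_additive : semi_sigma_additive (mdensity M H).
Proof. by apply: semi_sigma_additive_nng_induced => //; exact/measurable_EFinP. Qed.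

Let nu : {measure set T -> \bar R} :=
  HB.pack (mdensity M H)
    (isMeasure.Build _ _ _ _ mdensity0 mdensity_ge0 mdensity_sigma_additive).

Lemma probability_of_density : \int[M]_x (H x)%:E = 1 ->
  exists P : probability T R,
    forall A, measurable A -> P A = \int[M]_(x in A) (H x)%:E.
Proof.
move=> H1; have nu1 : nu setT = 1 by [].
pose q := Measure_isProbability.Build _ _ _ nu nu1.
pose P : probability T R := HB.pack (nu : set T -> \bar R) nu q.
by exists P.
Qed.

Lemma finite_measure_of_density : \int[M]_x (H x)%:E < +oo ->
  exists P : {finite_measure set T -> \bar R},
    forall A, measurable A -> P A = \int[M]_(x in A) (H x)%:E.
Proof.
move=> Hoo; have nufin : fin_num_fun nu.
  move=> A mA; rewrite ge0_fin_numE//; apply: le_lt_trans Hoo.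
  apply: ge0_subset_integral => //; [exact/measurable_EFinP|].
  by move=> x _; rewrite lee_fin.
pose q := Measure_isFinite.Build _ _ _ nu nufin.
pose P : {finite_measure set T -> \bar R} := HB.pack (nu : set T -> \bar R) nu q.
by exists P.
Qed.

End measure_of_density.

Lemma integral_cst_prob (P : probability T R) (r : R) : \int[P]_x r%:E = r%:E.
Proof.
have := @integral_cst _ _ _ P setT measurableT r%:E.
move=> /= ->; rewrite -[RHS]mule1; congr (_ * _); exact: probability_setT.
Qed.

(** The change of variables holds for the Radon-Nikodym derivative of P, which agrees with [H]
    almost everywhere because both have the same integral over every measurable set. *)
Lemma ge0_integral_density (P : {finite_measure set T -> \bar R})
    (M : probability T R) (H f : T -> R) :
  measurable_fun setT H -> (forall x, 0 <= H x)%R ->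
  (forall A, measurable A -> P A = \int[M]_(x in A) (H x)%:E) ->
  measurable_fun setT f -> (forall x, 0 <= f x)%R ->
  \int[P]_x (f x)%:E = \int[M]_x (f x * H x)%:E.
Proof.
move=> mH H0 PH mf f0.
have PM : P `<< M.
  apply/null_content_dominatesP => A mA MA; rewrite PH//.
  apply: null_set_integral => //.
  exact/measurable_EFinP/measurable_funTS.
rewrite -(Radon_Nikodym_SigmaFinite.change_of_variables PM)//; last first.
  exact/measurable_EFinP.
have iH : M.-integrable setT (EFin \o H).
  by apply: integrableR_ge0 => //; rewrite -PH// -ge0_fin_numE// fin_num_measure.
have fR := Radon_Nikodym_SigmaFinite.f_integrable PM.
have mR := measurable_int _ fR.
apply: ge0_ae_eq_integral => //.
- apply: emeasurable_funM => //; exact/measurable_EFinP.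
- by apply/measurable_EFinP; mfun.
- by move=> x _; rewrite mule_ge0// ?lee_fin// Radon_Nikodym_SigmaFinite.f_ge0.
- by move=> x _; rewrite lee_fin mulr_ge0.
have : ae_eq M setT (EFin \o H) (Radon_Nikodym_SigmaFinite.f P M).
  apply: integral_ae_eq => // E _ mE.
  by rewrite -PH// -(Radon_Nikodym_SigmaFinite.f_integral PM).
by apply: filterS => x /= /(_ I) <- _; rewrite EFinM.
Qed.

Lemma density_unique (M : {measure set T -> \bar R}) (H H' : T -> R) :
  measurable_fun setT H -> (forall x, 0 <= H x)%R ->
  \int[M]_x (H x)%:E < +oo ->
  measurable_fun setT H' ->
  (forall A, measurable A ->
    \int[M]_(x in A) (H x)%:E = \int[M]_(x in A) (H' x)%:E) ->
  {ae M, forall x, H x = H' x}.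
Proof.
move=> mH H0 Hoo mH' HH'.
have : ae_eq M setT (EFin \o H) (EFin \o H').
  apply: integral_ae_eq => //; first exact: integrableR_ge0.
    exact/measurable_EFinP.
  by move=> E _ mE; exact: HH'.
by apply: filterS => x /= /(_ I) [].
Qed.

Lemma ae_eq_integralR (M : {measure set T -> \bar R}) (f g : T -> R) :
  measurable_fun setT f -> measurable_fun setT g ->
  {ae M, forall x, f x = g x} ->
  \int[M]_x (f x)%:E = \int[M]_x (g x)%:E.
Proof.
move=> mf mg fg; apply: ae_eq_integral => //; [exact/measurable_EFinP..|].
by apply: filterS fg => x -> _.
Qed.

End densities.

(** * Relative entropy, marginals and exchange of factors *)

Section relative_entropy.
Context (R : realType).
Local Open Scope ereal_scope.

Lemma measurable_klfun : measurable_fun setT (@klfun R).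
Proof. by rewrite /klfun; mfun. Qed.

Lemma measurable_rklfun : measurable_fun setT (@rklfun R).
Proof. by rewrite /rklfun; mfun. Qed.

(** Both sides may be infinite, so [ln h] is split into its parts [p] and [q]. Since - t ln t <= 1
    for t >= 0, the negative part has a finite integral against P and can be cancelled. *)
Lemma integral_ln_density d (T : measurableType d) (P M : probability T R)
    (h : T -> R) : is_density P M h ->
  \int[P]_x (ln (h x))%:E = \int[M]_x (klfun (h x))%:E.
Proof.
move=> [mh h0 Ph].
pose p x : R := (Num.max (ln (h x)) 0)%R; pose q x : R := (Num.max (- ln (h x)) 0)%R.
have mp : measurable_fun setT p by rewrite /p; mfun.
have mq : measurable_fun setT q by rewrite /q; mfun.
have p0 x : (0 <= p x)%R by rewrite /p le_max lexx orbT.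
have q0 x : (0 <= q x)%R by rewrite /q le_max lexx orbT.
have mk : measurable_fun setT (fun x => klfun (h x)).
  exact: measurableT_comp measurable_klfun mh.
have k0 x : (0 <= klfun (h x))%R by exact: klfun_ge0.
have h1 : \int[M]_x (h x)%:E = 1 by rewrite -Ph// probability_setT.
have qh1 x : (q x * h x <= 1)%R.
  rewrite /q; have [l|l] := leP (- ln (h x))%R 0%R.
    by rewrite mul0r.
  by have := k0 x; rewrite /klfun; have := h0 x; nra.
have -> : \int[P]_x (ln (h x))%:E = \int[P]_x (p x)%:E - \int[P]_x (q x)%:E.
  rewrite integralE; congr (_ - _).
  - by apply: eq_integral => x _; rewrite funeposE /= /p EFin_max.
  - by apply: eq_integral => x _; rewrite funenegE /= /q EFin_max.
rewrite (ge0_integral_density mh h0 Ph mp p0) (ge0_integral_density mh h0 Ph mq q0).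
have qfin : \int[M]_x (q x * h x)%:E \is a fin_num.
  rewrite ge0_fin_numE; last by apply: integralR_ge0 => x; rewrite mulr_ge0.
  apply: (@le_lt_trans _ _ (\int[M]_x 1%:E)).
    by apply: le_integralR => //; [move=> x; rewrite mulr_ge0|mfun].
  by rewrite integral_cst_prob ltry.
(* Integrated form of klfun h + q h + h = p h + 1, in which every term is nonnegative. *)
have key : \int[M]_x (klfun (h x))%:E + \int[M]_x (q x * h x)%:E + 1 =
           \int[M]_x (p x * h x)%:E + 1.
  rewrite -{1}h1 -integralRD//; [|by move=> x; rewrite mulr_ge0|by mfun].
  rewrite -integralRD//; [|by move=> x; rewrite addr_ge0// mulr_ge0|by mfun].
  have <- : \int[M]_x 1%:E = 1 := integral_cst_prob M 1.
  rewrite -integralRD//; [|by move=> x; rewrite mulr_ge0|by mfun].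
  apply: eq_integral => x _; congr EFin.
  rewrite /p /q /klfun /=; have [l|l] := leP (ln (h x)) 0%R.
    by rewrite max_l ?oppr_ge0//; ring.
  by rewrite max_r ?oppr_le0 ?ltW//; ring.
have <- : \int[M]_x (klfun (h x))%:E + \int[M]_x (q x * h x)%:E =
          \int[M]_x (p x * h x)%:E.
  have := congr1 (fun z => z - 1) key.
  by rewrite !addeK.
by rewrite addeK.
Qed.

(** The infimum defining [KL] runs over a single value, because two densities of P agree M-almost
    everywhere. *)
Lemma KL_density d (T : measurableType d) (P M : probability T R)
    (H : T -> R) : is_density P M H ->
  KL P M = \int[M]_x (klfun (H x))%:E.
Proof.
move=> dH; rewrite /KL.
suff -> : [set v | exists h, is_density P M h /\ v = \int[P]_x (ln (h x))%:E]
   = [set \int[M]_x (klfun (H x))%:E] by rewrite ereal_inf1.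
apply/seteqP; split => [v [h [dh ->]]|_ ->] /=; last first.
  by exists H; split => //; rewrite (integral_ln_density dH).
rewrite (integral_ln_density dh).
case: dh dH => mh h0 Ph [mH H0 PH].
apply: ae_eq_integralR; [exact: measurableT_comp measurable_klfun _..|].
have : {ae M, forall x, h x = H x}.
  apply: density_unique => //.
    by rewrite -Ph// probability_setT ltry.
  by move=> A mA; rewrite -Ph// PH.
by apply: filterS => x ->.
Qed.

Lemma KL_lty_density d (T : measurableType d) (P M : probability T R) :
  KL P M < +oo -> exists H, is_density P M H.
Proof.
move=> KLoo; apply: contrapT => nex; move: KLoo; rewrite /KL.
suff -> : [set v | exists h, is_density P M h /\ v = \int[P]_x (ln (h x))%:E]
   = set0 by rewrite ereal_inf0 ltxx.
by apply/seteqP; split => // v [h [dh _]]; apply: nex; exists h.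
Qed.

End relative_entropy.

Section marginals.
Context {R : realType} {d1 d2 : measure_display}
  {X1 : measurableType d1} {X2 : measurableType d2}.
Variables (mu1 : probability X1 R) (mu2 : probability X2 R).
Local Open Scope ereal_scope.
Implicit Types H : X1 * X2 -> R.

(** Almost everywhere and in the extended reals: the partial integrals may be infinite on a null
    set. *)
Definition has_marg1 H (a : X1 -> R) :=
  {ae mu1, forall x, \int[mu2]_y (H (x, y))%:E = (a x)%:E}.

Definition has_marg2 H (b : X2 -> R) :=
  {ae mu2, forall y, \int[mu1]_x (H (x, y))%:E = (b y)%:E}.

Lemma integral_prod1 H : measurable_fun setT H -> (forall z, 0 <= H z)%R ->
  \int[mu1 \x mu2]_z (H z)%:E = \int[mu1]_x \int[mu2]_y (H (x, y))%:E.
Proof.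
move=> mH H0; rewrite (fubini_tonelli1 (EFin \o H))//.
exact/measurable_EFinP.
Qed.

Lemma integral_prod2 H : measurable_fun setT H -> (forall z, 0 <= H z)%R ->
  \int[mu1 \x mu2]_z (H z)%:E = \int[mu2]_y \int[mu1]_x (H (x, y))%:E.
Proof.
move=> mH H0; rewrite (fubini_tonelli2 (EFin \o H))//.
exact/measurable_EFinP.
Qed.

Lemma measurable_integral1 H : measurable_fun setT H -> (forall z, 0 <= H z)%R ->
  measurable_fun setT (fun x => \int[mu2]_y (H (x, y))%:E).
Proof.
move=> mH H0.
apply: (@measurable_fun_fubini_tonelli_F _ _ _ _ _ mu2 (EFin \o H)) => //.
exact/measurable_EFinP.
Qed.

Lemma measurable_integral2 H : measurable_fun setT H -> (forall z, 0 <= H z)%R ->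
  measurable_fun setT (fun y => \int[mu1]_x (H (x, y))%:E).
Proof.
move=> mH H0.
apply: (@measurable_fun_fubini_tonelli_G _ _ _ _ _ mu1 (EFin \o H)) => //.
exact/measurable_EFinP.
Qed.

Lemma integral_marg1 H a (f : X1 -> R) : measurable_fun setT H ->
  (forall z, 0 <= H z)%R -> measurable_fun setT a -> has_marg1 H a ->
  measurable_fun setT f -> (forall x, 0 <= f x)%R ->
  \int[mu1 \x mu2]_z (f z.1 * H z)%:E = \int[mu1]_x (f x * a x)%:E.
Proof.
move=> mH H0 ma Ha mf f0.
have mf1 : measurable_fun [set: X1 * X2] (fun z => f z.1).
  exact: measurableT_comp mf _.
have mfH : measurable_fun setT (fun z => f z.1 * H z)%R by mfun.
have fH0 z : (0 <= f z.1 * H z)%R by rewrite mulr_ge0.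
rewrite integral_prod1//; apply: ae_eq_integral => //.
- exact: (@measurable_integral1 (fun z => f z.1 * H z)%R).
- by apply/measurable_EFinP; mfun.
apply: filterS Ha => x Hx _ /=.
rewrite EFinM -Hx -ge0_integralZl_EFin//.
- by move=> y _; rewrite lee_fin.
- by apply/measurable_EFinP; exact: measurable_fun_pair2.
Qed.

Lemma integral_marg2 H b (f : X2 -> R) : measurable_fun setT H ->
  (forall z, 0 <= H z)%R -> measurable_fun setT b -> has_marg2 H b ->
  measurable_fun setT f -> (forall x, 0 <= f x)%R ->
  \int[mu1 \x mu2]_z (f z.2 * H z)%:E = \int[mu2]_x (f x * b x)%:E.
Proof.
move=> mH H0 ma Ha mf f0.
have mf1 : measurable_fun [set: X1 * X2] (fun z => f z.2).
  exact: measurableT_comp mf _.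
have mfH : measurable_fun setT (fun z => f z.2 * H z)%R by mfun.
have fH0 z : (0 <= f z.2 * H z)%R by rewrite mulr_ge0.
rewrite integral_prod2//; apply: ae_eq_integral => //.
- exact: (@measurable_integral2 (fun z => f z.2 * H z)%R).
- by apply/measurable_EFinP; mfun.
apply: filterS Ha => x Hx _ /=.
rewrite EFinM -Hx -ge0_integralZl_EFin//.
- by move=> y _; rewrite lee_fin.
- by apply/measurable_EFinP; exact: measurable_fun_pair1.
Qed.

Lemma integral_total1 H a : measurable_fun setT H -> (forall z, 0 <= H z)%R ->
  measurable_fun setT a -> has_marg1 H a ->
  \int[mu1 \x mu2]_z (H z)%:E = \int[mu1]_x (a x)%:E.
Proof.
move=> mH H0 ma Ha; have := @integral_marg1 H a (cst 1%R) mH H0 ma Ha.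
move=> /(_ (measurable_cst _) (fun=> ler01)).
by under eq_integral do rewrite /= mul1r; under [in RHS]eq_integral do rewrite /= mul1r.
Qed.

(** Passes from the conditions on cylinders in [is_coupling] to densities; [sets_of_has_marg1] goes
    back. *)
Lemma has_marg1_of_sets H (a : X1 -> R) :
  measurable_fun setT H -> (forall z, 0 <= H z)%R ->
  \int[mu1 \x mu2]_z (H z)%:E < +oo ->
  measurable_fun setT a ->
  (forall A, measurable A ->
    \int[mu1 \x mu2]_(z in A `*` setT) (H z)%:E = \int[mu1]_(x in A) (a x)%:E) ->
  has_marg1 H a.
Proof.
move=> mH H0 Hoo ma HA.
have : ae_eq mu1 setT (fun x => \int[mu2]_y (H (x, y))%:E) (EFin \o a).
  apply: integral_ae_eq => //.
  - apply/integrableP; split; first exact: measurable_integral1.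
    under eq_integral do rewrite gee0_abs ?integralR_ge0//.
    by rewrite -integral_prod1.
  - exact/measurable_EFinP.
  - move=> E _ mE; rewrite -HA//.
    rewrite [RHS]integral_mkcond [LHS]integral_mkcond.
    pose F z := (\1_(E `*` [set: X2]) z * H z)%R.
    have mF : measurable_fun setT F.
      by rewrite /F; apply: measurable_funM => //; apply: measurable_indic; exact: measurableX.
    have F0 z : (0 <= F z)%R by rewrite /F mulr_ge0.
    transitivity (\int[mu1 \x mu2]_z (F z)%:E); last first.
      apply: eq_integral => z _; rewrite /F patchE indicE.
      by case: ifPn => _; rewrite ?mul1r ?mul0r.
    rewrite integral_prod1//; apply: eq_integral => x _.
    rewrite patchE /F; case: ifPn => xE.
      by apply: eq_integral => y _; rewrite indicE mem_set ?mul1r//; split => //; exact: set_mem.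
    rewrite integral0_eq// => y _; rewrite indicE memNset ?mul0r// => -[/= /mem_set].
    by move: xE => /negP.
by apply: filterS => x /= /(_ I).
Qed.

Lemma sets_of_has_marg1 H (a : X1 -> R) A :
  measurable_fun setT H -> (forall z, 0 <= H z)%R ->
  measurable_fun setT a -> has_marg1 H a -> measurable A ->
  \int[mu1 \x mu2]_(z in A `*` setT) (H z)%:E = \int[mu1]_(x in A) (a x)%:E.
Proof.
move=> mH H0 ma Ha mA.
have e : \int[mu1 \x mu2]_z (\1_A z.1 * H z)%:E = \int[mu1]_x (\1_A x * a x)%:E.
  by apply: integral_marg1 => //; exact: measurable_indic.
rewrite [LHS]integral_mkcond [RHS]integral_mkcond.
transitivity (\int[mu1 \x mu2]_z (\1_A z.1 * H z)%:E).
  apply: eq_integral => z _; rewrite patchE indicE.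
  have -> : (z \in A `*` setT) = (z.1 \in A).
    by apply/idP/idP; rewrite !inE /=; [case|].
  by case: ifPn => _; rewrite ?mul1r ?mul0r.
rewrite e//; apply: eq_integral => z _; rewrite patchE indicE.
by case: ifPn => _; rewrite ?mul1r ?mul0r.
Qed.

End marginals.

Section swap.
Context {R : realType} {d1 d2 : measure_display}
  {X1 : measurableType d1} {X2 : measurableType d2}.
Variables (mu1 : probability X1 R) (mu2 : probability X2 R).
Local Open Scope ereal_scope.
Implicit Types H : X1 * X2 -> R.

Definition pswap (H : X1 * X2 -> R) : X2 * X1 -> R := fun z => H (z.2, z.1).

Lemma measurable_pswap H : measurable_fun setT H -> measurable_fun setT (pswap H).
Proof.
move=> mH; apply: (measurableT_comp mH).
exact: measurable_fun_pair measurable_snd measurable_fst.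
Qed.

Lemma integral_pswap H : measurable_fun setT H -> (forall z, 0 <= H z)%R ->
  \int[mu2 \x mu1]_z (pswap H z)%:E = \int[mu1 \x mu2]_z (H z)%:E.
Proof.
move=> mH H0; have mS := measurable_pswap mH.
have S0 z : (0 <= pswap H z)%R by exact: H0.
by rewrite (integral_prod1 _ _ mS S0) (integral_prod2 _ _ mH H0).
Qed.

End swap.

(** * Shadows of densities *)

Section jensen.
Context d (T : measurableType d) (R : realType) (mu : {measure set T -> \bar R}).
Variables (w y : T -> R) (m : R).
Hypotheses (w0 : forall x, 0 <= w x) (mw : measurable_fun setT w)
  (w1 : (\int[mu]_x (w x)%:E = 1)%E)
  (my : measurable_fun setT y) (ym : (\int[mu]_x (y x * w x)%:E = m%:E)%E).
Local Open Scope ereal_scope.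

Lemma jensen_klfun : (forall x, 0 <= y x)%R ->
  (klfun m)%:E <= \int[mu]_x (klfun (y x) * w x)%:E.
Proof.
move=> y0.
have mF : measurable_fun setT (fun x => klfun (y x)).
  exact: measurableT_comp (@measurable_klfun R) my.
have F0 x : (0 <= klfun (y x))%R by exact: klfun_ge0.
have : (0 <= m)%R.
  by rewrite -lee_fin -ym; apply: integralR_ge0 => x; rewrite mulr_ge0.
rewrite le_eqVlt => /predU1P[m0|m0]; last first.
  apply: (@integral_affine_minorant _ _ _ _ w y _ m _ (ln m)) => // x.
  exact: klfun_tangent.
(* There is no tangent at m = 0. The tangent at e > 0 takes the value 1 - e at 0, and e is
   arbitrary. *)
rewrite -m0 klfun0; apply/lee_addgt0Pr => e e0.
rewrite -leeBlDr// -EFinB.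
apply: (@integral_affine_minorant _ _ _ _ w y _ m _ (ln e)) => // x.
rewrite -m0 subr0; have := klfun_tangent e0 (y0 x); rewrite {1}/klfun.
by apply: le_trans; rewrite le_eqVlt; apply/orP; left; apply/eqP; ring.
Qed.

Lemma jensen_rklfun : (forall x, 0 < y x)%R -> (0 < m)%R ->
  (rklfun m)%:E <= \int[mu]_x (rklfun (y x) * w x)%:E.
Proof.
move=> y0 m0.
have mF : measurable_fun setT (fun x => rklfun (y x)).
  exact: measurableT_comp (@measurable_rklfun R) my.
apply: (@integral_affine_minorant _ _ _ _ w y _ m _ (1 - m^-1)) => // x.
- exact: ltW.
- exact: rklfun_ge0.
- exact: rklfun_tangent.
Qed.

End jensen.

Lemma measurable_funV d (T : measurableType d) (R : realType) (f : T -> R) :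
  measurable_fun setT f -> (forall x, 0 < f x) ->
  measurable_fun setT (fun x => (f x)^-1).
Proof.
move=> mf f0.
have -> : (fun x => (f x)^-1) = (fun x => expR (- ln (f x))).
  by apply/funext => x; rewrite expRN lnK// posrE.
by mfun.
Qed.

Section shadow.
Context {R : realType} {d1 d2 : measure_display}
  {X1 : measurableType d1} {X2 : measurableType d2}.
Variables (mu1 : probability X1 R) (mu2 : probability X2 R).
Variables (H : X1 * X2 -> R) (a b : X2 -> R).
Hypotheses (mH : measurable_fun setT H) (H0 : forall z, 0 <= H z)
  (ma : measurable_fun setT a) (a0 : forall y, 0 < a y)
  (mb : measurable_fun setT b) (b0 : forall y, 0 < b y)
  (H1 : has_marg1 mu1 mu2 H (cst 1)) (H2 : has_marg2 mu1 mu2 H a)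
  (b1 : (\int[mu2]_y (b y)%:E = 1)%E).
Local Open Scope ereal_scope.

(** [D] and [E] are the excess and the deficit of mass over y, with common total [tau]; [Q] is the
    conditional density given y. [L] is the mass removed, of first marginal [tau * w], and [G] puts
    it back as a product of [E] and [w], so the first marginal does not change. If [tau] is 0,
    division gives [w = 0], which is consistent because [D] and [E] then vanish almost
    everywhere. *)
Let D y : R := Num.max (a y - b y)%R 0%R.
Let E y : R := Num.max (b y - a y)%R 0%R.
Let Q z : R := (H z / a z.2)%R.
Let tau : R := fine (\int[mu2]_y (D y)%:E).
Let w x : R := (fine (\int[mu2]_y (Q (x, y) * D y)%:E) / tau)%R.
Let G z : R := (E z.2 * w z.1)%R.
Let L z : R := (Q z * D z.2)%R.
Let S z : R := (Q z * Num.min (a z.2) (b z.2) + G z)%R.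

Let mD : measurable_fun setT D. Proof. by rewrite /D; mfun. Qed.
Let mE : measurable_fun setT E. Proof. by rewrite /E; mfun. Qed.
Let mQ : measurable_fun setT Q.
Proof.
rewrite /Q; apply: measurable_funM => //.
exact: measurableT_comp (measurable_funV ma a0) measurable_snd.
Qed.
Let mD2 : measurable_fun setT (fun z : X1 * X2 => D z.2).
Proof. exact: measurableT_comp mD measurable_snd. Qed.
Let mE2 : measurable_fun setT (fun z : X1 * X2 => E z.2).
Proof. exact: measurableT_comp mE measurable_snd. Qed.
Let mL : measurable_fun setT L. Proof. by rewrite /L; mfun. Qed.
Let D0 y : (0 <= D y)%R. Proof. by rewrite /D le_max lexx orbT. Qed.
Let E0 y : (0 <= E y)%R. Proof. by rewrite /E le_max lexx orbT. Qed.
Let Q0 z : (0 <= Q z)%R. Proof. by rewrite /Q divr_ge0// ltW. Qed.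
Let L0 z : (0 <= L z)%R. Proof. by rewrite /L mulr_ge0. Qed.
Let tau0 : (0 <= tau)%R. Proof. by rewrite /tau fine_ge0// integralR_ge0. Qed.
Let w0 x : (0 <= w x)%R.
Proof.
rewrite /w divr_ge0// fine_ge0// integralR_ge0// => y.
by rewrite mulr_ge0.
Qed.
Let mw : measurable_fun setT w.
Proof.
rewrite /w; apply: measurable_funM => //.
apply: (measurableT_comp (fine_measurable measurableT)).
exact: (measurable_integral1 mu2 mL L0).
Qed.
Let mw1 : measurable_fun setT (fun z : X1 * X2 => w z.1).
Proof. exact: measurableT_comp mw measurable_fst. Qed.
Let mG : measurable_fun setT G. Proof. by rewrite /G; mfun. Qed.
Let G0 z : (0 <= G z)%R. Proof. by rewrite /G mulr_ge0. Qed.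

Let ma2 : measurable_fun setT (fun z : X1 * X2 => a z.2).
Proof. exact: measurableT_comp ma measurable_snd. Qed.
Let mb2 : measurable_fun setT (fun z : X1 * X2 => b z.2).
Proof. exact: measurableT_comp mb measurable_snd. Qed.

Let int_a : \int[mu2]_y (a y)%:E = 1.
Proof.
have := integral_marg2 mH H0 ma H2 (measurable_cst (1%R : R)) (fun=> ler01).
under eq_integral do rewrite /= mul1r.
under [in RHS]eq_integral do rewrite /= mul1r.
by move=> <-; rewrite (integral_total1 mH H0 _ H1)//= integral_cst_prob.
Qed.

Let int_D : \int[mu2]_y (D y)%:E = tau%:E.
Proof.
rewrite /tau fineK// ge0_fin_numE ?integralR_ge0//.
apply: (@le_lt_trans _ _ (\int[mu2]_y (a y)%:E)); last by rewrite int_a ltry.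
apply: le_integralR => // y; rewrite /D ge_max lerBlDr lerDl !ltW//.
Qed.

Let int_E : \int[mu2]_y (E y)%:E = tau%:E.
Proof.
have e : \int[mu2]_y (a y)%:E + \int[mu2]_y (E y)%:E =
         \int[mu2]_y (b y)%:E + \int[mu2]_y (D y)%:E.
  rewrite -!integralRD//; try by move=> y; exact: ltW.
  apply: eq_integral => y _; congr EFin; rewrite /D /E.
  by have [h|h] := leP (a y) (b y);
    [rewrite max_l ?subr_ge0// max_r ?subr_le0//|
     rewrite max_r ?subr_le0 ?(ltW h)// max_l ?subr_ge0 ?(ltW h)//]; ring.
rewrite -int_D; move: e; rewrite int_a b1.
move/(congr1 (fun z => z - 1)); rewrite ![1 + _]addeC !addeK//.
Qed.

Let marg2_Q : has_marg2 mu1 mu2 Q (cst 1%R).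
Proof.
apply: filterS H2 => y Hy.
rewrite /Q; under eq_integral do rewrite /= mulrC.
rewrite integralRZ ?invr_ge0 ?(ltW (a0 y))//; last exact: measurable_fun_pair1.
by rewrite Hy -EFinM mulVf// gt_eqF.
Qed.

Let marg1_L : has_marg1 mu1 mu2 L (fun x => tau * w x)%R.
Proof.
have [t0|t0] := eqVneq tau 0%R.
  have Dae : ae_eq mu2 setT (EFin \o D) (cst 0).
    apply/ae_eq_integral_abs => //; first exact/measurable_EFinP.
    under eq_integral do rewrite /= ger0_norm//.
    by rewrite int_D t0.
  apply: aeW => x; rewrite t0 mul0r.
  rewrite (@ae_eq_integral _ _ _ _ _ (cst 0))// ?integral0//.
    by apply/measurable_EFinP; exact: measurable_fun_pair2.
  by apply: filterS Dae => y /(_ I) [Dy] _; rewrite /L /= Dy mulr0.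
have : {ae mu1, forall x, \int[mu2]_y (L (x, y))%:E \is a fin_num}.
  apply: filterS H1 => x Hx.
  rewrite ge0_fin_numE ?integralR_ge0//.
  apply: (@le_lt_trans _ _ (\int[mu2]_y (H (x, y))%:E)); last by rewrite Hx ltry.
  apply: le_integralR => //; [exact: measurable_fun_pair2..|].
  move=> y; rewrite /L /Q /= mulrAC ler_pdivrMr//.
  by rewrite ler_wpM2l// /D ge_max lerBlDr lerDl !ltW.
apply: filterS => x fx; rewrite /w mulrCA divff// mulr1.
by rewrite fineK.
Qed.

Let marg2_L : has_marg2 mu1 mu2 L D.
Proof.
apply: filterS marg2_Q => y Hy; rewrite /L; under eq_integral do rewrite /= mulrC.
by rewrite integralRZ ?Hy ?mule1//; exact: measurable_fun_pair1.
Qed.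

Let marg1_G : has_marg1 mu1 mu2 G (fun x => tau * w x)%R.
Proof.
apply: aeW => x; rewrite /G; under eq_integral do rewrite /= mulrC.
by rewrite integralRZ// int_E -EFinM mulrC.
Qed.

Let int_w : (0 < tau)%R -> \int[mu1]_x (w x)%:E = 1.
Proof.
move=> t0; have mtw : measurable_fun setT (fun x => tau * w x)%R by mfun.
have e : tau%:E * \int[mu1]_x (w x)%:E = tau%:E.
  rewrite -integralRZ// -(integral_total1 mL L0 mtw marg1_L).
  have := integral_marg2 mL L0 mD marg2_L (measurable_cst (1%R : R)) (fun=> ler01).
  under eq_integral do rewrite /= mul1r.
  under [in RHS]eq_integral do rewrite /= mul1r.
  by move=> ->.
have := congr1 (fun z => (tau^-1)%:E * z) e.
by rewrite muleA -!EFinM mulVf ?mul1e// gt_eqF.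
Qed.

Let marg2_G : has_marg2 mu1 mu2 G E.
Proof.
have [t0|t0] := eqVneq tau 0%R; last first.
  apply: aeW => y; rewrite /G /= integralRZ// int_w ?mule1//.
  by rewrite lt_neqAle eq_sym t0.
have : ae_eq mu2 setT (EFin \o E) (cst 0).
  apply/ae_eq_integral_abs => //; first exact/measurable_EFinP.
  under eq_integral do rewrite /= ger0_norm//.
  by rewrite int_E t0.
apply: filterS => y /(_ I) [Ey]; rewrite /G /= Ey.
by under eq_integral do rewrite mul0r; rewrite integral0.
Qed.

Let mS : measurable_fun setT S. Proof. by rewrite /S; mfun. Qed.
Let S0 z : (0 <= S z)%R.
Proof. by rewrite /S addr_ge0// mulr_ge0// le_min !ltW. Qed.

(** The balance S = H - L + G without subtraction, ready to be integrated in the extended reals. *)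
Let SLHG z : (S z + L z = H z + G z)%R.
Proof.
have -> : H z = (Q z * a z.2)%R by rewrite /Q divfK// gt_eqF.
rewrite /S /L /D; have [h|h] := leP (a z.2) (b z.2).
  by rewrite max_r ?subr_le0//; ring.
by rewrite max_l ?subr_ge0 ?(ltW h)//; ring.
Qed.

Let marg1_S : has_marg1 mu1 mu2 S (cst 1%R).
Proof.
move: H1 marg1_L marg1_G; apply: filterS3 => x h1 h2 h3.
have : \int[mu2]_y (S (x, y))%:E + \int[mu2]_y (L (x, y))%:E =
       \int[mu2]_y (H (x, y))%:E + \int[mu2]_y (G (x, y))%:E.
  rewrite -!integralRD//; try exact: measurable_fun_pair2.
  by apply: eq_integral => y _; rewrite SLHG.
by rewrite h1 h2 h3 => /(congr1 (fun z => z - (tau * w x)%:E)); rewrite !addeK.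
Qed.

Let marg2_S : has_marg2 mu1 mu2 S b.
Proof.
move: H2 marg2_L marg2_G; apply: filterS3 => y h1 h2 h3.
have : \int[mu1]_x (S (x, y))%:E + \int[mu1]_x (L (x, y))%:E =
       \int[mu1]_x (H (x, y))%:E + \int[mu1]_x (G (x, y))%:E.
  rewrite -!integralRD//; try exact: measurable_fun_pair1.
  by apply: eq_integral => x _; rewrite SLHG.
rewrite h1 h2 h3 => /(congr1 (fun z => z - (D y)%:E)); rewrite addeK// => ->.
rewrite -EFinD -?EFinB; congr EFin; rewrite /D /E.
by have [h|h] := leP (a y) (b y);
    [rewrite max_l ?subr_ge0// max_r ?subr_le0//|
     rewrite max_r ?subr_le0 ?(ltW h)// max_l ?subr_ge0 ?(ltW h)//]; ring.
Qed.

(** Over each y, S / b is the convex combination of [Q] and [w] with weight min(a, b) / b on [Q];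
    convexity of [klfun] does the rest. *)
Let kle z : (b z.2 * klfun (S z / b z.2) <=
  klfun (Q z) * Num.min (a z.2) (b z.2) + E z.2 * klfun (w z.1))%R.
Proof.
set y := z.2; pose t := (Num.min (a y) (b y) / b y)%R.
have bn : b y != 0%R by rewrite gt_eqF.
have t01 : (0 <= t <= 1)%R.
  rewrite /t divr_ge0 ?le_min ?(ltW (a0 y)) ?(ltW (b0 y))//=.
  by rewrite ler_pdivrMr// mul1r ge_min lexx orbT.
have Et : (E y = b y * (1 - t))%R.
  rewrite /t mulrBr mulr1 mulrCA divff// mulr1 /E.
  by have [h|h] := leP (a y) (b y);
    [rewrite max_l ?subr_ge0|rewrite max_r ?subr_le0 ?(ltW h)//; ring].
have mt : (Num.min (a y) (b y) = b y * t)%R by rewrite /t mulrCA divff// mulr1.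
have -> : (S z / b z.2 = t * Q z + (1 - t) * w z.1)%R.
  by rewrite /S /G -/y Et mt; field.
have := klfun_convex t01 (Q0 z) (w0 z.1).
move/(ler_wpM2l (ltW (b0 y))) => /le_trans; apply.
by rewrite Et mt le_eqVlt; apply/orP; left; apply/eqP; ring.
Qed.

Let mkQ : measurable_fun setT (fun z => klfun (Q z)).
Proof. exact: measurableT_comp (@measurable_klfun R) mQ. Qed.
Let mkw : measurable_fun setT (fun x => klfun (w x)).
Proof. exact: measurableT_comp (@measurable_klfun R) mw. Qed.
Let mkw1 : measurable_fun setT (fun z : X1 * X2 => klfun (w z.1)).
Proof. exact: measurableT_comp mkw measurable_fst. Qed.
Let kQ0 z : (0 <= klfun (Q z))%R. Proof. exact: klfun_ge0. Qed.
Let kw0 x : (0 <= klfun (w x))%R. Proof. exact: klfun_ge0. Qed.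

(** [w x] is the average of [Q (x, y)] for the probability density [D / tau] in y, so by Jensen the
    mass put back has no more entropy than the mass removed. *)
Let entropy_w : \int[mu1 \x mu2]_z (E z.2 * klfun (w z.1))%:E <=
  \int[mu1 \x mu2]_z (klfun (Q z) * D z.2)%:E.
Proof.
rewrite !integral_prod1//; [|by mfun|by move=> z; rewrite mulr_ge0|by mfun
  |by move=> z; rewrite mulr_ge0].
under eq_integral => x _.
  under eq_integral do rewrite /= mulrC.
  rewrite integralRZ// int_E -EFinM mulrC; over.
apply: ae_ge0_le_integral => //.
- by move=> x _; rewrite lee_fin mulr_ge0.
- by apply/measurable_EFinP; mfun.
- by move=> x _; apply: integralR_ge0 => y; rewrite mulr_ge0.
- apply: (@measurable_integral1 _ _ _ _ _ mu2 (fun z => klfun (Q z) * D z.2)%R).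
    by mfun.
  by move=> z; rewrite mulr_ge0.
apply: filterS marg1_L => x Hx _.
have [t0|t0] := eqVneq tau 0%R.
  by rewrite t0 mul0r integralR_ge0// => y; rewrite mulr_ge0.
have tp : (0 < tau)%R by rewrite lt_neqAle eq_sym t0.
have ti : (0 <= tau^-1)%R by rewrite invr_ge0.
have mQx : measurable_fun setT (fun y => Q (x, y)) by exact: measurable_fun_pair2.
have mkQx : measurable_fun setT (fun y => klfun (Q (x, y))).
  exact: measurableT_comp (@measurable_klfun R) mQx.
have J : (klfun (w x))%:E <=
    \int[mu2]_y (klfun (Q (x, y)) * (tau^-1 * D y))%:E.
  apply: jensen_klfun => //.
  - by move=> y; rewrite mulr_ge0.
  - by mfun.
  - by rewrite integralRZ// int_D -EFinM mulVf.
  - under eq_integral do rewrite /= mulrCA.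
    rewrite integralRZ//; [|by move=> y; rewrite mulr_ge0|by mfun].
    by rewrite Hx -EFinM mulKf.
rewrite EFinM; apply: (le_trans (lee_wpmul2l _ J)); first by rewrite lee_fin.
rewrite -integralRZ//; last 2 first.
- by move=> y; rewrite mulr_ge0// mulr_ge0.
- by mfun.
under eq_integral do rewrite mulrCA mulVKf//.
by [].
Qed.

(* [H] with marginals [(1, a)] is moved to [S] with marginals [(1, b)] by leaving
   mass in place where possible and redistributing the excess [(a - b)^+]
   proportionally to the deficit [(b - a)^+]. *)
Lemma shadow_exists : exists S L G : X1 * X2 -> R, exists r : X1 -> R,
  [/\ [/\ measurable_fun setT S, forall z, (0 <= S z)%R,
      has_marg1 mu1 mu2 S (cst 1%R) & has_marg2 mu1 mu2 S b],
      \int[mu1 \x mu2]_z (b z.2 * klfun (S z / b z.2))%:E <=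
        \int[mu1 \x mu2]_z (a z.2 * klfun (H z / a z.2))%:E,
      forall z, (S z + L z = H z + G z)%R,
      [/\ measurable_fun setT G, forall z, (0 <= G z)%R,
        has_marg1 mu1 mu2 G r &
        has_marg2 mu1 mu2 G (fun y => Num.max (b y - a y) 0)%R] &
      [/\ forall z, L z = (H z / a z.2 * Num.max (a z.2 - b z.2) 0)%R,
        measurable_fun setT r, has_marg1 mu1 mu2 L r &
        has_marg2 mu1 mu2 L (fun y => Num.max (a y - b y) 0)%R]].
Proof.
exists S, L, G, (fun x => tau * w x)%R; split => //; last first.
  by split => //; mfun.
have mb2V : measurable_fun setT (fun z : X1 * X2 => (b z.2)^-1)%R.
  exact: measurableT_comp (measurable_funV mb b0) measurable_snd.
apply: (@le_trans _ _ (\int[mu1 \x mu2]_z (klfun (Q z) *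
    Num.min (a z.2) (b z.2) + E z.2 * klfun (w z.1))%:E)).
  apply: le_integralR => //.
  - by move=> z; rewrite mulr_ge0 ?(ltW (b0 _))// klfun_ge0// divr_ge0// ltW.
  - apply: measurable_funM => //.
    by apply: (measurableT_comp (@measurable_klfun R)); mfun.
  - by mfun.
rewrite integralRD//; last 4 first.
- by move=> z; rewrite mulr_ge0// le_min !ltW.
- by mfun.
- by move=> z; rewrite mulr_ge0.
- by mfun.
apply: (le_trans (leeD2l _ entropy_w)).
rewrite -integralRD//; last 4 first.
- by move=> z; rewrite mulr_ge0// le_min !ltW.
- by mfun.
- by move=> z; rewrite mulr_ge0.
- by mfun.
apply: le_integralR.
- by move=> z; rewrite addr_ge0// mulr_ge0// le_min !ltW.
- by mfun.
- by apply: measurable_funM => //.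
(* The two pieces recombine because min(a, b) + (a - b)^+ = a. *)
move=> z; rewrite -mulrDr mulrC ler_wpM2r// /D.
have [h|h] := leP (a z.2) (b z.2); first by rewrite max_r ?subr_le0// addr0.
by rewrite max_l ?subr_ge0 ?(ltW h)// addrC subrK.
Qed.

End shadow.

(** * Entropy minimisation under marginal constraints *)

Section entropy.
Context {R : realType} {d1 d2 : measure_display}
  {X1 : measurableType d1} {X2 : measurableType d2}.
Variables (mu1 : probability X1 R) (mu2 : probability X2 R).
Local Open Scope ereal_scope.
Implicit Types H S : X1 * X2 -> R.

(** Entropy equals conditional entropy given y plus entropy of the marginal: integrate [klfun_chain]
    in x. The term in [ln (a y)] has no sign, so its parts [p] and [n] are placed on opposite sides
    before integrating. *)
Lemma entropy_chain H (a : X2 -> R) : measurable_fun setT H ->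
  (forall z, 0 <= H z)%R -> measurable_fun setT a -> (forall y, 0 < a y)%R ->
  has_marg2 mu1 mu2 H a ->
  \int[mu1 \x mu2]_z (klfun (H z))%:E =
  \int[mu1 \x mu2]_z (a z.2 * klfun (H z / a z.2))%:E +
  \int[mu2]_y (klfun (a y))%:E.
Proof.
move=> mH H0 ma a0 Ha.
have mk := @measurable_klfun R.
have ma2 : measurable_fun setT (fun z : X1 * X2 => a z.2).
  exact: measurableT_comp ma measurable_snd.
have maV2 : measurable_fun setT (fun z : X1 * X2 => (a z.2)^-1)%R.
  exact: measurableT_comp (measurable_funV ma a0) measurable_snd.
have mkH : measurable_fun setT (fun z => klfun (H z)).
  exact: measurableT_comp mk mH.
have mQ : measurable_fun setT (fun z => a z.2 * klfun (H z / a z.2))%R.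
  apply: measurable_funM => //.
  by apply: (measurableT_comp mk); mfun.
have Q0 z : (0 <= a z.2 * klfun (H z / a z.2))%R.
  by rewrite mulr_ge0 ?(ltW (a0 _))// klfun_ge0// divr_ge0// ltW.
have kH0 z : (0 <= klfun (H z))%R by exact: klfun_ge0.
have ka0 y : (0 <= klfun (a y))%R by rewrite klfun_ge0// ltW.
have mka : measurable_fun setT (fun y => klfun (a y)).
  exact: measurableT_comp mk ma.
rewrite !integral_prod2// -ge0_integralD//; last 4 first.
- by move=> y _; exact: integralR_ge0.
- exact: (measurable_integral2 mu1 mQ Q0).
- by move=> y _; rewrite lee_fin.
- exact/measurable_EFinP.
apply: ae_eq_integral => //.
- exact: (measurable_integral2 mu1 mkH kH0).
- apply: emeasurable_funD; last exact/measurable_EFinP.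
  exact: (measurable_integral2 mu1 mQ Q0).
apply: filterS Ha => y Hy _.
have mh : measurable_fun setT (fun x => H (x, y)) by exact: measurable_fun_pair1.
have mk1 : measurable_fun setT (fun x => klfun (H (x, y))).
  exact: measurableT_comp mk mh.
have mk2 : measurable_fun setT (fun x => a y * klfun (H (x, y) / a y))%R.
  exact: (measurable_fun_pair1 y mQ).
pose p : R := Num.max (ln (a y)) 0%R; pose n : R := Num.max (- ln (a y))%R 0%R.
have p0 : (0 <= p)%R by rewrite /p le_max lexx orbT.
have n0 : (0 <= n)%R by rewrite /n le_max lexx orbT.
have pn : (ln (a y) = p - n)%R.
  rewrite /p /n; have [h|h] := leP (ln (a y)) 0%R.
    by rewrite max_l ?oppr_ge0//; ring.
  by rewrite max_r ?oppr_le0 ?ltW//; ring.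
have e : \int[mu1]_x (klfun (H (x, y)))%:E + (n * a y + a y)%:E =
         \int[mu1]_x (a y * klfun (H (x, y) / a y))%:E + (p * a y + 1)%:E.
  have cst1 (q r : R) : (0 <= q)%R -> (0 <= r)%R ->
      \int[mu1]_x (q * H (x, y) + r)%:E = (q * a y + r)%:E.
    move=> q0 r0; rewrite integralRD//; [|by move=> x; rewrite mulr_ge0|by mfun].
    by rewrite integralRZ// Hy integral_cst_prob -EFinM -EFinD.
  have ay := ltW (a0 y).
  rewrite -!cst1// -!integralRD//; try by [mfun|move=> x; rewrite addr_ge0// mulr_ge0
    |move=> x; exact: (Q0 (x, y))].
  apply: eq_integral => x _; congr EFin.
  by rewrite (klfun_chain (a0 y) (H0 (x, y))) pn /=; ring.
have := congr1 (fun z => z - (n * a y + a y)%:E) e.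
rewrite addeK// => ->; rewrite -addeA -EFinB; congr (_ + _%:E).
by rewrite /klfun pn; ring.
Qed.

(** [b y] is the average of 1/a for the probability of density [H (x, y)] in x. Jensen bounds F(b)
    by the average of F(1/a), and integrating over y gives the integral of a F(1/a), the entropy in
    the other direction. *)
Lemma marginal_contraction H (a : X1 -> R) (b : X2 -> R) :
  measurable_fun setT H -> (forall z, 0 <= H z)%R ->
  measurable_fun setT a -> (forall x, 0 < a x)%R ->
  measurable_fun setT b -> (forall y, 0 < b y)%R ->
  has_marg1 mu1 mu2 H a -> has_marg2 mu1 mu2 H (cst 1%R) ->
  has_marg2 mu1 mu2 (fun z => H z / a z.1)%R b ->
  \int[mu2]_y (klfun (b y))%:E <= \int[mu1]_x (rklfun (a x))%:E /\
  \int[mu2]_y (rklfun (b y))%:E <= \int[mu1]_x (klfun (a x))%:E.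
Proof.
move=> mH H0 ma a0 mb b0 H1 H2 Hb.
have maV := measurable_funV ma a0.
have av0 x : (0 < (a x)^-1)%R by rewrite invr_gt0.
have mH1 y : measurable_fun setT (fun x => H (x, y)) by exact: measurable_fun_pair1.
suff gen (F F' : R -> R) : measurable_fun setT F ->
    (forall t, 0 < t -> 0 <= F t)%R -> (forall t, 0 < t -> t * F t^-1 = F' t)%R ->
    (forall y, \int[mu1]_x (H (x, y))%:E = 1 ->
      \int[mu1]_x ((a x)^-1 * H (x, y))%:E = (b y)%:E ->
      (F (b y))%:E <= \int[mu1]_x (F (a x)^-1 * H (x, y))%:E) ->
    \int[mu2]_y (F (b y))%:E <= \int[mu1]_x (F' (a x))%:E.
  split.
    apply: gen.
    - exact: measurable_klfun.
    - by move=> t t0; rewrite klfun_ge0// ltW.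
    - exact: klfunV.
    - by move=> y h1 h2; apply: jensen_klfun => // x; exact: ltW.
  apply: gen.
  - exact: measurable_rklfun.
  - exact: rklfun_ge0.
  - exact: rklfunV.
  - by move=> y h1 h2; apply: jensen_rklfun.
move=> mF F0 FF' J.
have mFa : measurable_fun setT (fun x => F (a x)^-1)%R by exact: measurableT_comp mF maV.
have mFa1 : measurable_fun setT (fun z : X1 * X2 => F (a z.1)^-1)%R.
  exact: measurableT_comp mFa measurable_fst.
have Fa0 x : (0 <= F (a x)^-1)%R by exact: F0.
apply: (@le_trans _ _ (\int[mu1 \x mu2]_z (F (a z.1)^-1 * H z)%:E)).
  rewrite integral_prod2//; [|by mfun|by move=> z; rewrite mulr_ge0].
  apply: ae_ge0_le_integral => //.
  - by move=> y _; rewrite lee_fin F0.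
  - by apply/measurable_EFinP; exact: measurableT_comp mF mb.
  - by move=> y _; apply: integralR_ge0 => x; rewrite mulr_ge0.
  - apply: (@measurable_integral2 _ _ _ _ _ mu1 (fun z => F (a z.1)^-1 * H z)%R).
      by mfun.
    by move=> z; rewrite mulr_ge0.
  move: H2 Hb; apply: filterS2 => y h1 h2 _; apply: J => //.
  by rewrite -h2; apply: eq_integral => x _; rewrite mulrC.
rewrite (integral_marg1 mH H0 ma H1 mFa)//.
by under eq_integral do rewrite mulrC FF'//.
Qed.

(** [Fent] read on densities, with a nonnegative integrand. *)
Definition Jent (c : X1 * X2 -> R) H : \bar R :=
  \int[mu1 \x mu2]_z (klfun (H z) + c z * H z)%:E.

Definition posp (r : R) : R := Num.max r 0%R.

Lemma posp_ge0 r : (0 <= posp r)%R. Proof. by rewrite /posp le_max lexx orbT. Qed.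

Lemma pospE (r : R) : r = (posp r - posp (- r)%R)%R.
Proof.
rewrite /posp; have [h|h] := leP r 0%R.
  by rewrite max_l ?oppr_ge0//; ring.
by rewrite max_r ?oppr_le0 ?ltW//; ring.
Qed.

Lemma measurable_posp d (T : measurableType d) (f : T -> R) :
  measurable_fun setT f -> measurable_fun setT (fun x => posp (f x)).
Proof. by move=> mf; rewrite /posp; mfun. Qed.

(* The tangent of [klfun] at [H] has slope [ln u + ln v - c], and [ln u + ln v]
   has the same integral against [S] and [H]. *)
Lemma Jent_gibbs_min (c : X1 * X2 -> R) (u : X1 -> R) (v h : X2 -> R) S (g : X2 -> R) :
  measurable_fun setT c -> (forall z, 0 <= c z)%R ->
  measurable_fun setT u -> (forall x, 0 < u x)%R ->
  measurable_fun setT v -> (forall y, 0 < v y)%R ->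
  measurable_fun setT h -> (forall y, 0 < h y)%R ->
  measurable_fun setT S -> (forall z, 0 <= S z)%R ->
  let H := fun z => (u z.1 * v z.2 * expR (- c z))%R in
  has_marg1 mu1 mu2 H (cst 1%R) -> has_marg2 mu1 mu2 H h ->
  has_marg1 mu1 mu2 S (cst 1%R) -> has_marg2 mu1 mu2 S h ->
  mu1.-integrable setT (EFin \o (fun x => ln (u x))) ->
  measurable_fun setT g -> (forall y, 0 <= g y)%R ->
  (forall y, ln (v y) <= g y)%R ->
  \int[mu2]_y (g y * h y)%:E < +oo ->
  Jent c H <= Jent c S.
Proof.
move=> mc c0 mu u0 mv v0 mh h0 mS S0 H H1 H2 S1 S2 iu mg g0 vg goo.
pose f1 x := posp (ln (u x)); pose f2 x := posp (- ln (u x))%R.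
pose g1 y := posp (ln (v y)); pose g2 y := posp (- ln (v y))%R.
have mu1' : measurable_fun setT (fun z : X1 * X2 => u z.1).
  exact: measurableT_comp mu measurable_fst.
have mv2' : measurable_fun setT (fun z : X1 * X2 => v z.2).
  exact: measurableT_comp mv measurable_snd.
have mH : measurable_fun setT H by rewrite /H; mfun.
have H0 z : (0 < H z)%R by rewrite /H !mulr_gt0// expR_gt0.
have mf1 : measurable_fun setT f1 by apply: measurable_posp; mfun.
have mf2 : measurable_fun setT f2 by apply: measurable_posp; mfun.
have mg1 : measurable_fun setT g1 by apply: measurable_posp; mfun.
have mg2 : measurable_fun setT g2 by apply: measurable_posp; mfun.
have f10 x : (0 <= f1 x)%R by exact: posp_ge0.
have f20 x : (0 <= f2 x)%R by exact: posp_ge0.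
have g10 x : (0 <= g1 x)%R by exact: posp_ge0.
have g20 x : (0 <= g2 x)%R by exact: posp_ge0.
have mf11 : measurable_fun setT (fun z : X1 * X2 => f1 z.1).
  exact: measurableT_comp mf1 measurable_fst.
have mf21 : measurable_fun setT (fun z : X1 * X2 => f2 z.1).
  exact: measurableT_comp mf2 measurable_fst.
have mg12 : measurable_fun setT (fun z : X1 * X2 => g1 z.2).
  exact: measurableT_comp mg1 measurable_snd.
have mg22 : measurable_fun setT (fun z : X1 * X2 => g2 z.2).
  exact: measurableT_comp mg2 measurable_snd.
have absu x : (`|ln (u x)| = f1 x + f2 x)%R.
  rewrite /f1 /f2 /posp; have [q|q] := leP (ln (u x)) 0%R.
    by rewrite max_l ?oppr_ge0// ler0_norm// add0r.
  by rewrite max_r ?oppr_le0 ?ltW// gtr0_norm// addr0.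
have F1 : \int[mu1]_x (f1 x)%:E < +oo.
  apply: le_lt_trans (integrableR_abs iu); apply: le_integralR => //.
    by mfun.
  by move=> x; rewrite absu lerDl.
have F2 : \int[mu1]_x (f2 x)%:E < +oo.
  apply: le_lt_trans (integrableR_abs iu); apply: le_integralR => //.
    by mfun.
  by move=> x; rewrite absu lerDr.
have G1 : \int[mu2]_y (g1 y * h y)%:E < +oo.
  apply: le_lt_trans goo; apply: le_integralR => //; [|by mfun|by mfun|].
    by move=> y; rewrite mulr_ge0// ltW.
  by move=> y; rewrite ler_wpM2r ?(ltW (h0 _))// /g1 /posp ge_max vg g0.
have HH0 z := ltW (H0 z).
have m1 : measurable_fun [set: X1] (cst 1%R : X1 -> R) by [].
have int1 (f : X1 -> R) (W : X1 * X2 -> R) : measurable_fun setT f -> (forall x, 0 <= f x)%R ->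
    measurable_fun setT W -> (forall z, 0 <= W z)%R -> has_marg1 mu1 mu2 W (cst 1%R) ->
    \int[mu1 \x mu2]_z (f z.1 * W z)%:E = \int[mu1]_x (f x)%:E.
  move=> mf f0 mW W0 W1; rewrite (integral_marg1 mW W0 m1 W1 mf)//.
  by under eq_integral do rewrite mulr1.
(* The negative part of [ln v] is controlled by the positive part of [ln u]: take - t ln t <= 1 at t
   = u v and multiply by exp (- c) <= 1. *)
have G2 : \int[mu2]_y (g2 y * h y)%:E < +oo.
  rewrite -(integral_marg2 mH HH0 mh H2 mg2)//.
  apply: (@le_lt_trans _ _ (\int[mu1 \x mu2]_z (f1 z.1 * H z + 1)%:E)).
    apply: le_integralR; [by move=> z; rewrite mulr_ge0|by mfun|by mfun|].
    move=> z; rewrite /g2 /posp.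
    have [q|q] := leP (- ln (v z.2))%R 0%R.
      by rewrite mul0r addr_ge0// mulr_ge0.
    have q1 : (0 <= klfun (u z.1 * v z.2))%R by rewrite klfun_ge0// mulr_ge0 ?ltW.
    have q2 : (ln (u z.1) <= f1 z.1)%R by rewrite /f1 /posp le_max lexx.
    have e1 : (0 < expR (- c z) <= 1)%R.
      by rewrite expR_gt0 -expR0 ler_expR oppr_le0 c0.
    have uv0 : (0 < u z.1 * v z.2)%R by rewrite mulr_gt0.
    move: q1; rewrite /klfun lnM ?posrE// => q1.
    have q3 : (- (ln (u z.1) + ln (v z.2)) * (u z.1 * v z.2) <= 1)%R by nra.
    have q4 : (- (ln (u z.1) + ln (v z.2)) * H z <= 1)%R.
      rewrite /H mulrA; case/andP: e1 => e0 e1.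
      apply: (@le_trans _ _ (1 * expR (- c z))%R); last by rewrite mul1r.
      by rewrite ler_wpM2r// ltW.
    have := ler_wpM2r (HH0 z) q2; nra.
  rewrite integralRD//; [|by move=> z; rewrite mulr_ge0|by mfun].
  by rewrite int1// integral_cst_prob lte_add_pinfty// ltry.
pose A := \int[mu1]_x (f1 x)%:E + \int[mu2]_y (g1 y * h y)%:E +
          (\int[mu1]_x (f2 x)%:E + \int[mu2]_y (g2 y * h y)%:E).
have Afin : A \is a fin_num.
  rewrite ge0_fin_numE; last first.
    by apply: adde_ge0; apply: adde_ge0; apply: integralR_ge0 => // y;
      rewrite mulr_ge0// ltW.
  by apply: lte_add_pinfty; apply: lte_add_pinfty.
have mkS : measurable_fun setT (fun z => klfun (S z)).
  exact: measurableT_comp (@measurable_klfun R) mS.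
have mkH : measurable_fun setT (fun z => klfun (H z)).
  exact: measurableT_comp (@measurable_klfun R) mH.
have kS0 z : (0 <= klfun (S z))%R by exact: klfun_ge0.
have kH0 z : (0 <= klfun (H z))%R by exact: klfun_ge0.
(* Positive parts of the potentials go with one density and negative parts with the other. [B S H]
   and [B H S] have the same finite integral [A], and adding them to the two sides turns the tangent
   inequality into one between nonnegative functions. *)
pose B (W W' : X1 * X2 -> R) z :=
  (f1 z.1 * W z + g1 z.2 * W z + (f2 z.1 * W' z + g2 z.2 * W' z))%R.
have BA (W W' : X1 * X2 -> R) : measurable_fun setT W -> (forall z, 0 <= W z)%R ->
    has_marg1 mu1 mu2 W (cst 1%R) -> has_marg2 mu1 mu2 W h ->
    measurable_fun setT W' -> (forall z, 0 <= W' z)%R ->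
    has_marg1 mu1 mu2 W' (cst 1%R) -> has_marg2 mu1 mu2 W' h ->
    \int[mu1 \x mu2]_z (B W W' z)%:E = A.
  move=> mW W0 W1 W2 mW' W0' W1' W2'.
  rewrite /B !integralRD//; try by [mfun|move=> z; rewrite !addr_ge0// mulr_ge0
    |move=> z; rewrite mulr_ge0].
  by rewrite !int1// (integral_marg2 mW W0 mh W2 mg1)// (integral_marg2 mW' W0' mh W2' mg2).
have B0 (W W' : X1 * X2 -> R) z : (forall z, 0 <= W z)%R ->
    (forall z, 0 <= W' z)%R -> (0 <= B W W' z)%R.
  by move=> W0 W0'; rewrite /B !addr_ge0// mulr_ge0.
have mB (W W' : X1 * X2 -> R) : measurable_fun setT W -> measurable_fun setT W' ->
  measurable_fun setT (B W W') by move=> mW mW'; rewrite /B; mfun.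
have mBSH := mB _ _ mS mH; have mBHS := mB _ _ mH mS.
rewrite -(leeD2rE _ _ Afin).
rewrite -{1}(BA S H)// -(BA H S)// /Jent.
rewrite -!integralRD//; try by [mfun|move=> z; exact: B0
  |move=> z; rewrite addr_ge0// mulr_ge0].
apply: le_integralR; [|by mfun|by mfun|].
  by move=> z; rewrite addr_ge0 ?B0// addr_ge0// mulr_ge0.
move=> z; have tg := klfun_tangent (H0 z) (S0 z).
have lnH : (ln (H z) = f1 z.1 - f2 z.1 + (g1 z.2 - g2 z.2) - c z)%R.
  rewrite /H !lnM ?posrE ?mulr_gt0 ?expR_gt0// expRK.
  by rewrite -(pospE (ln (u z.1))) -(pospE (ln (v z.2))).
rewrite lnH in tg; rewrite /B; nra.
Qed.

End entropy.

(** * Quantitative shadow estimates *)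

Section moments.
Context d (T : measurableType d) (R : realType) (mu : probability T R).
Variables (phi : T -> R) (alpha M : R).
Hypotheses (mphi : measurable_fun setT phi) (phi0 : forall x, 0 <= phi x)
  (alpha0 : 0 < alpha).
Hypothesis expM : (\int[mu]_x (expR (alpha * phi x))%:E <= M%:E)%E.
Local Open Scope ereal_scope.

Lemma integral_sqr_le : \int[mu]_x (phi x ^+ 2)%:E <= (4 / alpha ^+ 2 * M)%:E.
Proof.
have a2 : (0 <= 4 / alpha ^+ 2)%R by rewrite divr_ge0// sqr_ge0.
have mexp : measurable_fun setT (fun x => expR (alpha * phi x)) by mfun.
apply: (@le_trans _ _ (\int[mu]_x (4 / alpha ^+ 2 * expR (alpha * phi x))%:E)).
  apply: le_integralR => //; [|by mfun|by mfun|] => x; first exact: sqr_ge0.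
  have := sqr_le_expR (mulr_ge0 (ltW alpha0) (phi0 x)).
  rewrite exprMn => h; rewrite mulrAC ler_pdivlMr ?exprn_gt0//.
  by rewrite mulrC.
rewrite integralRZ//.
by rewrite [leRHS]EFinM; apply: lee_wpmul2l => //; rewrite lee_fin.
Qed.

Definition tvconst (K : R) : R := (2 / alpha * (K + 4 * expR alpha * M))%R.

(** The pointwise inequality with s = alpha (1 + phi) / 2, chosen so that exp (2 s) is exp alpha
    times the exponential moment at hand; dividing by alpha e / 2 produces [tvconst]. *)
Lemma weighted_pinsker (h : T -> R) (K e : R) : measurable_fun setT h ->
  (forall x, 0 <= h x)%R -> (0 < e <= 1)%R ->
  \int[mu]_x (klfun (h x))%:E <= (K * e ^+ 2)%:E ->
  \int[mu]_x ((1 + phi x) * `|h x - 1|)%:E <= (tvconst K * e)%:E.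
Proof.
move=> mh h0 /andP[e0 e1] hK.
have mexp : measurable_fun setT (fun x => expR (alpha * phi x)) by mfun.
have mkh : measurable_fun setT (fun x => klfun (h x)).
  exact: measurableT_comp (@measurable_klfun R) mh.
pose q : R := (2 / (alpha * e))%R.
have q0 : (0 <= q)%R by rewrite /q divr_ge0// mulr_ge0 ?ltW.
pose f x := (klfun (h x) + 4 * e ^+ 2 * expR alpha * expR (alpha * phi x))%R.
have c0 : (0 <= 4 * e ^+ 2 * expR alpha)%R.
  by rewrite mulr_ge0 ?expR_ge0// mulr_ge0// sqr_ge0.
have kh0 x : (0 <= klfun (h x))%R by exact: klfun_ge0.
have f0 x : (0 <= f x)%R by rewrite /f addr_ge0// mulr_ge0// expR_ge0.
have mf : measurable_fun setT f by rewrite /f; mfun.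
apply: (@le_trans _ _ (\int[mu]_x (q * f x)%:E)).
  apply: le_integralR; [|by mfun|by mfun|] => x.
    by rewrite mulr_ge0// addr_ge0.
  have s0 : (0 <= alpha / 2 * (1 + phi x))%R.
    by rewrite mulr_ge0 ?divr_ge0 ?addr_ge0 ?(ltW alpha0).
  have e01 : (0 <= e <= 1)%R by rewrite (ltW e0).
  have := klfun_weighted_pinsker (h0 x) s0 e01.
  rewrite (_ : 2 * (alpha / 2 * (1 + phi x)) = alpha + alpha * phi x)%R; last by field.
  rewrite expRD => /(ler_wpM2l q0) hh.
  rewrite [leLHS](_ : _ = q * (e * (alpha / 2 * (1 + phi x)) * `|h x - 1|))%R.
    by rewrite (le_trans hh)// /f !mulrA.
  by rewrite /q; field; rewrite !gt_eqF.
rewrite integralRZ// /f integralRD//; [|by move=> x; rewrite mulr_ge0// expR_ge0|by mfun].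
rewrite integralRZ//.
apply: (@le_trans _ _ (q%:E * ((K * e ^+ 2)%:E +
    (4 * e ^+ 2 * expR alpha)%:E * M%:E))).
  apply: lee_wpmul2l; first by rewrite lee_fin.
  by apply: leeD => //; apply: lee_wpmul2l => //; rewrite lee_fin.
rewrite [leLHS](_ : _ = (q * (K * e ^+ 2 + 4 * e ^+ 2 * expR alpha * M))%:E)//.
rewrite lee_fin le_eqVlt; apply/orP; left; apply/eqP.
by rewrite /q /tvconst; field; rewrite !gt_eqF.
Qed.

End moments.

Section shadow_estimates.
Context {R : realType} {d1 d2 : measure_display}
  {X1 : measurableType d1} {X2 : measurableType d2}.
Variables (mu1 : probability X1 R) (mu2 : probability X2 R).
Variables (phi1 : X1 -> R) (phi2 : X2 -> R) (alpha M C : R) (c : X1 * X2 -> R).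
Hypotheses (mphi1 : measurable_fun setT phi1) (phi10 : forall x, 0 <= phi1 x)
  (mphi2 : measurable_fun setT phi2) (phi20 : forall x, 0 <= phi2 x)
  (alpha0 : 0 < alpha)
  (exp1 : (\int[mu1]_x (expR (alpha * phi1 x))%:E <= M%:E)%E)
  (exp2 : (\int[mu2]_x (expR (alpha * phi2 x))%:E <= M%:E)%E)
  (mc : measurable_fun setT c) (c0 : forall z, 0 <= c z) (C0 : 0 <= C)
  (cC : forall z, c z <= C * (1 + phi1 z.1 + phi2 z.2)).
Local Open Scope ereal_scope.

Definition wgt (z : X1 * X2) : R := (1 + phi1 z.1 + phi2 z.2)%R.

Lemma wgt_ge0 z : (0 <= wgt z)%R.
Proof. by rewrite /wgt !addr_ge0. Qed.

Let mphi11 : measurable_fun setT (fun z : X1 * X2 => phi1 z.1).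
Proof. exact: measurableT_comp mphi1 measurable_fst. Qed.
Let mphi22 : measurable_fun setT (fun z : X1 * X2 => phi2 z.2).
Proof. exact: measurableT_comp mphi2 measurable_snd. Qed.

Lemma measurable_wgt : measurable_fun setT wgt.
Proof. by rewrite /wgt; mfun. Qed.

Let mwgt := measurable_wgt.

(** The bound for the part 1 + phi2 of the weight plus the one of [cross_term] for the part phi1. *)
Definition shconst (K : R) : R :=
  (tvconst alpha M K + (4 / alpha ^+ 2 * M + 4 * K))%R.

(** The weight depends on x while the removed fraction rho = (a - b)^+ / a depends on y, and no
    independence is available. AM-GM separates them: phi1^2 only sees the exact first marginal, and
    rho^2 integrates to a rho^2, which is at most 4 klfun h. *)
Lemma cross_term (H : X1 * X2 -> R) (a b h : X2 -> R) (K e : R) :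
  measurable_fun setT H -> (forall z, 0 <= H z)%R ->
  measurable_fun setT a -> (forall y, 0 < a y)%R ->
  measurable_fun setT b -> measurable_fun setT h -> (forall y, 0 <= h y)%R ->
  has_marg1 mu1 mu2 H (cst 1%R) -> has_marg2 mu1 mu2 H a ->
  (forall y, a y * (Num.max (a y - b y) 0 / a y) ^+ 2 <= 4 * klfun (h y))%R ->
  (0 < e)%R -> \int[mu2]_x (klfun (h x))%:E <= (K * e ^+ 2)%:E ->
  \int[mu1 \x mu2]_z (phi1 z.1 * (H z / a z.2 * Num.max (a z.2 - b z.2) 0))%:E <=
  ((4 / alpha ^+ 2 * M + 4 * K) * e)%:E.
Proof.
move=> mH H0 ma a0 mb mh h0 H1 H2 ab e0 hK.
pose rho y := (Num.max (a y - b y) 0 / a y)%R.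
have maV := measurable_funV ma a0.
have mrho : measurable_fun setT rho by rewrite /rho; mfun.
have mrho2 : measurable_fun setT (fun z : X1 * X2 => rho z.2).
  exact: measurableT_comp mrho measurable_snd.
have rho0 y : (0 <= rho y)%R by rewrite /rho divr_ge0 ?(ltW (a0 _))// le_max lexx orbT.
have mkh : measurable_fun setT (fun x => klfun (h x)).
  exact: measurableT_comp (@measurable_klfun R) mh.
have eV : (0 <= e^-1)%R by rewrite invr_ge0 ltW.
have s1 z : (0 <= phi1 z.1 ^+ 2 * H z)%R by rewrite mulr_ge0// sqr_ge0.
have s2 z : (0 <= rho z.2 ^+ 2 * H z)%R by rewrite mulr_ge0// sqr_ge0.
have ms1 : measurable_fun setT (fun z => phi1 z.1 ^+ 2 * H z)%R by mfun.
have ms2 : measurable_fun setT (fun z => rho z.2 ^+ 2 * H z)%R by mfun.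
apply: (@le_trans _ _ (\int[mu1 \x mu2]_z (e * (phi1 z.1 ^+ 2 * H z) +
    e^-1 * (rho z.2 ^+ 2 * H z))%:E)).
  rewrite (_ : (fun z => _) = (fun z => (phi1 z.1 * (H z * rho z.2))%:E)); last first.
    by apply/funext => z; rewrite /rho; congr EFin; ring.
  apply: le_integralR; [|by mfun|by mfun|] => z.
    by rewrite mulr_ge0// mulr_ge0.
  (* AM-GM: phi rho <= e phi^2 + rho^2 / e *)
  have : (phi1 z.1 * rho z.2 <= e * phi1 z.1 ^+ 2 + e^-1 * rho z.2 ^+ 2)%R.
    have := sqr_ge0 (e * phi1 z.1 - rho z.2).
    have p0 := mulr_ge0 (phi10 z.1) (rho0 z.2).
    move/(mulr_ge0 eV).
    have -> : (e^-1 * (e * phi1 z.1 - rho z.2) ^+ 2 = e * phi1 z.1 ^+ 2 -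
      2 * (phi1 z.1 * rho z.2) + e^-1 * rho z.2 ^+ 2)%R by field; rewrite gt_eqF.
    lra.
  by move/(ler_wpM2r (H0 z)); congr (is_true (_ <= _)%R); ring.
rewrite integralRD//; [|by move=> z; rewrite mulr_ge0// ltW|by mfun
  |by move=> z; rewrite mulr_ge0|by mfun].
rewrite !integralRZ// ?(ltW e0)//.
have mp2 : measurable_fun setT (fun x => phi1 x ^+ 2)%R by mfun.
have mr2 : measurable_fun setT (fun x => rho x ^+ 2)%R by mfun.
have m1 : measurable_fun [set: X1] (cst 1%R : X1 -> R) by [].
rewrite (integral_marg1 mH H0 m1 H1 mp2); last by move=> x; exact: sqr_ge0.
rewrite (integral_marg2 mH H0 ma H2 mr2); last by move=> x; exact: sqr_ge0.
rewrite mulrDl EFinD; apply: leeD.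
  rewrite mulrC [leRHS]EFinM; apply: lee_wpmul2l; first by rewrite lee_fin ltW.
  under eq_integral do rewrite mulr1.
  exact: integral_sqr_le.
apply: (@le_trans _ _ ((e^-1)%:E * (4 * (K * e ^+ 2))%:E)); last first.
  rewrite -EFinM lee_fin le_eqVlt; apply/orP; left; apply/eqP; field.
  by rewrite gt_eqF.
apply: lee_wpmul2l; first by rewrite lee_fin.
apply: (@le_trans _ _ (\int[mu2]_x (4 * klfun (h x))%:E)).
  apply: le_integralR; [|by mfun|by mfun|].
    by move=> y; rewrite mulr_ge0 ?sqr_ge0// ltW.
  by move=> y; rewrite mulrC; exact: ab.
rewrite integralRZ//; last by move=> x; exact: klfun_ge0.
by rewrite [leRHS]EFinM; apply: lee_wpmul2l => //; rewrite lee_fin.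
Qed.

(** The auxiliary [h] lets one statement cover both the move from h to 1 and the move from 1 to
    h. *)
Lemma shadow_estimate (H : X1 * X2 -> R) (a b h : X2 -> R) (K e : R) :
  measurable_fun setT H -> (forall z, 0 <= H z)%R ->
  measurable_fun setT a -> (forall y, 0 < a y)%R ->
  measurable_fun setT b -> (forall y, 0 < b y)%R ->
  measurable_fun setT h -> (forall y, 0 <= h y)%R ->
  has_marg1 mu1 mu2 H (cst 1%R) -> has_marg2 mu1 mu2 H a ->
  \int[mu2]_y (b y)%:E = 1 ->
  (forall y, a y * (Num.max (a y - b y) 0 / a y) ^+ 2 <= 4 * klfun (h y))%R ->
  (forall y, `|a y - b y| = `|h y - 1|)%R ->
  (0 < e <= 1)%R -> \int[mu2]_x (klfun (h x))%:E <= (K * e ^+ 2)%:E ->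
  exists S : X1 * X2 -> R,
  [/\ [/\ measurable_fun setT S, forall z, (0 <= S z)%R,
        has_marg1 mu1 mu2 S (cst 1%R) & has_marg2 mu1 mu2 S b],
      \int[mu1 \x mu2]_z (b z.2 * klfun (S z / b z.2))%:E <=
        \int[mu1 \x mu2]_z (a z.2 * klfun (H z / a z.2))%:E,
      \int[mu1 \x mu2]_z (c z * S z)%:E <=
        \int[mu1 \x mu2]_z (c z * H z)%:E + (C * shconst K * e)%:E &
      \int[mu1 \x mu2]_z (wgt z * `|S z - H z|)%:E <= (2 * shconst K * e)%:E].
Proof.
move=> mH H0 ma a0 mb b0 mh h0 H1 H2 b1 ab abh e01 hK.
have [S [L [G [r [[mS S0 S1 S2] Sk SLHG [mG G0 G1 G2] [LE mr L1 L2]]]]]] :=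
  shadow_exists mH H0 ma a0 mb b0 H1 H2 b1.
have /andP[e0 e1] := e01.
have L0 z : (0 <= L z)%R.
  by rewrite LE mulr_ge0 ?divr_ge0 ?(ltW (a0 _))// le_max lexx orbT.
have mL : measurable_fun setT L.
  have -> : L = (fun z => S z * -1 + (H z + G z))%R.
    by apply/funext => z; rewrite -SLHG; ring.
  by mfun.
(* One bound serves both [G] and [L]: they share the first marginal [r], so the phi1 part is always
   that of [L], and their second marginals are at most |h - 1|. *)
have X0 (G' : X1 * X2 -> R) (r' : X2 -> R) : measurable_fun setT G' ->
    (forall z, 0 <= G' z)%R -> has_marg1 mu1 mu2 G' r -> measurable_fun setT r' ->
    has_marg2 mu1 mu2 G' r' -> (forall y, 0 <= r' y <= `|h y - 1|)%R ->
    \int[mu1 \x mu2]_z (wgt z * G' z)%:E <= (shconst K * e)%:E.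
  move=> mG' G'0 G'1 mr' G'2 r'h.
  have -> : \int[mu1 \x mu2]_z (wgt z * G' z)%:E =
    \int[mu1 \x mu2]_z ((1 + phi2 z.2) * G' z)%:E + \int[mu1 \x mu2]_z (phi1 z.1 * G' z)%:E.
    rewrite -integralRD//; [|by move=> z; rewrite mulr_ge0// addr_ge0|by mfun
      |by move=> z; rewrite mulr_ge0|by mfun].
    by apply: eq_integral => z _; congr EFin; rewrite /wgt; ring.
  rewrite /shconst mulrDl EFinD; apply: leeD.
    have m1p : measurable_fun setT (fun y => 1 + phi2 y)%R by mfun.
    rewrite (integral_marg2 mG' G'0 mr' G'2 m1p); last by move=> y; rewrite addr_ge0.
    apply: le_trans (weighted_pinsker mphi2 phi20 alpha0 exp2 mh h0 e01 hK).
    apply: le_integralR; [|by mfun|by mfun|] => y.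
      by rewrite mulr_ge0 ?addr_ge0//; have /andP[] := r'h y.
    by rewrite ler_wpM2l ?addr_ge0//; have /andP[] := r'h y.
  rewrite (integral_marg1 mG' G'0 mr G'1 mphi1)// -(integral_marg1 mL L0 mr L1 mphi1)//.
  under eq_integral do rewrite LE.
  exact: (cross_term mH H0 ma a0 mb mh h0 H1 H2 ab).
have XG : \int[mu1 \x mu2]_z (wgt z * G z)%:E <= (shconst K * e)%:E.
  apply: (X0 _ _ mG G0 G1 _ G2); first by mfun.
  by move=> y; rewrite -abh le_max lexx orbT ge_max normr_ge0 distrC ler_norm.
have XL : \int[mu1 \x mu2]_z (wgt z * L z)%:E <= (shconst K * e)%:E.
  apply: (X0 _ _ mL L0 L1 _ L2); first by mfun.
  by move=> y; rewrite -abh le_max lexx orbT ge_max normr_ge0 ler_norm.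
exists S; split => //.
- apply: (@le_trans _ _ (\int[mu1 \x mu2]_z (c z * H z + C * (wgt z * G z))%:E)).
    apply: le_integralR; [|by mfun|by mfun|] => z.
      by rewrite mulr_ge0.
    have h1 : (S z <= H z + G z)%R by rewrite -SLHG lerDl.
    have := ler_wpM2l (c0 z) h1; have := ler_wpM2r (G0 z) (cC z).
    by rewrite -/(wgt z) -mulrA mulrDr; lra.
  rewrite integralRD//; [|by move=> z; rewrite mulr_ge0|by mfun
    |by move=> z; rewrite mulr_ge0// mulr_ge0// wgt_ge0|by mfun].
  rewrite integralRZ//; [|by move=> z; rewrite mulr_ge0// wgt_ge0|by mfun].
  rewrite leeD2l// -mulrA [leRHS]EFinM; apply: lee_wpmul2l => //; by rewrite lee_fin.
- apply: (@le_trans _ _ (\int[mu1 \x mu2]_z (wgt z * G z + wgt z * L z)%:E)).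
    apply: le_integralR; [|by mfun|by mfun|] => z.
      by rewrite mulr_ge0// wgt_ge0.
    rewrite -mulrDr ler_wpM2l ?wgt_ge0//.
    have -> : (S z - H z = G z - L z)%R by have := SLHG z; lra.
    by rewrite (le_trans (ler_normB _ _))// !ger0_norm.
  rewrite integralRD//; try by [move=> z; rewrite mulr_ge0// wgt_ge0|mfun].
  rewrite -mulrA [X in X%:E](_ : _ = shconst K * e + shconst K * e)%R; last by ring.
  by rewrite EFinD; apply: leeD.
Qed.

End shadow_estimates.

(** * Stability of Gibbs densities *)

Section gibbs_stability.
Context {R : realType} {d1 d2 : measure_display}
  {X1 : measurableType d1} {X2 : measurableType d2}.
Variables (mu1 : probability X1 R) (mu2 : probability X2 R).
Variables (phi1 : X1 -> R) (phi2 : X2 -> R) (alpha M C : R) (c : X1 * X2 -> R).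
Hypotheses (mphi1 : measurable_fun setT phi1) (phi10 : forall x, 0 <= phi1 x)
  (mphi2 : measurable_fun setT phi2) (phi20 : forall x, 0 <= phi2 x)
  (alpha0 : 0 < alpha)
  (exp1 : (\int[mu1]_x (expR (alpha * phi1 x))%:E <= M%:E)%E)
  (exp2 : (\int[mu2]_x (expR (alpha * phi2 x))%:E <= M%:E)%E)
  (mc : measurable_fun setT c) (c0 : forall z, 0 <= c z) (C0 : 0 <= C)
  (cC : forall z, c z <= C * (1 + phi1 z.1 + phi2 z.2)).
Local Open Scope ereal_scope.
Local Notation J := (Jent mu1 mu2 c).
Local Notation wgt := (wgt phi1 phi2).
Local Notation shconst := (shconst alpha M).

Let mphi11 : measurable_fun setT (fun z : X1 * X2 => phi1 z.1).
Proof. exact: measurableT_comp mphi1 measurable_fst. Qed.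
Let mphi22 : measurable_fun setT (fun z : X1 * X2 => phi2 z.2).
Proof. exact: measurableT_comp mphi2 measurable_snd. Qed.
Let mwgt := measurable_wgt mphi1 mphi2.
Let wgt0 := wgt_ge0 phi10 phi20.

(** 12 = 3 * 4: the 3 is that of (1 + s + t)^2 <= 3 (1 + s^2 + t^2), the 4 is the total weight in 3
    S + Hs in the midpoint inequality. *)
Definition momconst : R := (12 * (1 + 8 * M / alpha ^+ 2))%R.

(** Three contributions: the distance of H to its shadow, the near-optimality defect of that shadow,
    and the second moments of the weight. *)
Definition corconst (K : R) : R :=
  (2 * shconst K + (K + 2 * (C * shconst K)) + momconst)%R.

Lemma JentE (H : X1 * X2 -> R) : measurable_fun setT H -> (forall z, 0 <= H z)%R ->
  J H = \int[mu1 \x mu2]_z (klfun (H z))%:E + \int[mu1 \x mu2]_z (c z * H z)%:E.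
Proof.
move=> mH H0; rewrite /Jent integralRD//.
- by move=> z; exact: klfun_ge0.
- exact: measurableT_comp (@measurable_klfun R) mH.
- by move=> z; rewrite mulr_ge0.
- by mfun.
Qed.

Lemma wgt_sqr_moment (H : X1 * X2 -> R) : measurable_fun setT H ->
  (forall z, 0 <= H z)%R -> has_marg1 mu1 mu2 H (cst 1%R) ->
  has_marg2 mu1 mu2 H (cst 1%R) ->
  \int[mu1 \x mu2]_z (wgt z ^+ 2 * H z)%:E <= (momconst / 4)%:E.
Proof.
move=> mH H0 H1 H2.
have m1 : measurable_fun [set: X1] (cst 1%R : X1 -> R) by [].
have m2 : measurable_fun [set: X2] (cst 1%R : X2 -> R) by [].
have mp1 : measurable_fun setT (fun x => phi1 x ^+ 2)%R by mfun.
have mp2 : measurable_fun setT (fun x => phi2 x ^+ 2)%R by mfun.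
have s1 z : (0 <= phi1 z.1 ^+ 2 * H z)%R by rewrite mulr_ge0// sqr_ge0.
have s2 z : (0 <= phi2 z.2 ^+ 2 * H z)%R by rewrite mulr_ge0// sqr_ge0.
have ms1 : measurable_fun setT (fun z => phi1 z.1 ^+ 2 * H z)%R by mfun.
have ms2 : measurable_fun setT (fun z => phi2 z.2 ^+ 2 * H z)%R by mfun.
apply: (@le_trans _ _ (\int[mu1 \x mu2]_z
   (3 * (H z + (phi1 z.1 ^+ 2 * H z + phi2 z.2 ^+ 2 * H z)))%:E)).
  apply: le_integralR; [|by mfun|by mfun|] => z.
    by rewrite mulr_ge0// sqr_ge0.
  rewrite -{2}[H z]mul1r -!mulrDl mulrA ler_wpM2r// /wgt.
  have := sqr_ge0 (phi1 z.1 - phi2 z.2)%R; have := sqr_ge0 (1 - phi1 z.1)%R.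
  by have := sqr_ge0 (1 - phi2 z.2)%R; lra.
rewrite integralRZ//; [|by move=> z; rewrite !addr_ge0|by mfun].
rewrite integralRD//; [|by move=> z; rewrite addr_ge0|by mfun].
rewrite integralRD//.
rewrite (integral_total1 mH H0 m1 H1) integral_cst_prob.
rewrite (integral_marg1 mH H0 m1 H1 mp1); last by move=> x; exact: sqr_ge0.
rewrite (integral_marg2 mH H0 m2 H2 mp2); last by move=> x; exact: sqr_ge0.
under eq_integral do rewrite mulr1.
under [X in _ + (_ + X)]eq_integral do rewrite mulr1.
apply: (@le_trans _ _ (3%:E * (1%:E + ((4 / alpha ^+ 2 * M)%:E +
    (4 / alpha ^+ 2 * M)%:E)))).
  apply: lee_wpmul2l => //; apply: leeD2l; apply: leeD; exact: integral_sqr_le.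
rewrite [leLHS](_ : _ = (3 * (1 + (4 / alpha ^+ 2 * M + 4 / alpha ^+ 2 * M)))%:E)//.
rewrite lee_fin /momconst le_eqVlt; apply/orP; left; apply/eqP; field.
by rewrite gt_eqF.
Qed.

Variable Hs : X1 * X2 -> R.
Hypotheses (mHs : measurable_fun setT Hs) (Hs0 : forall z, (0 <= Hs z)%R)
  (Hs1 : has_marg1 mu1 mu2 Hs (cst 1%R)) (Hs2 : has_marg2 mu1 mu2 Hs (cst 1%R))
  (opt : forall S : X1 * X2 -> R, measurable_fun setT S -> (forall z, 0 <= S z)%R ->
    has_marg1 mu1 mu2 S (cst 1%R) -> has_marg2 mu1 mu2 S (cst 1%R) -> J Hs <= J S)
  (Jfin : J Hs < +oo).

Let JHsfin : J Hs \is a fin_num.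
Proof.
rewrite ge0_fin_numE//; apply: integralR_ge0 => z.
by rewrite addr_ge0 ?mulr_ge0// klfun_ge0.
Qed.

(** The midpoint of S and the optimizer is admissible, so its value is at least the optimum.
    Integrating [klfun_midpoint_gap] with s = e wgt bounds e times the distance by the defect K e^2
    plus e^2 times second moments; divide by e. *)
Lemma near_optimal_tv (S : X1 * X2 -> R) (K e : R) :
  measurable_fun setT S -> (forall z, 0 <= S z)%R ->
  has_marg1 mu1 mu2 S (cst 1%R) -> has_marg2 mu1 mu2 S (cst 1%R) ->
  (0 < e)%R -> J S <= J Hs + (K * e ^+ 2)%:E ->
  \int[mu1 \x mu2]_z (wgt z * `|S z - Hs z|)%:E <= ((K + momconst) * e)%:E.
Proof.
move=> mS S0 S1 S2 e0 JS.
pose m z := ((S z + Hs z) / 2)%R.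
have mm : measurable_fun setT m by rewrite /m; mfun.
have m0 z : (0 <= m z)%R by rewrite /m divr_ge0// addr_ge0.
have half d (T : measurableType d) (mu : probability T R) (f g : T -> R) :
    measurable_fun setT f -> (forall x, 0 <= f x)%R ->
    measurable_fun setT g -> (forall x, 0 <= g x)%R ->
    \int[mu]_x (f x)%:E = 1 -> \int[mu]_x (g x)%:E = 1 ->
    \int[mu]_x ((f x + g x) / 2)%:E = 1.
  move=> mf f0 mg g0 f1 g1; under eq_integral do rewrite mulrC.
  rewrite integralRZ//; [|by move=> x; rewrite addr_ge0|by mfun].
  rewrite integralRD// f1 g1 [LHS](_ : _ = (2^-1 * (1 + 1))%:E)//; congr EFin; lra.
have Jm : J Hs <= J m.
  apply: opt => //.
    move: S1 Hs1; apply: filterS2 => x h1 h2.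
    by apply: half => //; exact: measurable_fun_pair2.
  move: S2 Hs2; apply: filterS2 => x h1 h2.
  by apply: half => //; exact: measurable_fun_pair1.
have mkl (f : X1 * X2 -> R) : measurable_fun setT f ->
    measurable_fun setT (fun z => klfun (f z)).
  exact: measurableT_comp (@measurable_klfun R).
have mkm := mkl _ mm; have mkS := mkl _ mS; have mkHs := mkl _ mHs.
have mX : measurable_fun setT (fun z => wgt z * `|S z - Hs z|)%R by mfun.
have X0 z : (0 <= wgt z * `|S z - Hs z|)%R by rewrite mulr_ge0.
pose A (f : X1 * X2 -> R) z := (klfun (f z) + c z * f z)%R.
have mA f : measurable_fun setT f -> measurable_fun setT (A f).
  by move=> mf; rewrite /A; have := mkl _ mf => mkf; mfun.
have A0 (f : X1 * X2 -> R) : (forall z, 0 <= f z)%R -> forall z, (0 <= A f z)%R.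
  by move=> f0 z; rewrite /A addr_ge0 ?mulr_ge0// klfun_ge0.
have mAm := mA _ mm; have mAS := mA _ mS; have mAHs := mA _ mHs.
have Am0 := A0 _ m0; have AS0 := A0 _ S0; have AHs0 := A0 _ Hs0.
pose Bd z := (3 * (wgt z ^+ 2 * S z) + wgt z ^+ 2 * Hs z)%R.
have w2S z : (0 <= wgt z ^+ 2 * S z)%R by rewrite mulr_ge0// sqr_ge0.
have w2H z : (0 <= wgt z ^+ 2 * Hs z)%R by rewrite mulr_ge0// sqr_ge0.
have B0 z : (0 <= Bd z)%R by rewrite /Bd addr_ge0// mulr_ge0.
have mw2S : measurable_fun setT (fun z => wgt z ^+ 2 * S z)%R by mfun.
have mw2H : measurable_fun setT (fun z => wgt z ^+ 2 * Hs z)%R by mfun.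
have mB : measurable_fun setT Bd by rewrite /Bd; mfun.
have IB : \int[mu1 \x mu2]_z (Bd z)%:E <= momconst%:E.
  rewrite /Bd integralRD//; [|by move=> z; rewrite mulr_ge0|by mfun].
  rewrite integralRZ//.
  apply: (@le_trans _ _ (3%:E * (momconst / 4)%:E + (momconst / 4)%:E)).
    apply: leeD; last exact: wgt_sqr_moment.
    by apply: lee_wpmul2l => //; exact: wgt_sqr_moment.
  rewrite [leLHS](_ : _ = (3 * (momconst / 4) + momconst / 4)%:E)// lee_fin; lra.
have e2 := sqr_ge0 e.
have key : 2%:E * J m + e%:E * \int[mu1 \x mu2]_z (wgt z * `|S z - Hs z|)%:E <=
    J S + J Hs + (e ^+ 2)%:E * \int[mu1 \x mu2]_z (Bd z)%:E.
  have JA f : J f = \int[mu1 \x mu2]_z (A f z)%:E by [].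
  have e0' := ltW e0.
  rewrite !JA -!integralRZ//.
  rewrite -!integralRD//; try by [mfun|move=> z; rewrite mulr_ge0//
    |move=> z; rewrite addr_ge0].
  apply: le_integralR; [|by mfun|by mfun|] => z.
    by rewrite addr_ge0 ?mulr_ge0.
  have := klfun_midpoint_gap (S0 z) (Hs0 z) (mulr_ge0 (ltW e0) (wgt0 z)).
  rewrite -/(m z) /Bd exprMn /A => gap.
  have -> : (2 * (klfun (m z) + c z * m z) = 2 * klfun (m z) + (c z * S z + c z * Hs z))%R.
    by rewrite {2}/m; field.
  by move: gap; set W := wgt z; set U := (`|_|)%R; lra.
have e0' := ltW e0.
have key2 : 2%:E * J Hs + e%:E * \int[mu1 \x mu2]_z (wgt z * `|S z - Hs z|)%:E <=
    2%:E * J Hs + ((K + momconst) * e ^+ 2)%:E.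
  apply: (@le_trans _ _ (J S + J Hs + (e ^+ 2)%:E * \int[mu1 \x mu2]_z (Bd z)%:E)).
    by apply: le_trans key; apply: leeD2r; apply: lee_wpmul2l.
  apply: (@le_trans _ _ (J Hs + (K * e ^+ 2)%:E + J Hs + (e ^+ 2)%:E * momconst%:E)).
    apply: leeD; first exact: leeD2r.
    by apply: lee_wpmul2l => //; rewrite lee_fin.
  rewrite -(fineK JHsfin); set j := fine _.
  rewrite [leLHS](_ : _ = (j + K * e ^+ 2 + j + e ^+ 2 * momconst)%:E)//.
  rewrite [leRHS](_ : _ = (2 * j + (K + momconst) * e ^+ 2)%:E)//.
  by rewrite lee_fin; lra.
move: key2; rewrite leeD2lE; last by rewrite fin_numM.
move=> /(@lee_wpmul2l _ (e^-1)%:E); rewrite lee_fin invr_ge0 e0' => /(_ isT).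
rewrite muleA -EFinM mulVf ?gt_eqF// mul1e => /le_trans; apply.
rewrite -EFinM lee_fin le_eqVlt; apply/orP; left; apply/eqP; field.
by rewrite gt_eqF.
Qed.

Variables (u : X1 -> R) (v h : X2 -> R) (Kv K e : R).
Let H z := (u z.1 * v z.2 * expR (- c z))%R.
Hypotheses (mu : measurable_fun setT u) (u0 : forall x, (0 < u x)%R)
  (mv : measurable_fun setT v) (v0 : forall y, (0 < v y)%R)
  (mh : measurable_fun setT h) (h0 : forall y, (0 < h y)%R)
  (H1 : has_marg1 mu1 mu2 H (cst 1%R)) (H2 : has_marg2 mu1 mu2 H h)
  (iu : mu1.-integrable setT (EFin \o (fun x => ln (u x))))
  (Kv0 : (0 <= Kv)%R) (vK : forall y, (ln (v y) <= Kv * (1 + phi2 y))%R)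
  (e01 : (0 < e <= 1)%R) (K0 : (0 <= K)%R)
  (hK : (\int[mu2]_y (klfun (h y))%:E <= (K * (e ^+ 2) ^+ 2)%:E)%E).

Lemma gibbs_stability : [/\
  J H <= J Hs + ((K + C * shconst K) * e ^+ 2)%:E,
  J Hs <= J H + (C * shconst K * e ^+ 2)%:E &
  \int[mu1 \x mu2]_z (wgt z * `|H z - Hs z|)%:E <= (corconst K * e)%:E].
Proof.
have /andP[e0 e1] := e01.
have ee : (0 < e ^+ 2 <= 1)%R by rewrite exprn_gt0//= exprn_ile1// ltW.
have /andP[ee0 ee1] := ee.
have mu1' : measurable_fun setT (fun z : X1 * X2 => u z.1).
  exact: measurableT_comp mu measurable_fst.
have mv2' : measurable_fun setT (fun z : X1 * X2 => v z.2).
  exact: measurableT_comp mv measurable_snd.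
have mH : measurable_fun setT H by rewrite /H; mfun.
have H0 z : (0 <= H z)%R by rewrite /H !mulr_ge0 ?expR_ge0// ltW.
have h0' y := ltW (h0 y).
have m1 : measurable_fun [set: X1] (cst 1%R : X1 -> R) by [].
have m2 : measurable_fun [set: X2] (cst 1%R : X2 -> R) by [].
have h1 : \int[mu2]_y (h y)%:E = 1.
  have := integral_marg2 mH H0 mh H2 m2 (fun=> ler01).
  under eq_integral do rewrite /= mul1r.
  under [in RHS]eq_integral do rewrite /= mul1r.
  by move=> <-; rewrite (integral_total1 mH H0 m1 H1) integral_cst_prob.
have hsq1 y : (h y * (Num.max (h y - 1) 0 / h y) ^+ 2 <= 4 * klfun (h y))%R.
  have [hy|hy] := leP (h y) 1%R.
    rewrite max_r ?subr_le0// mul0r expr0n mulr0 mulr_ge0// klfun_ge0//.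
  rewrite max_l ?subr_ge0 ?(ltW hy)//.
  rewrite mulrBl mul1r divff ?gt_eqF//.
  exact: (klfun_sqr_ge1 (ltW hy)).
have hsq2 y : (1 * (Num.max (1 - h y) 0 / 1) ^+ 2 <= 4 * klfun (h y))%R.
  rewrite mul1r divr1; have [hy|hy] := leP (h y) 1%R.
    by rewrite max_l ?subr_ge0// klfun_sqr_le1// h0'.
  by rewrite max_r ?subr_le0 ?(ltW hy)// expr0n mulr_ge0// klfun_ge0.
have mkh : measurable_fun setT (fun y => klfun (h y)).
  exact: measurableT_comp (@measurable_klfun R) mh.
have M0 : (0 <= M)%R.
  by rewrite -lee_fin; apply: le_trans exp1; apply: integralR_ge0 => x; exact: expR_ge0.
have sh0 : (0 <= shconst K)%R.
  rewrite /shconst /tvconst addr_ge0//.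
    by rewrite mulr_ge0 ?divr_ge0 ?(ltW alpha0)// addr_ge0// !mulr_ge0// expR_ge0.
  by rewrite addr_ge0 ?mulr_ge0// invr_ge0 sqr_ge0.
(* [S] moves H to the marginals (1, 1) and competes with [Hs]; [S'] moves [Hs] to the marginals (1,
   h) and competes with H. *)
have [S [[mS S0 S1 S2] Sk Sc Sd]] := shadow_estimate mphi1 phi10 mphi2 phi20 alpha0
  exp1 exp2 mc c0 C0 cC mH H0 mh h0 m2 (fun=> ltr01) mh h0' H1 H2
  (integral_cst_prob mu2 1) hsq1 (fun y => erefl) ee hK.
have [S' [[mS' S0' S1' S2'] Sk' Sc' _]] := shadow_estimate mphi1 phi10 mphi2 phi20 alpha0
  exp1 exp2 mc c0 C0 cC mHs Hs0 m2 (fun=> ltr01) mh h0 mh h0' Hs1 Hs2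
  h1 hsq2 (fun y => distrC _ _) ee hK.
have int1 (F : X1 * X2 -> R) : \int[mu1 \x mu2]_z (klfun (F z))%:E =
    \int[mu1 \x mu2]_z (cst 1%R z.2 * klfun (F z / cst 1%R z.2))%:E.
  by apply: eq_integral => z _; rewrite /= mul1r divr1.
have leeDA (x y x' y' t : \bar R) : x <= x' -> y <= y' + t -> x + y <= x' + y' + t.
  by move=> xx yy; rewrite -addeA; exact: leeD.
(* In this direction the entropy of [h], being nonnegative, is simply dropped. *)
have JS : J S <= J H + (C * shconst K * e ^+ 2)%:E.
  rewrite !JentE//; apply: leeDA => //.
  rewrite (int1 S); apply: (le_trans Sk); rewrite (entropy_chain mH H0 mh h0 H2).
  by rewrite leeDl//; apply: integralR_ge0 => y; exact: klfun_ge0.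
have JHs : J Hs <= J S by exact: opt.
(* Here the entropy of [h] is added; it is at most K e^4 <= K e^2. *)
have JS' : J S' <= J Hs + ((K + C * shconst K) * e ^+ 2)%:E.
  rewrite !JentE// (entropy_chain mS' S0' mh h0 S2').
  rewrite mulrDl EFinD.
  have leeDAC (x y t x' y' t1 t2 : \bar R) : x <= x' -> y <= t1 -> t <= y' + t2 ->
      x + y + t <= x' + y' + (t1 + t2).
    by move=> ? ? ?; rewrite addeACA; apply: leeD => //; exact: leeD.
  apply: leeDAC => //.
    by rewrite (int1 Hs).
  apply: (le_trans hK); rewrite lee_fin ler_wpM2l// expr2.
  by rewrite -[leRHS]mulr1 ler_wpM2l// ltW.
have JH : J H <= J S'.
  apply: (@Jent_gibbs_min _ _ _ _ _ _ _ c u v h S' (fun y => Kv * (1 + phi2 y))%R) => //.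
  - by mfun.
  - by move=> y; rewrite mulr_ge0// addr_ge0.
  (* (1 + phi2) h is integrable: in h <= |h - 1| + 1 the first term is handled by weighted Pinsker,
     the second by the moments of phi2. *)
  have mp2 : measurable_fun setT (fun y => phi2 y ^+ 2)%R by mfun.
  have mq : measurable_fun setT (fun y => (1 + phi2 y) * `|h y - 1|)%R by mfun.
  have q0 y : (0 <= (1 + phi2 y) * `|h y - 1|)%R by rewrite mulr_ge0// addr_ge0.
  apply: (@le_lt_trans _ _ (\int[mu2]_y (Kv * ((1 + phi2 y) * `|h y - 1| +
      (2 + phi2 y ^+ 2)))%:E)).
    apply: le_integralR; [|by mfun|by mfun|] => y.
      by rewrite !mulr_ge0// addr_ge0.
    rewrite -mulrA ler_wpM2l//.
    have : (h y <= `|h y - 1| + 1)%R by have := ler_norm (h y - 1)%R; lra.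
    have p1 : (0 <= 1 + phi2 y)%R by rewrite addr_ge0.
    move=> /(ler_wpM2l p1); have := sqr_ge0 (phi2 y - 1)%R.
    by set A := (`|_|)%R; nra.
  have z2 y : (0 <= 2 + phi2 y ^+ 2)%R by rewrite addr_ge0// sqr_ge0.
  rewrite integralRZ//; [|by move=> y; rewrite addr_ge0|by mfun].
  rewrite integralRD//; last by mfun.
  rewrite integralRD//; last by move=> y; exact: sqr_ge0.
  rewrite lte_mul_pinfty//.
  apply: lte_add_pinfty.
    by apply: le_lt_trans (weighted_pinsker mphi2 phi20 alpha0 exp2 mh h0' ee hK) _;
      rewrite ltry.
  rewrite integral_cst_prob lte_add_pinfty ?ltry//.
  by apply: le_lt_trans (integral_sqr_le mphi2 phi20 alpha0 exp2) _; rewrite ltry.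
have JHHs := le_trans JH JS'.
split => //; first exact: le_trans JHs JS.
have JS2 : J S <= J Hs + ((K + 2 * (C * shconst K)) * e ^+ 2)%:E.
  apply: (le_trans JS).
  have -> : ((K + 2 * (C * shconst K)) * e ^+ 2 = (K + C * shconst K) * e ^+ 2 +
     C * shconst K * e ^+ 2)%R by ring.
  by rewrite EFinD addeA leeD2r.
have X1' := near_optimal_tv mS S0 S1 S2 e0 JS2.
apply: (@le_trans _ _ (\int[mu1 \x mu2]_z
   (wgt z * `|S z - H z| + wgt z * `|S z - Hs z|)%:E)).
  apply: le_integralR; [|by mfun|by mfun|] => z; first by rewrite mulr_ge0.
  rewrite -mulrDr ler_wpM2l//.
  have -> : (H z - Hs z = (S z - Hs z) - (S z - H z))%R by ring.
  by rewrite (le_trans (ler_normB _ _))// addrC.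
rewrite integralRD//; try by [mfun|move=> z; rewrite mulr_ge0].
apply: (le_trans (leeD Sd X1')).
rewrite -EFinD lee_fin /corconst -[in leRHS]addrA [in leRHS]mulrDl lerD2r.
rewrite ler_wpM2l ?mulr_ge0// expr2 -[leRHS]mulr1 ler_wpM2l// ltW//.
Qed.

End gibbs_stability.

(** * The Sinkhorn half step *)

Lemma integral_indicM d (T : measurableType d) (R : realType)
    (mu : {measure set T -> \bar R}) (f : T -> R) A :
  (\int[mu]_(x in A) (f x)%:E = \int[mu]_x (\1_A x * f x)%:E)%E.
Proof.
rewrite integral_mkcond; apply: eq_integral => x _; rewrite patchE indicE.
by case: ifPn => _; rewrite ?mul1r ?mul0r.
Qed.

Lemma integral_gt0_prob d (T : measurableType d) (R : realType)
    (mu : probability T R) (f : T -> R) :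
  measurable_fun setT f -> (forall x, 0 < f x) -> (0 < \int[mu]_x (f x)%:E)%E.
Proof.
move=> mf f0; rewrite lt_neqAle integralR_ge0 ?andbT; last by move=> x; exact: ltW.
apply/eqP => /esym i0.
have : ae_eq mu setT (EFin \o f) (cst 0%E).
  apply/ae_eq_integral_abs => //; first exact/measurable_EFinP.
  by under eq_integral do rewrite /= gtr0_norm//.
move=> ae0; have : {ae mu, forall x : T, False}.
  by apply: filterS ae0 => x /(_ I) [] fx; have := f0 x; rewrite fx ltxx.
case=> A [mA A0 sA]; have AT : A = setT.
  by apply/seteqP; split => // x _; apply: sA => /=.
have := @probability_setT _ _ _ mu; rewrite -AT A0 => /eqP.
by rewrite eq_sym onee_eq0.
Qed.

Section half_step.
Context {R : realType} {d1 d2 : measure_display}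
  {X1 : measurableType d1} {X2 : measurableType d2}.
Variables (mu1 : probability X1 R) (mu2 : probability X2 R).
Variables (phi1 : X1 -> R) (phi2 : X2 -> R) (alpha M C : R) (c : X1 * X2 -> R).
Hypotheses (mphi1 : measurable_fun setT phi1) (phi10 : forall x, 0 <= phi1 x)
  (mphi2 : measurable_fun setT phi2) (phi20 : forall x, 0 <= phi2 x)
  (alpha0 : 0 < alpha)
  (exp1 : (\int[mu1]_x (expR (alpha * phi1 x))%:E <= M%:E)%E)
  (exp2 : (\int[mu2]_x (expR (alpha * phi2 x))%:E <= M%:E)%E)
  (mc : measurable_fun setT c) (c0 : forall z, 0 <= c z) (C0 : 0 <= C)
  (cC : forall z, c z <= C * (1 + phi1 z.1 + phi2 z.2)).
Local Open Scope ereal_scope.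

Definition gibbs (u : X1 -> R) (v : X2 -> R) (z : X1 * X2) : R :=
  (u z.1 * v z.2 * expR (- c z))%R.

(* The value [1] is junk: the integral is finite almost everywhere. *)
Definition sinkhorn_update (v : X2 -> R) (x : X1) : R :=
  let g := \int[mu2]_y (v y * expR (- c (x, y)))%:E in
  let n : R := if g < +oo then fine g else 1%R in (n^-1)%R.

Lemma integrable_phi d (T : measurableType d) (mu : probability T R) (phi : T -> R) :
  measurable_fun setT phi -> (forall x, 0 <= phi x)%R ->
  \int[mu]_x (expR (alpha * phi x))%:E <= M%:E ->
  mu.-integrable setT (EFin \o phi).
Proof.
move=> mphi phi0 expM; apply: integrableR_ge0 => //.
have mp2 : measurable_fun setT (fun x => phi x ^+ 2)%R by mfun.
apply: (@le_lt_trans _ _ (\int[mu]_x (1 + phi x ^+ 2)%:E)).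
  apply: le_integralR => //; first by mfun.
  by move=> x; have := sqr_ge0 (phi x - 1)%R; have := phi0 x; nra.
rewrite integralRD//; last by move=> x; exact: sqr_ge0.
rewrite integral_cst_prob lte_add_pinfty ?ltry//.
by apply: le_lt_trans (integral_sqr_le mphi phi0 alpha0 expM) _; rewrite ltry.
Qed.

Variables (u : X1 -> R) (v : X2 -> R).
Hypotheses (mu : measurable_fun setT u) (u0 : forall x, (0 < u x)%R)
  (mv : measurable_fun setT v) (v0 : forall y, (0 < v y)%R)
  (iu : mu1.-integrable setT (EFin \o (fun x => ln (u x))))
  (iv : mu2.-integrable setT (EFin \o (fun y => ln (v y))))
  (H1 : \int[mu1 \x mu2]_z (gibbs u v z)%:E = 1).

Let u' := sinkhorn_update v.
(** Density of the first marginal before the update, see [gibbs_marg1]. *)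
Let a x := (u x / u' x)%R.
Let F z := (v z.2 * expR (- c z))%R.
Let g x := \int[mu2]_y (F (x, y))%:E.

Lemma measurable_gibbs w : measurable_fun setT w -> measurable_fun setT (gibbs w v).
Proof.
move=> mw.
have mw1 : measurable_fun setT (fun z : X1 * X2 => w z.1).
  exact: measurableT_comp mw measurable_fst.
have mv2' : measurable_fun setT (fun z : X1 * X2 => v z.2).
  exact: measurableT_comp mv measurable_snd.
by rewrite /gibbs; mfun.
Qed.

Lemma gibbs_gt0 w z : (forall x, 0 < w x)%R -> (0 < gibbs w v z)%R.
Proof. by move=> w0; rewrite /gibbs !mulr_gt0// expR_gt0. Qed.

Let mF : measurable_fun setT F.
Proof.
have mv2' : measurable_fun setT (fun z : X1 * X2 => v z.2).
  exact: measurableT_comp mv measurable_snd.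
by rewrite /F; mfun.
Qed.

Let F0 z : (0 < F z)%R. Proof. by rewrite /F mulr_gt0// expR_gt0. Qed.
Let F0' z : (0 <= F z)%R. Proof. exact: ltW. Qed.
Let mFx x : measurable_fun setT (fun y => F (x, y)).
Proof. exact: measurable_fun_pair2. Qed.
Let mg : measurable_fun setT g. Proof. exact: (measurable_integral1 mu2 mF F0'). Qed.
Let g0 x : 0 < g x. Proof. exact: (integral_gt0_prob mu2 (mFx x)). Qed.

Let int_gibbs w x : (forall x, 0 < w x)%R ->
  \int[mu2]_y (gibbs w v (x, y))%:E = (w x)%:E * g x.
Proof.
move=> w0; rewrite -integralRZ ?(ltW (w0 x))//.
by apply: eq_integral => y _; rewrite /gibbs /F /= mulrA.
Qed.

(** u g has integral 1 and u is positive. *)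
Let gfin : {ae mu1, forall x, g x < +oo}.
Proof.
have mG := measurable_gibbs mu.
have G0 z : (0 <= gibbs u v z)%R by rewrite ltW// gibbs_gt0.
have : mu1.-integrable setT (fun x => (u x)%:E * g x).
  apply/integrableP; split; first by apply: emeasurable_funM => //; exact/measurable_EFinP.
  under eq_integral => x _.
    rewrite gee0_abs; last by rewrite mule_ge0 ?lee_fin ?ltW//.
    rewrite -int_gibbs//; over.
  by rewrite -integral_prod1// H1 ltry.
move/(integrable_ae measurableT); apply: filterS => x /(_ I) h.
rewrite ltNge leye_eq; apply/eqP => goo; move: h.
by rewrite goo gt0_muley// lte_fin.
Qed.

Let k x : R := if g x < +oo then fine (g x) else 1%R.
Let k0 x : (0 < k x)%R.
Proof.
rewrite /k; case: ifPn => // h; rewrite fine_gt0// h andbT; exact: g0.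
Qed.
Let mk : measurable_fun setT k.
Proof.
apply: measurable_fun_ifT => //; first exact: measurable_fun_lte.
exact: measurableT_comp (fine_measurable measurableT) mg.
Qed.

Lemma measurable_update : measurable_fun setT u'.
Proof. exact: (measurable_funV mk k0). Qed.

Lemma update_gt0 x : (0 < u' x)%R.
Proof. by rewrite /u' /sinkhorn_update invr_gt0; exact: k0. Qed.

Let u'V x : ((u' x)^-1 = k x)%R. Proof. by rewrite /u' /sinkhorn_update invrK. Qed.

Let gk x : g x < +oo -> g x = (k x)%:E.
Proof.
by move=> h; rewrite /k h fineK// ge0_fin_numE// ltW.
Qed.

Lemma update_marg1 : has_marg1 mu1 mu2 (gibbs u' v) (cst 1%R).
Proof.
apply: filterS gfin => x /gk gx; rewrite (int_gibbs _ update_gt0) gx -u'V -EFinM.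
by rewrite mulfV// gt_eqF// update_gt0.
Qed.

Lemma gibbs_marg1 : has_marg1 mu1 mu2 (gibbs u v) a.
Proof. by apply: filterS gfin => x /gk gx; rewrite int_gibbs// gx -EFinM /a u'V. Qed.

Lemma measurable_ratio : measurable_fun setT a.
Proof.
apply: measurable_funM => //; exact: (measurable_funV measurable_update update_gt0).
Qed.

Lemma ratio_gt0 x : (0 < a x)%R.
Proof. by rewrite /a divr_gt0// update_gt0. Qed.

(** Jensen for the logarithm gives - ln g(x) <= - \int ln F(x, y) dmu2(y), and the growth of c turns
    the right side into a multiple of 1 + phi1. The bound holds at every x. *)
Lemma update_upper : exists2 K : R, (0 <= K)%R &
  forall x, (ln (u' x) <= K * (1 + phi1 x))%R.
Proof.
have iphi2 := integrable_phi mphi2 phi20 exp2.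
have /fineK em := integrable_fin_num measurableT iphi2.
have /fineK ev := integrable_fin_num measurableT iv.
set m2 : R := fine _ in em; set lv : R := fine _ in ev.
have m20 : (0 <= m2)%R by rewrite -lee_fin em; exact: integralR_ge0.
have K0 : (0 <= C * (1 + m2) + `|lv|)%R by rewrite addr_ge0// mulr_ge0// addr_ge0.
exists (C * (1 + m2) + `|lv|)%R => // x.
have lnu : (ln (u' x) = - ln (k x))%R by rewrite -u'V lnV ?opprK// posrE update_gt0.
(* Where g is infinite, the default value 1 has logarithm 0. *)
rewrite lnu; have [goo|goo] := boolP (g x < +oo); last first.
  by rewrite /k (negbTE goo) ln1 oppr0 mulr_ge0// addr_ge0.
have gx := gk goo.
have iF : mu2.-integrable setT (EFin \o (fun y => F (x, y))).
  by apply: integrableR_ge0.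
have i1 : mu2.-integrable setT (EFin \o (cst 1%R : X2 -> R)).
  apply: integrableR_ge0 => //=; by rewrite integral_cst_prob ltry.
have Cm : (C * phi1 x <= C * (1 + m2) * phi1 x)%R.
  by rewrite ler_wpM2r// -[leLHS]mulr1 ler_wpM2l// lerDl.
have : (lv - C * m2 <= 1 + (ln (k x) - 1 + C * (1 + phi1 x)))%R.
  rewrite -lee_fin.
  have -> : (lv - C * m2)%:E = \int[mu2]_y (1 * ln (v y) + (- C) * phi2 y)%:E.
    rewrite (integral_lincomb 1 (- C) iv iphi2) -em -ev -!EFinM -EFinD.
    by congr EFin; ring.
  have -> : (1 + (ln (k x) - 1 + C * (1 + phi1 x)))%:E =
     \int[mu2]_y ((k x)^-1 * F (x, y) + (ln (k x) - 1 + C * (1 + phi1 x)) * 1)%:E.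
    rewrite (integral_lincomb _ _ iF i1) -/(g x) gx -EFinM mulVf ?gt_eqF//.
    by rewrite integral_cst_prob -EFinM mulr1 -EFinD.
  apply: le_integral => //.
  - exact: (integrable_lincomb 1 (- C) iv iphi2).
  - exact: (integrable_lincomb _ _ iF i1).
  move=> y _; rewrite lee_fin.
  have : (ln (F (x, y) / k x) <= F (x, y) / k x - 1)%R.
    by apply: ln_le_subr1; rewrite divr_gt0.
  rewrite ln_div ?posrE// {1}/F lnM ?posrE ?expR_gt0// expRK /=.
  have := cC (x, y); rewrite /= [((k x)^-1 * _)%R]mulrC; lra.
have := ler_norm (- lv)%R; rewrite normrN.
have p1 := phi10 x; have n1 := normr_ge0 lv.
have : (`|lv| <= `|lv| * (1 + phi1 x))%R by rewrite ler_peMr// lerDl.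
lra.
Qed.

Lemma integrable_ratio : mu1.-integrable setT (EFin \o a).
Proof.
have G0 z : (0 <= gibbs u v z)%R by rewrite ltW// gibbs_gt0.
apply: integrableR_ge0; [by move=> x; rewrite ltW// ratio_gt0|exact: measurable_ratio|].
by rewrite -(integral_total1 (measurable_gibbs mu) G0 measurable_ratio gibbs_marg1) H1 ltry.
Qed.

Lemma integral_ratio : \int[mu1]_x (a x)%:E = 1.
Proof.
have G0 z : (0 <= gibbs u v z)%R by rewrite ltW// gibbs_gt0.
by rewrite -(integral_total1 (measurable_gibbs mu) G0 measurable_ratio gibbs_marg1) H1.
Qed.

Let lna x : (ln (a x) = ln (u x) - ln (u' x))%R.
Proof. by rewrite /a ln_div// posrE// update_gt0. Qed.

Let mlnu' : measurable_fun setT (fun x => ln (u' x)).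
Proof. have := measurable_update; by move=> ?; mfun. Qed.

(** From above by [update_upper]; from below by ln u' = ln u - ln a >= ln u - a + 1, with [a]
    integrable. *)
Lemma integrable_ln_update : mu1.-integrable setT (EFin \o (fun x => ln (u' x))).
Proof.
have [K K0 uK] := update_upper.
have iabs : mu1.-integrable setT (EFin \o (fun x => `|ln (u x)|%R)).
  exact: integrable_abse iu.
have i1 : mu1.-integrable setT (EFin \o (cst 1%R : X1 -> R)).
  by apply: integrableR_ge0 => //=; rewrite integral_cst_prob ltry.
have iphi1 := integrable_phi mphi1 phi10 exp1.
have I1 := integrable_lincomb 1 1 iabs integrable_ratio.
have I2 := integrable_lincomb (K + 1) K i1 iphi1.
have I3 := integrable_lincomb 1 1 I1 I2.
apply: le_integrableR I3 _ => //= x.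
rewrite !mul1r mulr1.
have h1 := uK x; have h2 := ln_le_subr1 (ratio_gt0 x); rewrite lna in h2.
have h3 := ler_norm (ln (u x)); have h4 := ler_norm (- ln (u x)).
rewrite normrN in h4; have h5 := ratio_gt0 x; have h6 := mulr_ge0 K0 (phi10 x).
by rewrite ler_norml; apply/andP; split; lra.
Qed.

(** Since [a] has total mass one, only - ln a = ln u' - ln u survives: the dual gain of an update is
    a reverse entropy. *)
Lemma integral_rklfun_ratio : \int[mu1]_x (rklfun (a x))%:E =
  \int[mu1]_x (ln (u' x))%:E - \int[mu1]_x (ln (u x))%:E.
Proof.
have i1 : mu1.-integrable setT (EFin \o (cst 1%R : X1 -> R)).
  by apply: integrableR_ge0 => //=; rewrite integral_cst_prob ltry.
have I1 := integrable_lincomb 1 (-1) integrable_ratio i1.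
have I2 := integrable_lincomb 1 (-1) integrable_ln_update iu.
transitivity (\int[mu1]_x (1 * (1 * a x + -1 * 1) + 1 * (1 * ln (u' x) + -1 * ln (u x)))%:E).
  by apply: eq_integral => x _; congr EFin; rewrite /rklfun lna; ring.
rewrite (integral_lincomb 1 1 I1 I2) (integral_lincomb 1 (-1) integrable_ratio i1).
rewrite (integral_lincomb 1 (-1) integrable_ln_update iu) integral_ratio integral_cst_prob.
by rewrite !mul1e !EFinN !mulN1e subee// add0e.
Qed.

(** The factor in the definition of the iterates is determined only almost everywhere: testing on
    sets gives r a = 1, hence r u = u', outside a null set of x. *)
Lemma update_density (r : X1 -> R) (w : X1 * X2 -> R) :
  measurable_fun setT r -> (forall x, 0 <= r x)%R ->
  (forall B, measurable B ->
    mu1 B = \int[mu1 \x mu2]_z (\1_B z.1 * (r z.1 * gibbs u v z))%:E) ->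
  measurable_fun setT w -> (forall z, 0 <= w z)%R ->
  \int[mu1 \x mu2]_z (w z * (r z.1 * gibbs u v z))%:E =
  \int[mu1 \x mu2]_z (w z * gibbs u' v z)%:E.
Proof.
move=> mr r0 rB mw w0.
have mG := measurable_gibbs mu; have mG' := measurable_gibbs measurable_update.
have G0 z : (0 <= gibbs u v z)%R by rewrite ltW// gibbs_gt0.
have G0' z : (0 <= gibbs u' v z)%R by rewrite ltW// gibbs_gt0//; exact: update_gt0.
have mr1 : measurable_fun setT (fun z : X1 * X2 => r z.1).
  exact: measurableT_comp mr measurable_fst.
have ma := measurable_ratio.
have ra : {ae mu1, forall x, (r x * a x = 1)%R}.
  apply: density_unique => //; [by mfun| |..].
  - by move=> x; rewrite mulr_ge0// ltW// ratio_gt0.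
  - rewrite -(integral_marg1 mG G0 ma gibbs_marg1 mr r0).
    have := rB _ measurableT; rewrite probability_setT.
    under eq_integral do rewrite indicT mul1r.
    by move=> <-; rewrite ltry.
  - move=> B mB; rewrite (integral_indicM mu1 (fun x => r x * a x)%R B).
    have m1B : measurable_fun setT (\1_B : X1 -> R) by exact: measurable_indic.
    have m1r : measurable_fun setT (fun x => \1_B x * r x)%R by mfun.
    have br0 x : (0 <= \1_B x * r x)%R by rewrite mulr_ge0.
    transitivity (mu1 B); last by rewrite integral_cst// mul1e.
    rewrite rB//.
    transitivity (\int[mu1]_x (\1_B x * r x * a x)%:E).
      by apply: eq_integral => x _; rewrite mulrA.
    rewrite -(integral_marg1 mG G0 ma gibbs_marg1 m1r br0).
    by apply: eq_integral => x _; congr EFin; rewrite /=; ring.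
have ru : {ae mu1, forall x, (r x * u x = u' x)%R}.
  apply: filterS ra => x; rewrite /a mulrA => e.
  by rewrite -[RHS]mul1r -e divfK// gt_eqF// update_gt0.
rewrite !integral_prod1//; [|by mfun|by move=> z; rewrite mulr_ge0
  |by mfun|by move=> z; rewrite mulr_ge0// mulr_ge0].
apply: ae_eq_integral => //.
- apply: (@measurable_integral1 _ _ _ _ _ mu2 (fun z => w z * (r z.1 * gibbs u v z))%R).
    by mfun.
  by move=> z; rewrite mulr_ge0// mulr_ge0.
- apply: (@measurable_integral1 _ _ _ _ _ mu2 (fun z => w z * gibbs u' v z)%R).
    by mfun.
  by move=> z; rewrite mulr_ge0.
apply: filterS ru => x rux _; apply: eq_integral => y _; congr EFin.
by rewrite /gibbs /= -rux; ring.
Qed.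

End half_step.

(** * Sinkhorn potentials *)

Section sinkhorn_state.
Context {R : realType} {d1 d2 : measure_display}
  {X1 : measurableType d1} {X2 : measurableType d2}.
Variables (mu1 : probability X1 R) (mu2 : probability X2 R).
Variables (phi1 : X1 -> R) (phi2 : X2 -> R) (c : X1 * X2 -> R).
Local Open Scope ereal_scope.

(** Invariant of the iteration: integrable potentials with one-sided growth bounds, as required to
    apply [gibbs_stability]. *)
Definition sinkhorn_state (u : X1 -> R) (v : X2 -> R) :=
  [/\ [/\ measurable_fun setT u, forall x, (0 < u x)%R,
        measurable_fun setT v & forall y, (0 < v y)%R],
      mu1.-integrable setT (EFin \o (fun x => ln (u x))) /\
      mu2.-integrable setT (EFin \o (fun y => ln (v y))),
      (exists2 K : R, (0 <= K)%R & forall x, (ln (u x) <= K * (1 + phi1 x))%R) /\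
      (exists2 K : R, (0 <= K)%R & forall y, (ln (v y) <= K * (1 + phi2 y))%R) &
      \int[mu1 \x mu2]_z (gibbs c u v z)%:E = 1].

End sinkhorn_state.

Lemma gibbs_pswap {R : realType} {d1 d2 : measure_display}
    {X1 : measurableType d1} {X2 : measurableType d2} (c : X1 * X2 -> R)
    (u : X1 -> R) (v : X2 -> R) :
  gibbs (pswap c) v u = pswap (gibbs c u v).
Proof. by apply/funext => z; rewrite /gibbs /pswap /=; congr (_ * _)%R; rewrite mulrC. Qed.

Lemma sinkhorn_state_swap {R : realType} {d1 d2 : measure_display}
    {X1 : measurableType d1} {X2 : measurableType d2}
    (mu1 : probability X1 R) (mu2 : probability X2 R)
    (phi1 : X1 -> R) (phi2 : X2 -> R) (c : X1 * X2 -> R) (u : X1 -> R) (v : X2 -> R) :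
  measurable_fun setT c ->
  sinkhorn_state mu1 mu2 phi1 phi2 c u v ->
  sinkhorn_state mu2 mu1 phi2 phi1 (pswap c) v u.
Proof.
move=> mc [[mu u0 mv v0] [iu iv] [bu bv] H1]; split => //.
rewrite gibbs_pswap integral_pswap//; first exact: measurable_gibbs.
by move=> z; rewrite ltW// gibbs_gt0.
Qed.

Section sinkhorn_step.
Context {R : realType} {d1 d2 : measure_display}
  {X1 : measurableType d1} {X2 : measurableType d2}.
Variables (mu1 : probability X1 R) (mu2 : probability X2 R).
Variables (phi1 : X1 -> R) (phi2 : X2 -> R) (alpha M C : R) (c : X1 * X2 -> R).
Hypotheses (mphi1 : measurable_fun setT phi1) (phi10 : forall x, 0 <= phi1 x)
  (mphi2 : measurable_fun setT phi2) (phi20 : forall x, 0 <= phi2 x)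
  (alpha0 : 0 < alpha)
  (exp1 : (\int[mu1]_x (expR (alpha * phi1 x))%:E <= M%:E)%E)
  (exp2 : (\int[mu2]_x (expR (alpha * phi2 x))%:E <= M%:E)%E)
  (mc : measurable_fun setT c) (c0 : forall z, 0 <= c z) (C0 : 0 <= C)
  (cC : forall z, c z <= C * (1 + phi1 z.1 + phi2 z.2)).
Local Open Scope ereal_scope.
Local Notation state := (sinkhorn_state mu1 mu2 phi1 phi2 c).
Local Notation upd := (sinkhorn_update mu2 c).

Lemma state_update u v : state u v -> state (upd v) v.
Proof.
move=> [[mu u0 mv v0] [iu iv] [bu bv] H1]; split => //.
- by split => //; [exact: measurable_update|move=> x; exact: update_gt0].
- split => //.
  exact: (integrable_ln_update mphi1 phi10 mphi2 phi20 alpha0 exp1 exp2 mc C0 cC mu u0 mv v0 iu iv H1).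
- split => //; exact: (update_upper phi10 mphi2 phi20 alpha0 exp2 mc C0 cC mv v0 iv).
have m1 : measurable_fun [set: X1] (cst 1%R : X1 -> R) by [].
have mup := measurable_update mu2 mc mv v0.
rewrite (integral_total1 (measurable_gibbs mc mv mup) _ m1 (update_marg1 mc mu u0 mv v0 H1)).
  exact: integral_cst_prob.
by move=> z; rewrite ltW// gibbs_gt0// => x; exact: update_gt0.
Qed.

(** Weak duality. The tangent of [klfun] at H = gibbs c u v, evaluated at Hs, reads 1 - H + Hs ln H
    <= klfun Hs; integrating, the exact marginals of Hs turn ln u + ln v into the dual value, and H
    has mass 1. *)
Lemma state_ln_le u v (Hs : X1 * X2 -> R) : state u v ->
  measurable_fun setT Hs -> (forall z, 0 <= Hs z)%R ->
  has_marg1 mu1 mu2 Hs (cst 1%R) -> has_marg2 mu1 mu2 Hs (cst 1%R) ->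
  \int[mu1]_x (ln (u x))%:E + \int[mu2]_y (ln (v y))%:E <= Jent mu1 mu2 c Hs.
Proof.
move=> [[mu u0 mv v0] [iu iv] _ H1] mHs Hs0 Hs1 Hs2.
have mH := measurable_gibbs mc mv mu; have H0 z := gibbs_gt0 c v0 z u0.
set H := gibbs c u v in mH H0 H1.
have m1 : measurable_fun [set: X1] (cst 1%R : X1 -> R) by [].
have m2 : measurable_fun [set: X2] (cst 1%R : X2 -> R) by [].
have split_int d (T : measurableType d) (nu : probability T R) (w : T -> R) :
    measurable_fun setT w -> nu.-integrable setT (EFin \o (fun x => ln (w x))) ->
    exists a b : R, [/\ \int[nu]_x (ln (w x))%:E = (a - b)%:E,
      \int[nu]_x (posp (ln (w x)))%:E = a%:E & \int[nu]_x (posp (- ln (w x)))%:E = b%:E].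
  move=> mw iw.
  have mlw : measurable_fun setT (fun x => ln (w x)) by mfun.
  have bnd (r : R) : (`|posp r| <= `|r|)%R.
    rewrite ger0_norm ?posp_ge0// /posp ge_max normr_ge0 andbT; exact: ler_norm.
  have iabs : nu.-integrable setT (EFin \o (fun x => `|ln (w x)|%R)).
    exact: integrable_abse iw.
  have ip : nu.-integrable setT (EFin \o (fun x => posp (ln (w x)))).
    apply: le_integrableR iabs _; first exact: measurable_posp.
    by move=> x; exact: bnd.
  have iq : nu.-integrable setT (EFin \o (fun x => posp (- ln (w x))%R)).
    apply: le_integrableR iabs _; first by apply: measurable_posp; mfun.
    by move=> x; rewrite (le_trans (bnd _))// normrN.
  have /fineK ea := integrable_fin_num measurableT ip.
  have /fineK eb := integrable_fin_num measurableT iq.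
  eexists; eexists; split; [|exact: esym ea|exact: esym eb].
  rewrite EFinB ea eb.
  transitivity (\int[nu]_x (1 * posp (ln (w x)) + -1 * posp (- ln (w x)))%:E).
    by apply: eq_integral => x _; congr EFin; rewrite {1}[ln (w x)]pospE; ring.
  by rewrite (integral_lincomb 1 (-1) ip iq) mul1e EFinN mulN1e.
have [f1 [f2 [ef ef1 ef2]]] := split_int _ _ _ _ mu iu.
have [g1 [g2 [eg eg1 eg2]]] := split_int _ _ _ _ mv iv.
rewrite ef eg -EFinD.
have mkHs : measurable_fun setT (fun z => klfun (Hs z)).
  exact: measurableT_comp (@measurable_klfun R) mHs.
have kHs0 z : (0 <= klfun (Hs z))%R by exact: klfun_ge0.
have mlu : measurable_fun setT (fun x => ln (u x)) by mfun.
have mlv : measurable_fun setT (fun x => ln (v x)) by mfun.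
have mlu' : measurable_fun setT (fun x => - ln (u x))%R by mfun.
have mlv' : measurable_fun setT (fun x => - ln (v x))%R by mfun.
have I1 (f : X1 -> R) : measurable_fun setT f ->
    \int[mu1 \x mu2]_z (posp (f z.1) * Hs z)%:E = \int[mu1]_x (posp (f x))%:E.
  move=> mf; rewrite (integral_marg1 mHs Hs0 m1 Hs1 (measurable_posp mf)).
    by under eq_integral do rewrite mulr1.
  by move=> x; exact: posp_ge0.
have I2 (f : X2 -> R) : measurable_fun setT f ->
    \int[mu1 \x mu2]_z (posp (f z.2) * Hs z)%:E = \int[mu2]_x (posp (f x))%:E.
  move=> mf; rewrite (integral_marg2 mHs Hs0 m2 Hs2 (measurable_posp mf)).
    by under eq_integral do rewrite mulr1.
  by move=> x; exact: posp_ge0.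
have mp1 (f : X1 -> R) : measurable_fun setT f ->
    measurable_fun setT (fun z : X1 * X2 => posp (f z.1) * Hs z)%R.
  move=> mf; apply: measurable_funM => //.
  exact: measurableT_comp (measurable_posp mf) measurable_fst.
have mp2 (f : X2 -> R) : measurable_fun setT f ->
    measurable_fun setT (fun z : X1 * X2 => posp (f z.2) * Hs z)%R.
  move=> mf; apply: measurable_funM => //.
  exact: measurableT_comp (measurable_posp mf) measurable_snd.
have p0 (r : R) z : (0 <= posp r * Hs z)%R by rewrite mulr_ge0// posp_ge0.
pose P z := (posp (ln (u z.1)) * Hs z + posp (ln (v z.2)) * Hs z + 1)%R.
pose A z := (klfun (Hs z) + c z * Hs z)%R.
have mA : measurable_fun setT A by rewrite /A; mfun.
have A0 z : (0 <= A z)%R by rewrite /A addr_ge0// mulr_ge0.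
have JA : \int[mu1 \x mu2]_z (A z)%:E = Jent mu1 mu2 c Hs by [].
pose N z := (A z + H z +
  (posp (- ln (u z.1)) * Hs z + posp (- ln (v z.2)) * Hs z))%R.
have mpu := mp1 _ mlu; have mpv := mp2 _ mlv.
have mnu := mp1 _ mlu'; have mnv := mp2 _ mlv'.
have H0' z := ltW (H0 z).
have PN : \int[mu1 \x mu2]_z (P z)%:E <= \int[mu1 \x mu2]_z (N z)%:E.
  apply: le_integralR; [by move=> z; rewrite !addr_ge0|by rewrite /P; mfun
    |by rewrite /N; mfun|] => z.
  have tg := klfun_tangent (H0 z) (Hs0 z).
  have lnH : (ln (H z) = ln (u z.1) + ln (v z.2) - c z)%R.
    by rewrite /H /gibbs !lnM ?posrE ?mulr_gt0 ?expR_gt0// expRK.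
  rewrite {1}/klfun lnH in tg; rewrite /P /N /A.
  have := pospE (ln (u z.1)); have := pospE (ln (v z.2)); nra.
have eP : \int[mu1 \x mu2]_z (P z)%:E = f1%:E + g1%:E + 1.
  rewrite /P !integralRD//; try by [mfun|move=> z; rewrite !addr_ge0].
  by rewrite (I1 _ mlu) (I2 _ mlv) ef1 eg1 integral_cst_prob.
have eN : \int[mu1 \x mu2]_z (N z)%:E = Jent mu1 mu2 c Hs + 1 + (f2%:E + g2%:E).
  rewrite (@integralRD _ _ _ _ (fun z => A z + H z)%R)//; try by [mfun|move=> z; rewrite addr_ge0].
  rewrite (@integralRD _ _ _ _ A H)// H1 JA; congr (_ + _).
  rewrite integralRD//.
  by rewrite (I1 _ mlu') (I2 _ mlv') ef2 eg2.
move: PN; rewrite eP eN.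
set j := Jent _ _ _ _.
have : 0 <= j.
  by apply: integralR_ge0 => z; rewrite addr_ge0// mulr_ge0.
case: j => [j _|_ _|//]; last by rewrite leey.
rewrite [leLHS](_ : _ = (f1 + g1 + 1)%:E)// [leRHS](_ : _ = (j + 1 + (f2 + g2))%:E)//.
by rewrite !lee_fin; lra.
Qed.

End sinkhorn_step.

(** * Rates for the Sinkhorn densities *)

Lemma pswapK {R : realType} {d1 d2 : measure_display}
    {X1 : measurableType d1} {X2 : measurableType d2} (c : X1 * X2 -> R) :
  pswap (pswap c) = c.
Proof. by apply/funext => -[]. Qed.

(** About half of the terms up to n have the parity of n and are at least [al n]. Decrease starts at
    index 1 because pi^0 has no exact marginal; the induction carries two consecutive indices. *)
Lemma two_step_decreasing_summable (R : realType) (al : nat -> R) (J : R) :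
  (forall n, 0 <= al n) -> (forall n, (0 < n)%N -> al n.+2 <= al n) ->
  (forall n, \sum_(i < n) al i <= J) -> forall n, n%:R * al n <= 2 * J.
Proof.
move=> al0 al2 alJ n.
suff [h _] : n%:R * al n <= 2 * \sum_(i < n.+1) al i /\
       n.+1%:R * al n.+1 <= 2 * \sum_(i < n.+2) al i.
  by apply: (le_trans h); rewrite ler_pM2l.
have S0 m : 0 <= \sum_(i < m) al i by apply: sumr_ge0.
elim: n => [|n [h1 h2]].
  split; first by rewrite mul0r mulr_ge0.
  rewrite !big_ord_recr /= big_ord0 add0r mul1r.
  have := al0 0%N; have := al0 1%N; lra.
split => //; rewrite big_ord_recr /= mulrDr.
case: n h1 h2 => [|n] h1 h2; first by rewrite lerDr mulr_ge0// sumr_ge0.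
have -> : n.+3%:R = n.+1%:R + 2 :> R by rewrite -[n.+3]addn2 natrD.
rewrite mulrDl lerD2r.
apply: (@le_trans _ _ (n.+1%:R * al n.+1)); first by rewrite ler_wpM2l// al2.
apply: (le_trans h1); rewrite ler_pM2l// [leRHS]big_ord_recr /= lerDl//.
Qed.

Section two_steps.
Context {R : realType} {d1 d2 : measure_display}
  {X1 : measurableType d1} {X2 : measurableType d2}.
Variables (mu1 : probability X1 R) (mu2 : probability X2 R).
Variables (phi1 : X1 -> R) (phi2 : X2 -> R) (c : X1 * X2 -> R).
Hypothesis mc : measurable_fun setT c.
Local Open Scope ereal_scope.
Local Notation state := (sinkhorn_state mu1 mu2 phi1 phi2 c).
Local Notation upd1 := (sinkhorn_update mu2 c).
Local Notation upd2 := (sinkhorn_update mu1 (pswap c)).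

Lemma state_marg2 u v : state u v ->
  has_marg2 mu1 mu2 (gibbs c u v) (fun y => v y / upd2 u y)%R.
Proof.
move=> /(sinkhorn_state_swap mc) [[mv v0 mu u0] _ _ H1].
by have := gibbs_marg1 (measurable_pswap mc) mv v0 mu u0 H1; rewrite gibbs_pswap.
Qed.

(** Dividing [gibbs c u v] by its first marginal is the update of [u], so [marginal_contraction]
    compares the errors of two successive updates. *)
Lemma two_steps u v : state u v -> state (upd1 v) v ->
  has_marg2 mu1 mu2 (gibbs c u v) (cst 1%R) ->
  \int[mu2]_y (klfun (v y / upd2 (upd1 v) y))%:E <=
    \int[mu1]_x (rklfun (u x / upd1 v x))%:E /\
  \int[mu2]_y (rklfun (v y / upd2 (upd1 v) y))%:E <=
    \int[mu1]_x (klfun (u x / upd1 v x))%:E.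
Proof.
move=> [[mu u0 mv v0] _ _ H1] st' H2.
have [[mu' u'0 _ _] _ _ _] := st'.
apply: (@marginal_contraction _ _ _ _ _ mu1 mu2 (gibbs c u v)).
- exact: measurable_gibbs.
- by move=> z; rewrite ltW// gibbs_gt0.
- exact: measurable_ratio.
- by move=> x; exact: divr_gt0.
- exact: (measurable_ratio mu1 (measurable_pswap mc) mv mu').
- by move=> y; rewrite divr_gt0//; exact: (update_gt0 mu1 (measurable_pswap mc) mu').
- exact: gibbs_marg1.
- by [].
rewrite (_ : (fun z => _) = gibbs c (upd1 v) v); first exact: state_marg2.
apply/funext => z; rewrite /gibbs; field.
by rewrite !gt_eqF.
Qed.

End two_steps.

Section sinkhorn_rates.
Context {R : realType} {d1 d2 : measure_display}
  {X1 : measurableType d1} {X2 : measurableType d2}.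
Variables (mu1 : probability X1 R) (mu2 : probability X2 R).
Variables (phi1 : X1 -> R) (phi2 : X2 -> R) (alpha M C : R) (c : X1 * X2 -> R).
Hypotheses (mphi1 : measurable_fun setT phi1) (phi10 : forall x, 0 <= phi1 x)
  (mphi2 : measurable_fun setT phi2) (phi20 : forall x, 0 <= phi2 x)
  (alpha0 : 0 < alpha)
  (exp1 : (\int[mu1]_x (expR (alpha * phi1 x))%:E <= M%:E)%E)
  (exp2 : (\int[mu2]_x (expR (alpha * phi2 x))%:E <= M%:E)%E)
  (mc : measurable_fun setT c) (c0 : forall z, 0 <= c z) (C0 : 0 <= C)
  (cC : forall z, c z <= C * (1 + phi1 z.1 + phi2 z.2)).
Local Open Scope ereal_scope.
Local Notation state := (sinkhorn_state mu1 mu2 phi1 phi2 c).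
Local Notation upd1 := (sinkhorn_update mu2 c).
Local Notation upd2 := (sinkhorn_update mu1 (pswap c)).

Let mct := measurable_pswap mc.
Let cCt z : (pswap c z <= C * (1 + phi2 z.1 + phi1 z.2))%R.
Proof. by rewrite (le_trans (cC _))//= addrAC. Qed.

Let Z : R := fine (\int[mu1 \x mu2]_z (expR (- c z))%:E).

Let intZ : \int[mu1 \x mu2]_z (expR (- c z))%:E = Z%:E.
Proof.
rewrite /Z fineK// ge0_fin_numE; last first.
  by apply: integralR_ge0 => z; exact: expR_ge0.
apply: (@le_lt_trans _ _ (\int[mu1 \x mu2]_z 1%:E)).
  apply: le_integralR; [by move=> z; exact: expR_ge0|by mfun|by []|] => z.
  by rewrite -expR0 ler_expR oppr_le0.
by rewrite integral_cst_prob ltry.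
Qed.

Let Z0 : (0 < Z)%R.
Proof.
have mE : measurable_fun [set: X1 * X2] (fun z => expR (- c z)) by mfun.
rewrite -lte_fin -intZ.
exact: (integral_gt0_prob (mu1 \x mu2) mE (fun z => expR_gt0 _)).
Qed.

(** The parity test is on the previous index: odd iterates arise from even [m] and correct the first
    marginal. The initial 1/Z normalises P_c. *)
Fixpoint sinkhorn_seq (n : nat) : (X1 -> R) * (X2 -> R) :=
  if n is m.+1 then
    let: (u, v) := sinkhorn_seq m in
    if odd m then (u, upd2 u) else (upd1 v, v)
  else (cst (Z^-1)%R, cst 1%R).

Let U n := (sinkhorn_seq n).1.
Let V n := (sinkhorn_seq n).2.

Definition sinkhorn_density n : X1 * X2 -> R := gibbs c (U n) (V n).

Let stepU n : ~~ odd n -> U n.+1 = upd1 (V n) /\ V n.+1 = V n.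
Proof.
by move=> on; rewrite /U /V /=; case: (sinkhorn_seq n) => u v; rewrite (negbTE on).
Qed.

Let stepV n : odd n -> U n.+1 = U n /\ V n.+1 = upd2 (U n).
Proof. by move=> on; rewrite /U /V /=; case: (sinkhorn_seq n) => u v; rewrite on. Qed.

Let st n : state (U n) (V n).
Proof.
elim: n => [|n IH].
  have icst d (T : measurableType d) (nu : probability T R) (r : R) :
      nu.-integrable setT (EFin \o (fun=> r)).
    by apply: integrableR => //=; rewrite integral_cst_prob ltry.
  split; rewrite /U /V /=.
  - by split => // x; rewrite invr_gt0.
  - by split; exact: icst.
  - split; [exists `|ln Z^-1|%R|exists 0%R] => // x.
      by rewrite (le_trans (ler_norm _))// ler_peMr// lerDl.
    by rewrite ln1 mul0r.
  - under eq_integral do rewrite /gibbs /= mulr1.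
    rewrite integralRZ ?invr_ge0 ?(ltW Z0)//; last by mfun.
    by rewrite intZ -EFinM mulVf// gt_eqF.
have [on|on] := boolP (odd n).
  have [-> ->] := stepV on; have sw := sinkhorn_state_swap mc IH.
  have := state_update mphi2 phi20 mphi1 phi10 alpha0 exp2 exp1 mct C0 cCt sw.
  by move=> /(sinkhorn_state_swap mct); rewrite pswapK.
have [-> ->] := stepU on.
exact: (state_update mphi1 phi10 mphi2 phi20 alpha0 exp1 exp2 mc C0 cC IH).
Qed.

(** [D] is the dual value and [al] its increment. [B n] and [A n] are the forward and reverse
    entropies of the marginal corrected at step n + 1; [AE] identifies [A] with [al]. *)
Let D n : R := (fine (\int[mu1]_x (ln (U n x))%:E) + fine (\int[mu2]_y (ln (V n y))%:E))%R.
Let al n : R := (D n.+1 - D n)%R.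
Let B n : \bar R := if odd n then \int[mu2]_y (klfun (V n y / V n.+1 y))%:E
  else \int[mu1]_x (klfun (U n x / U n.+1 x))%:E.
Let A n : \bar R := if odd n then \int[mu2]_y (rklfun (V n y / V n.+1 y))%:E
  else \int[mu1]_x (rklfun (U n x / U n.+1 x))%:E.

Let fU n : \int[mu1]_x (ln (U n x))%:E = (fine (\int[mu1]_x (ln (U n x))%:E))%:E.
Proof.
have [_ [iu _] _ _] := st n.
by have /fineK -> := integrable_fin_num measurableT iu.
Qed.
Let fV n : \int[mu2]_y (ln (V n y))%:E = (fine (\int[mu2]_y (ln (V n y))%:E))%:E.
Proof.
have [_ [_ iv] _ _] := st n.
by have /fineK -> := integrable_fin_num measurableT iv.
Qed.

Let AE n : A n = (al n)%:E.
Proof.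
rewrite /A /al /D; have [[mu u0 mv v0] [iu iv] _ H1] := st n.
have [on|on] := boolP (odd n).
  have [_ _ _ H1'] := sinkhorn_state_swap mc (st n).
  have [eU eV] := stepV on; rewrite eV.
  rewrite (integral_rklfun_ratio mphi2 phi20 mphi1 phi10 alpha0 exp2 exp1 mct C0 cCt
    mv v0 mu u0 iv iu H1') -eV eU.
  by rewrite [X in X - _]fV [X in _ - X]fV -EFinB; congr EFin; ring.
have [eU eV] := stepU on; rewrite eU.
rewrite (integral_rklfun_ratio mphi1 phi10 mphi2 phi20 alpha0 exp1 exp2 mc C0 cC
    mu u0 mv v0 iu iv H1) -eU eV.
by rewrite [X in X - _]fU [X in _ - X]fU -EFinB; congr EFin; ring.
Qed.

Let marg1_odd n : odd n -> has_marg1 mu1 mu2 (sinkhorn_density n) (cst 1%R).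
Proof.
case: n => // n; rewrite oddS => on; rewrite /sinkhorn_density.
have [-> ->] := stepU on; have [[mu u0 mv v0] _ _ H1] := st n.
exact: (update_marg1 mc mu u0 mv v0 H1).
Qed.

Let marg2_even n : ~~ odd n.+1 -> has_marg2 mu1 mu2 (sinkhorn_density n.+1) (cst 1%R).
Proof.
rewrite oddS negbK => on; rewrite /sinkhorn_density.
have [-> ->] := stepV on.
have [[mv v0 mu u0] _ _ H1] := sinkhorn_state_swap mc (st n).
by have := update_marg1 mct mv v0 mu u0 H1; rewrite gibbs_pswap.
Qed.

(** Composing the two halves gives A (n + 2) <= B (n + 1) <= A n. From n = 1 on one marginal is
    exact, as [two_steps] requires. *)
Let contr n : (0 < n)%N -> B n.+1 <= A n /\ A n.+1 <= B n.
Proof.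
move=> n0; rewrite /A /B oddS; have [on|on] /= := boolP (odd n).
  have on' : ~~ odd n.+1 by rewrite oddS on.
  have [eU eV] := stepV on; have [eU' _] := stepU on'.
  have s0 := sinkhorn_state_swap mc (st n).
  have s1 := sinkhorn_state_swap mc (st n.+1).
  rewrite eU eV in s1.
  have := two_steps mct s0 s1; rewrite pswapK gibbs_pswap eU' eU eV; apply.
  exact: marg1_odd on.
have on' : odd n.+1 by rewrite oddS on.
have [eU eV] := stepU on; have [_ eV'] := stepV on'.
have s1 := st n.+1; rewrite eU eV in s1.
have := two_steps mc (st n) s1; rewrite eV' eU eV; apply.
by case: n n0 on {eU eV eV' on' s1} => // n _; exact: marg2_even.
Qed.

(** Induction on n: integrals against pi^n become integrals against mu1 (x) mu2, where
    [update_density] replaces the given factor by the explicit update. *)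
Lemma sinkhorn_iterates_density (pin : nat -> probability (X1 * X2)%type R) n :
  sinkhorn_iterates mu1 mu2 c pin ->
  is_density (pin n) (mu1 \x mu2) (sinkhorn_density n).
Proof.
move=> [pin0 pinO pinE].
have mH m : measurable_fun setT (sinkhorn_density m).
  by have [[mu u0 mv v0] _ _ _] := st m; exact: measurable_gibbs.
have H0 m z : (0 <= sinkhorn_density m z)%R.
  by have [[_ u0 _ v0] _ _ _] := st m; rewrite ltW// gibbs_gt0.
split => //; elim: n => [|n IH] E mE.
  rewrite pin0// intZ; apply: eq_integral => z _.
  rewrite inver gt_eqF// -EFinM; congr EFin.
  by rewrite /sinkhorn_density /gibbs /U /V /=; ring.
have dI (f : X1 * X2 -> R) : measurable_fun setT f -> (forall z, 0 <= f z)%R ->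
    \int[pin n]_z (f z)%:E = \int[mu1 \x mu2]_z (f z * sinkhorn_density n z)%:E.
  exact: (ge0_integral_density (mH n) (H0 n) IH).
have m1E : measurable_fun setT (\1_E : X1 * X2 -> R) by exact: measurable_indic.
have [on|on] := boolP (odd n).
  have [eU eV] := stepV on.
  have [|r [mr r0 rB ->//]] := pinE n.+1 (ltn0Sn n); first by rewrite oddS on.
  have mr2 : measurable_fun setT (fun z : X1 * X2 => r z.2).
    exact: measurableT_comp mr measurable_snd.
  have [[mv v0 mu u0] _ _ H1] := sinkhorn_state_swap mc (st n).
  rewrite /= integral_indicM dI//; [|by mfun|by move=> z; rewrite mulr_ge0].
  rewrite [RHS]integral_indicM.
  have mHn := mH n; have mHn1 := mH n.+1.
  have sw (f : X2 -> R) : measurable_fun setT f -> (forall y, 0 <= f y)%R ->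
      \int[mu2 \x mu1]_z (f z.1 * (r z.1 * gibbs (pswap c) (V n) (U n) z))%:E =
      \int[mu1 \x mu2]_z (f z.2 * (r z.2 * sinkhorn_density n z))%:E.
    move=> mf f0; have mf2 : measurable_fun setT (fun z : X1 * X2 => f z.2).
      exact: measurableT_comp mf measurable_snd.
    rewrite gibbs_pswap.
    apply: (@integral_pswap _ _ _ _ _ mu1 mu2
      (fun z => f z.2 * (r z.2 * sinkhorn_density n z))%R); first by mfun.
    by move=> z; rewrite mulr_ge0// mulr_ge0.
  have cond B' : measurable B' -> mu2 B' =
      \int[mu2 \x mu1]_z (\1_B' z.1 * (r z.1 * gibbs (pswap c) (V n) (U n) z))%:E.
    move=> mB'; have m1B : measurable_fun setT (\1_B' : X2 -> R).
      exact: measurable_indic.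
    rewrite (sw _ m1B)//.
    rewrite rB// integral_indicM.
    have mT : measurable ([set: X1] `*` B') by exact: measurableX.
    have m1T : measurable_fun setT (\1_([set: X1] `*` B') : X1 * X2 -> R).
      exact: measurable_indic.
    rewrite dI//; [|by mfun|by move=> z; rewrite mulr_ge0].
    apply: eq_integral => z _; rewrite -mulrA; congr ((_ * _)%:E)%R.
    rewrite !indicE; congr ((_ : bool)%:R)%R.
    by apply/idP/idP; rewrite !inE /=; [case|].
  have w0 z : (0 <= pswap (\1_E : X1 * X2 -> R) z)%R by rewrite /pswap.
  have := update_density mct mv v0 mu u0 H1 mr r0 cond (measurable_pswap m1E) w0.
  rewrite -eV !gibbs_pswap => e.
  transitivity (\int[mu1 \x mu2]_z (\1_E z * (r z.2 * sinkhorn_density n z))%:E).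
    by apply: eq_integral => z _; congr EFin; rewrite -mulrA.
  rewrite -(integral_pswap mu1 mu2); last 2 first.
  - by mfun.
  - by move=> z; rewrite mulr_ge0// mulr_ge0.
  rewrite -(integral_pswap mu1 mu2 (H := fun z => \1_E z * _)%R); last 2 first.
  - by mfun.
  - by move=> z; rewrite mulr_ge0.
  by rewrite /sinkhorn_density eU; exact: e.
have [eU eV] := stepU on.
have [|r [mr r0 rB ->//]] := pinO n.+1; first by rewrite oddS on.
have mr1 : measurable_fun setT (fun z : X1 * X2 => r z.1).
  exact: measurableT_comp mr measurable_fst.
have [[mu u0 mv v0] _ _ H1] := st n.
have mHn := mH n; have mHn1 := mH n.+1.
rewrite /= integral_indicM dI//; [|by mfun|by move=> z; rewrite mulr_ge0].
rewrite [RHS]integral_indicM.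
have cond B' : measurable B' -> mu1 B' =
    \int[mu1 \x mu2]_z (\1_B' z.1 * (r z.1 * gibbs c (U n) (V n) z))%:E.
  move=> mB'; rewrite rB// integral_indicM.
  have mT : measurable (B' `*` [set: X2]) by exact: measurableX.
  have m1T : measurable_fun setT (\1_(B' `*` [set: X2]) : X1 * X2 -> R).
    exact: measurable_indic.
  rewrite dI//; [|by mfun|by move=> z; rewrite mulr_ge0].
  apply: eq_integral => z _; rewrite -mulrA; congr ((_ * _)%:E)%R.
  rewrite !indicE; congr ((_ : bool)%:R)%R.
  by apply/idP/idP; rewrite !inE /=; [case|].
have w0 z : (0 <= (\1_E : X1 * X2 -> R) z)%R by [].
have := update_density mc mu u0 mv v0 H1 mr r0 cond m1E w0.
rewrite -eU => e; rewrite /sinkhorn_density eV -e.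
by apply: eq_integral => z _; congr EFin; rewrite -mulrA.
Qed.

Variable Hs : X1 * X2 -> R.
Hypotheses (mHs : measurable_fun setT Hs) (Hs0 : forall z, (0 <= Hs z)%R)
  (Hs1 : has_marg1 mu1 mu2 Hs (cst 1%R)) (Hs2 : has_marg2 mu1 mu2 Hs (cst 1%R))
  (opt : forall S : X1 * X2 -> R, measurable_fun setT S -> (forall z, 0 <= S z)%R ->
    has_marg1 mu1 mu2 S (cst 1%R) -> has_marg2 mu1 mu2 S (cst 1%R) ->
    Jent mu1 mu2 c Hs <= Jent mu1 mu2 c S)
  (Jfin : Jent mu1 mu2 c Hs < +oo).

Let J : R := fine (Jent mu1 mu2 c Hs).
Let JE : Jent mu1 mu2 c Hs = J%:E.
Proof.
rewrite /J fineK// ge0_fin_numE//; apply: integralR_ge0 => z.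
by rewrite addr_ge0 ?mulr_ge0// klfun_ge0.
Qed.

Let DJ n : (D n <= J)%R.
Proof.
rewrite -lee_fin -JE /D EFinD -fU -fV.
exact: (state_ln_le mc c0 (st n) mHs Hs0 Hs1 Hs2).
Qed.

Let al0 n : (0 <= al n)%R.
Proof.
rewrite -lee_fin -AE /A.
have [[_ u0 _ v0] _ _ _] := st n; have [[_ u0' _ v0'] _ _ _] := st n.+1.
by case: ifP => _; apply: integralR_ge0 => x; apply: rklfun_ge0; exact: divr_gt0.
Qed.

(** Summability gives A n <= 2 (J - D 0) / n, which bounds B (n + 1); the second factor 2 pays for n
    + 1 <= 2 n. *)
Let KK : R := (4 * (J - D 0))%R.

Let KK0 : (0 <= KK)%R. Proof. by rewrite /KK mulr_ge0// subr_ge0. Qed.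

Let B_le n : (2 <= n)%N -> B n <= (KK / n%:R)%:E.
Proof.
case: n => [//|n] n2.
have n0 : (0 < n)%N by [].
apply: (le_trans (contr n0).1); rewrite AE lee_fin.
have := @two_step_decreasing_summable R al (J - D 0) al0.
move=> /(_ _ _ n) h.
have {}h : (n%:R * al n <= 2 * (J - D 0))%R.
  apply: h => [m m0|m].
    rewrite -lee_fin -!AE; apply: (le_trans (contr (ltn0Sn m)).2).
    exact: (contr m0).1.
  suff -> : (\sum_(i < m) al i = D m - D 0)%R by rewrite lerD2r.
  elim: m => [|m IH]; first by rewrite big_ord0 subrr.
  by rewrite big_ord_recr /= IH /al; ring.
rewrite ler_pdivlMr ?ltr0n// mulrC.
have n1 : (1 <= n%:R :> R)%R by rewrite ler1n.
have := al0 n; rewrite -natr1 /KK; nra.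
Qed.

Lemma sinkhorn_density_rates : exists K : R, forall (n : nat) (e : R), (2 <= n)%N ->
  (0 < e <= 1)%R -> ((e ^+ 2) ^+ 2 = n%:R^-1)%R ->
  [/\ Jent mu1 mu2 c (sinkhorn_density n) <= Jent mu1 mu2 c Hs + (K * e ^+ 2)%:E,
      Jent mu1 mu2 c Hs <= Jent mu1 mu2 c (sinkhorn_density n) + (K * e ^+ 2)%:E &
      \int[mu1 \x mu2]_z (wgt phi1 phi2 z * `|sinkhorn_density n z - Hs z|)%:E <=
        (K * e)%:E].
Proof.
pose K1 := (KK + C * shconst alpha M KK)%R.
pose K2 := (C * shconst alpha M KK)%R.
pose K3 := corconst alpha M C KK.
pose K := Num.max K1 (Num.max K2 K3); exists K => n e n2 e01 en.
have [l1 l2 l3] : [/\ (K1 <= K)%R, (K2 <= K)%R & (K3 <= K)%R].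
  by rewrite /K !le_max !lexx /= !orbT.
have /andP[e0 e1] := e01.
have up (k t : R) (x y : \bar R) : (k <= K)%R -> (0 <= t)%R ->
    x <= y + (k * t)%:E -> x <= y + (K * t)%:E.
  by move=> kK t0 /le_trans; apply; rewrite leeD2l// lee_fin ler_wpM2r.
suff [h1 h2 h3] : [/\
   Jent mu1 mu2 c (sinkhorn_density n) <= Jent mu1 mu2 c Hs + (K1 * e ^+ 2)%:E,
   Jent mu1 mu2 c Hs <= Jent mu1 mu2 c (sinkhorn_density n) + (K2 * e ^+ 2)%:E &
   \int[mu1 \x mu2]_z (wgt phi1 phi2 z * `|sinkhorn_density n z - Hs z|)%:E <=
     (K3 * e)%:E].
  split; [exact: (up _ _ _ _ l1 (sqr_ge0 e) h1)|exact: (up _ _ _ _ l2 (sqr_ge0 e) h2)|].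
  by apply: (le_trans h3); rewrite lee_fin ler_wpM2r// ltW.
have hB := B_le n2; rewrite -en in hB.
have [[mu u0 mv v0] [iu iv] [[Ku Ku0 bu] [Kv Kv0 bv]] H1] := st n.
have mH : measurable_fun setT (sinkhorn_density n) by exact: measurable_gibbs.
have H0 z : (0 <= sinkhorn_density n z)%R by rewrite ltW// gibbs_gt0.
have [on|on] := boolP (odd n).
  have [eU eV] := stepV on; rewrite /B on eV in hB.
  have ml := measurable_ratio mu1 mct mv mu u0.
  have l0 := ratio_gt0 mu1 mct v0 mu u0.
  exact: (gibbs_stability mphi1 phi10 mphi2 phi20 alpha0 exp1 exp2 mc c0 C0 cC
    mHs Hs0 Hs1 Hs2 opt Jfin mu u0 mv v0 ml l0 (marg1_odd on) (state_marg2 mc (st n)) iu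
    Kv0 bv e01 KK0 hB).
(* For even n the exact marginal is the second one, so stability is applied after exchanging the
   factors. *)
have [eU eV] := stepU on; rewrite /B (negbTE on) eU in hB.
have ml := measurable_ratio mu2 mc mu mv v0.
have l0 := ratio_gt0 mu2 mc u0 mv v0.
have Jsw (F : X1 * X2 -> R) : measurable_fun setT F -> (forall z, 0 <= F z)%R ->
    Jent mu2 mu1 (pswap c) (pswap F) = Jent mu1 mu2 c F.
  move=> mF F0; rewrite /Jent.
  apply: (@integral_pswap _ _ _ _ _ mu1 mu2 (fun z => klfun (F z) + c z * F z)%R).
    by have := measurableT_comp (@measurable_klfun R) mF => mkF; mfun.
  by move=> z; rewrite addr_ge0 ?klfun_ge0// mulr_ge0.
have m1 : has_marg1 mu2 mu1 (gibbs (pswap c) (V n) (U n)) (cst 1%R).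
  rewrite gibbs_pswap; case: n n2 on {en H1 mu u0 mv v0 iu iv bu bv mH H0 eU eV hB ml l0} => // n _.
  exact: marg2_even.
have m2 : has_marg2 mu2 mu1 (gibbs (pswap c) (V n) (U n)) (fun x => U n x / upd1 (V n) x)%R.
  by rewrite gibbs_pswap; exact: gibbs_marg1.
have mHst := measurable_pswap mHs.
have opt' (S : X2 * X1 -> R) : measurable_fun setT S -> (forall z, 0 <= S z)%R ->
    has_marg1 mu2 mu1 S (cst 1%R) -> has_marg2 mu2 mu1 S (cst 1%R) ->
    Jent mu2 mu1 (pswap c) (pswap Hs) <= Jent mu2 mu1 (pswap c) S.
  move=> mS S0 S1 S2; have mS' := measurable_pswap mS.
  have S0' z : (0 <= pswap S z)%R by exact: S0.
  by rewrite -[S]pswapK (Jsw _ mS' S0') (Jsw _ mHs Hs0); exact: opt.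
have Jfin' : Jent mu2 mu1 (pswap c) (pswap Hs) < +oo by rewrite Jsw.
have [] := gibbs_stability mphi2 phi20 mphi1 phi10 alpha0 exp2 exp1 mct
    (fun z => c0 (z.2, z.1)) C0 cCt
    mHst (fun z => Hs0 (z.2, z.1)) Hs2 Hs1 opt' Jfin' mv v0 mu u0 ml l0 m1 m2 iv
    Ku0 bu e01 KK0 hB.
rewrite -/(gibbs (pswap c) (V n) (U n)) gibbs_pswap !Jsw// => h1 h2 h3; split => //.
apply: le_trans h3; rewrite -(integral_pswap mu1 mu2); last 2 first.
- have := measurable_wgt mphi1 mphi2 => mw; by mfun.
- by move=> z; rewrite mulr_ge0// wgt_ge0.
rewrite le_eqVlt; apply/orP; left; apply/eqP; apply: eq_integral => z _; congr EFin.
rewrite -[(_ * _ * expR _)%R]/(gibbs (pswap c) (V n) (U n) z) gibbs_pswap.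
by rewrite /wgt /pswap /= addrAC.
Qed.

End sinkhorn_rates.

(** * Couplings and metric measurability *)

Section tv_coupling.
Context d (T : measurableType d) (R : realType) (M P P' : probability T R).
Variables (H H' : T -> R) (kappa : T * T -> R) (w : T -> R).
Hypotheses (dH : is_density P M H) (dH' : is_density P' M H')
  (mk : measurable_fun setT kappa) (k0 : forall z, 0 <= kappa z)
  (kxx : forall x, kappa (x, x) = 0)
  (mw : measurable_fun setT w) (w0 : forall x, 0 <= w x)
  (kw : forall z, kappa z <= w z.1 + w z.2).
Local Open Scope ereal_scope.

Let mH : measurable_fun setT H. Proof. by case: dH. Qed.
Let mH' : measurable_fun setT H'. Proof. by case: dH'. Qed.
Let H0 x : (0 <= H x)%R. Proof. by case: dH. Qed.
Let H'0 x : (0 <= H' x)%R. Proof. by case: dH'. Qed.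
Let PE A : measurable A -> P A = \int[M]_(x in A) (H x)%:E. Proof. by case: dH => _ _; exact. Qed.
Let PE' A : measurable A -> P' A = \int[M]_(x in A) (H' x)%:E.
Proof. by case: dH' => _ _; exact. Qed.

Let m x : R := Num.min (H x) (H' x).
Let D x : R := (H x - m x)%R.
Let E x : R := (H' x - m x)%R.
Let mm : measurable_fun setT m. Proof. by rewrite /m; mfun. Qed.
Let m0 x : (0 <= m x)%R. Proof. by rewrite /m le_min H0 H'0. Qed.
Let mD : measurable_fun setT D. Proof. by rewrite /D; mfun. Qed.
Let mE : measurable_fun setT E. Proof. by rewrite /E; mfun. Qed.
Let D0 x : (0 <= D x)%R. Proof. by rewrite /D subr_ge0 /m ge_min lexx. Qed.
Let E0 x : (0 <= E x)%R. Proof. by rewrite /E subr_ge0 /m ge_min lexx orbT. Qed.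

Let tau : R := fine (\int[M]_x (D x)%:E).

Let int1 : \int[M]_x (H x)%:E = 1. Proof. by rewrite -PE// probability_setT. Qed.
Let int1' : \int[M]_x (H' x)%:E = 1. Proof. by rewrite -PE'// probability_setT. Qed.

Let le1 (f : T -> R) : measurable_fun setT f -> (forall x, 0 <= f x)%R ->
  (forall x, f x <= H x)%R -> \int[M]_x (f x)%:E < +oo.
Proof.
move=> mf f0 fH; apply: (@le_lt_trans _ _ (\int[M]_x (H x)%:E)); last by rewrite int1 ltry.
exact: le_integralR.
Qed.

Let int_D : \int[M]_x (D x)%:E = tau%:E.
Proof.
rewrite /tau fineK// ge0_fin_numE ?integralR_ge0//; apply: le1 => // x.
by rewrite /D lerBlDr lerDl.
Qed.

Let intmoo : \int[M]_x (m x)%:E < +oo.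
Proof. by apply: le1 => // x; rewrite /m ge_min lexx. Qed.

Let int_E : \int[M]_x (E x)%:E = tau%:E.
Proof.
have e1 : \int[M]_x (m x)%:E + \int[M]_x (D x)%:E = 1.
  by rewrite -integralRD// -int1; apply: eq_integral => x _; rewrite /D addrC subrK.
have e2 : \int[M]_x (m x)%:E + \int[M]_x (E x)%:E = 1.
  by rewrite -integralRD// -int1'; apply: eq_integral => x _; rewrite /E addrC subrK.
have mfin : \int[M]_x (m x)%:E \is a fin_num.
  by rewrite ge0_fin_numE// integralR_ge0.
have e : \int[M]_x (E x)%:E + \int[M]_x (m x)%:E = \int[M]_x (D x)%:E + \int[M]_x (m x)%:E.
  by rewrite addeC e2 addeC e1.
by have := congr1 (fun z => z - \int[M]_x (m x)%:E) e; rewrite !addeK// int_D.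
Qed.

Let tau0 : (0 <= tau)%R. Proof. by rewrite -lee_fin -int_D integralR_ge0. Qed.

Let G z : R := (D z.1 * E z.2 / tau)%R.

Let mG : measurable_fun [set: T * T] G.
Proof.
apply: measurable_funM => //; apply: measurable_funM.
  exact: measurableT_comp mD measurable_fst.
exact: measurableT_comp mE measurable_snd.
Qed.

Let G0 z : (0 <= G z)%R. Proof. by rewrite /G divr_ge0// mulr_ge0. Qed.

(** Cancelling [tau] is legitimate even when it is 0, as f then vanishes almost everywhere. *)
Let marg_aux (f : T -> R) : measurable_fun setT f -> (forall x, 0 <= f x)%R ->
  \int[M]_x (f x)%:E = tau%:E -> {ae M, forall x, (f x / tau * tau = f x)%R}.
Proof.
move=> mf f0 ft; have [t0|t0] := eqVneq tau 0%R; last first.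
  by apply: aeW => x; rewrite divfK.
have : ae_eq M setT (EFin \o f) (cst 0).
  apply/ae_eq_integral_abs => //; first exact/measurable_EFinP.
  by under eq_integral do rewrite /= ger0_norm//; rewrite ft t0.
by apply: filterS => x /(_ I) [->]; rewrite !mul0r.
Qed.

Let tV0 : (0 <= tau^-1)%R. Proof. by rewrite invr_ge0. Qed.

Let margG1 : has_marg1 M M G D.
Proof.
apply: filterS (marg_aux mD D0 int_D) => x Dx.
transitivity (\int[M]_y ((D x / tau) * E y)%:E).
  by apply: eq_integral => y _; rewrite /G /= mulrAC.
by rewrite integralRZ// ?int_E -?EFinM ?Dx// mulr_ge0.
Qed.

Let margG2 : has_marg2 M M G E.
Proof.
apply: filterS (marg_aux mE E0 int_E) => y Ey.
transitivity (\int[M]_x ((E y / tau) * D x)%:E).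
  by apply: eq_integral => x _; rewrite /G /= [(D x * _)%R]mulrC mulrAC.
by rewrite integralRZ// ?int_D -?EFinM ?Ey// mulr_ge0.
Qed.

Let Goo : \int[M \x M]_z (G z)%:E < +oo.
Proof. by rewrite (integral_total1 mG G0 mD margG1) int_D ltry. Qed.

Let mdiag : measurable_fun setT (fun x : T => (x, x)).
Proof. exact: measurable_fun_pair. Qed.

(* The common part [min(H, H')] is put on the diagonal and the two excesses are
   coupled independently. *)
Lemma tv_coupling : exists2 gam : probability (T * T)%type R,
  is_coupling P P' gam &
  \int[gam]_z (kappa z)%:E <= \int[M]_x (w x * `|H x - H' x|)%:E.
Proof.
have [n1 n1E] := finite_measure_of_density mm m0 intmoo.
have [n2 n2E] := finite_measure_of_density mG G0 Goo.
pose g0 : {measure set (T * T)%type -> \bar R} := pushforward n1 (fun x : T => (x, x)).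
pose g1 := g0 mdiag.
pose g : {measure set (T * T)%type -> \bar R} := measure_add g1 n2.
have gE A : measurable A -> g A = n1 [set x | A (x, x)] + n2 A.
  by move=> mA; exact: (measure_addE g1 n2 A).
have m1A A : measurable A -> measurable_fun setT (\1_A : T -> R).
  by move=> mA; exact: measurable_indic.
have sumA A (f h q : T -> R) : measurable A -> measurable_fun setT f ->
    (forall x, 0 <= f x)%R -> measurable_fun setT h -> (forall x, 0 <= h x)%R ->
    (forall x, f x + h x = q x)%R ->
    \int[M]_(x in A) (f x)%:E + \int[M]_(x in A) (h x)%:E = \int[M]_(x in A) (q x)%:E.
  move=> mA mf f0 mh h0 fhq.
  rewrite (integral_indicM M f) (integral_indicM M h) (integral_indicM M q).
  have mA1 := m1A A mA.
  rewrite -integralRD//; [|by move=> x; rewrite mulr_ge0|by mfun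
    |by move=> x; rewrite mulr_ge0|by mfun].
  by apply: eq_integral => x _; rewrite -mulrDr fhq.
have gP A : measurable A -> g (A `*` setT) = P A.
  move=> mA; have mAT : measurable (A `*` [set: T]) by exact: measurableX.
  rewrite gE// PE//.
  have -> : [set x | (A `*` setT) (x, x)] = A by apply/seteqP; split => [x []|x].
  rewrite n1E// n2E// (sets_of_has_marg1 mG G0 mD margG1 mA).
  by apply: sumA => // x; rewrite /D addrC subrK.
have gP' A : measurable A -> g (setT `*` A) = P' A.
  move=> mA; have mAT : measurable ([set: T] `*` A) by exact: measurableX.
  rewrite gE// PE'//.
  have -> : [set x | (setT `*` A) (x, x)] = A by apply/seteqP; split => [x []|x].
  rewrite n1E// n2E//.
  have -> : \int[M \x M]_(x in [set: T] `*` A) (G x)%:E = \int[M]_(x in A) (E x)%:E.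
    rewrite (integral_indicM M E) -(integral_marg2 mG G0 mE margG2 (m1A A mA))//.
    rewrite integral_indicM; apply: eq_integral => z _; congr ((_ * _)%:E)%R.
    rewrite !indicE; congr ((_ : bool)%:R)%R.
    by apply/idP/idP; rewrite !inE /=; [case|].
  by apply: sumA => // x; rewrite /E addrC subrK.
have gT : g setT = 1 by rewrite -setXTT gP// probability_setT.
pose q := Measure_isProbability.Build _ _ _ g gT.
pose gam : probability (T * T)%type R := HB.pack (g : set (T * T) -> \bar R) g q.
exists gam; first by split => A mA; [exact: gP|exact: gP'].
have -> : \int[gam]_z (kappa z)%:E = \int[g]_z (kappa z)%:E by [].
rewrite /g ge0_integral_measure_add//; [|by move=> z _; rewrite lee_fin
  |exact/measurable_EFinP].
rewrite /g1 ge0_integral_pushforward//; [|exact/measurable_EFinP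
  |by move=> z _; rewrite lee_fin].
(* The diagonal part costs nothing. *)
rewrite preimage_setT integral0_eq ?add0e; last by move=> x _ /=; rewrite kxx.
rewrite (@ge0_integral_density _ _ _ n2 (M \x M) G)//.
have mw1 : measurable_fun setT (fun z : T * T => w z.1).
  exact: measurableT_comp mw measurable_fst.
have mw2 : measurable_fun setT (fun z : T * T => w z.2).
  exact: measurableT_comp mw measurable_snd.
apply: (@le_trans _ _ (\int[M \x M]_z (w z.1 * G z + w z.2 * G z)%:E)).
  apply: le_integralR; [by move=> z; rewrite mulr_ge0|by mfun|by mfun|] => z.
  by rewrite -mulrDl ler_wpM2r.
rewrite integralRD//; [|by move=> z; rewrite mulr_ge0|by mfun
  |by move=> z; rewrite mulr_ge0|by mfun].
rewrite (integral_marg1 mG G0 mD margG1 mw w0) (integral_marg2 mG G0 mE margG2 mw w0).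
rewrite -integralRD//; [|by move=> z; rewrite mulr_ge0|by mfun
  |by move=> z; rewrite mulr_ge0|by mfun].
rewrite le_eqVlt; apply/orP; left; apply/eqP; apply: eq_integral => x _.
(* The two excesses add up to |H - H'|. *)
rewrite -mulrDr; congr ((_ * _)%:E)%R; rewrite /D /E /m.
have [h|h] := leP (H x) (H' x).
  by rewrite ler0_norm ?subr_le0//; ring.
by rewrite gtr0_norm ?subr_gt0//; ring.
Qed.

End tv_coupling.

Section metric_measurability.
Context {R : realType} {dT : measure_display} (T : measurableType dT).
Variables (dist : T -> T -> R) (x0 : T).
Hypothesis polish : polish_borel dist.

Let metr : is_metric dist. Proof. by case: polish. Qed.

Lemma dist_ge0 x y : 0 <= dist x y. Proof. by case: metr. Qed.
Lemma dist_xx x : dist x x = 0. Proof. by case: metr => _ h _ _; apply/h. Qed.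
Lemma dist_sym x y : dist x y = dist y x. Proof. by case: metr. Qed.
Lemma dist_triangle x y z : dist x z <= dist x y + dist y z.
Proof. by case: metr. Qed.

Lemma measurable_ball_dist x r : measurable [set y | dist x y < r].
Proof.
case: polish => _ _ _ ->; apply: sub_sigma_algebra => y /= xy.
exists (r - dist x y); first by rewrite subr_gt0.
move=> z /= yz; have := dist_triangle x y z; lra.
Qed.

Lemma measurable_fun_lt_sets d (S : measurableType d) (f : S -> R) :
  (forall r, measurable [set x | f x < r]) -> measurable_fun setT f.
Proof.
move=> mf mD; apply: (measurability _ (RGenInftyO.measurableE R)) => //.
move=> /= _ [_ [r ->] <-]; rewrite setTI preimage_itvNyo; exact: mf.
Qed.

Lemma measurable_dist x : measurable_fun setT (dist x).
Proof. by apply: measurable_fun_lt_sets => r; exact: measurable_ball_dist. Qed.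

Lemma dense_sequence : exists s : nat -> T,
  forall x e, 0 < e -> exists n, dist x (s n) < e.
Proof.
case: polish => _ [D [/countable_injP[i iD] dD]] _ _.
have [s sP] : exists s : nat -> T, forall x, D x -> s (i x) = x.
  pose Q n x := D x /\ i x = n.
  (* [x0] fills the indices that enumerate no point of [D]. *)
  exists (fun n => if pselect (exists x, Q n x) is left ex then projT1 (cid ex) else x0).
  move=> x Dx; case: pselect => [ex|]; last by case; exists x.
  by case: (cid ex) => y /= [Dy iy]; apply: iD; rewrite ?inE.
exists s => x e /(dD x)[y Dy xy]; by exists (i y); rewrite sP.
Qed.

(** Joint measurability for the product sigma-algebra comes from separability: dist z.1 z.2 < r
    exactly when some point of a dense sequence has distances to z.1 and z.2 summing to less than
    r. *)
Lemma measurable_dist2 : measurable_fun setT (fun z : T * T => dist z.1 z.2).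
Proof.
have [s sP] := dense_sequence.
apply: measurable_fun_lt_sets => r.
rewrite (_ : [set _ | _] =
  \bigcup_n [set z : T * T | dist (s n) z.1 + dist (s n) z.2 < r]).
  apply: bigcup_measurable => n _.
  have m1 : measurable_fun setT (fun z : T * T => dist (s n) z.1).
    exact: measurableT_comp (measurable_dist (s n)) measurable_fst.
  have m2 : measurable_fun setT (fun z : T * T => dist (s n) z.2).
    exact: measurableT_comp (measurable_dist (s n)) measurable_snd.
  rewrite -[X in measurable X]setTI -preimage_itvNyo.
  exact: (measurable_funD m1 m2).
apply/seteqP; split => [z /= zr|z [n _] /= zr]; last first.
  have := dist_triangle z.1 (s n) z.2; rewrite (dist_sym z.1 (s n)); lra.
have e0 : 0 < (r - dist z.1 z.2) / 2 by lra.
have [n sn] := sP z.1 _ e0; exists n => //=; rewrite dist_sym in sn.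
have := dist_triangle (s n) z.1 z.2; lra.
Qed.

End metric_measurability.

Section product_metric.
Context {R : realType} {d1 d2 : measure_display}
  {X1 : measurableType d1} {X2 : measurableType d2}.
Variables (dist1 : X1 -> X1 -> R) (dist2 : X2 -> X2 -> R) (xh : X1 * X2).
Hypotheses (P1 : polish_borel dist1) (P2 : polish_borel dist2).

Lemma dXr_powR r x y : 0 < r ->
  dXr dist1 dist2 r x y `^ r = dist1 x.1 y.1 `^ r + dist2 x.2 y.2 `^ r.
Proof.
move=> r0; rewrite /dXr -powRrM mulVf ?gt_eqF// powRr1//.
by rewrite addr_ge0// powR_ge0.
Qed.

Lemma dXr_le r x y t : 1 <= r -> dist1 x.1 y.1 <= t -> dist2 x.2 y.2 <= t ->
  dXr dist1 dist2 r x y <= 2 * t.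
Proof.
move=> r1 h1 h2; have r0 : 0 < r by lra.
have t0 : 0 <= t by apply: le_trans h1; exact: dist_ge0.
have r0' := ltW r0.
have -> : 2 * t = ((2 * t) `^ r) `^ r^-1.
  by rewrite -powRrM divff ?gt_eqF// powRr1// mulr_ge0.
apply: ge0_ler_powR; rewrite ?invr_ge0 ?nnegrE ?addr_ge0 ?powR_ge0//.
apply: (@le_trans _ _ (t `^ r + t `^ r)).
  by apply: lerD; apply: ge0_ler_powR; rewrite ?nnegrE ?dist_ge0.
have := le1r_powRZ (_ : 1 <= 2) t0 r1; rewrite ler1n => /(_ isT).
by rewrite mulr2n mulrDl mul1r.
Qed.

(** Each sublevel set is a countable union of products of balls of radius 1/(k + 1) centred on dense
    sequences. *)
Lemma measurable_dX_continuous r (h : X1 * X2 -> R) : 1 <= r ->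
  dX_continuous dist1 dist2 r h -> measurable_fun setT h.
Proof.
move=> r1 ch; apply: measurable_fun_lt_sets => a.
have [s1 sP1] := dense_sequence xh.1 P1; have [s2 sP2] := dense_sequence xh.2 P2.
pose rect (i j k : nat) : set (X1 * X2) :=
  [set x | dist1 (s1 i) x < k.+1%:R^-1] `*` [set x | dist2 (s2 j) x < k.+1%:R^-1].
rewrite (_ : [set _ | _] = \bigcup_i \bigcup_j
    \bigcup_(k in [set k | rect i j k `<=` [set x | h x < a]]) rect i j k).
  apply: bigcup_measurable => i _; apply: bigcup_measurable => j _.
  apply: bigcup_measurable => k _.
  by apply: measurableX; exact: measurable_ball_dist.
apply/seteqP; split => [x /= hx|x [i _ [j _ [k /= + xk]]]]; last by exact.
have [del del0 hdel] := ch x (a - h x) ltac:(by rewrite subr_gt0).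
(* Two points of such a rectangle differ by at most 2/(k + 1) in each coordinate, hence by at most
   4/(k + 1) for [dXr]. *)
have [k kdel] : exists k : nat, k.+1%:R^-1 < del / 4.
  have d4 : 0 < del / 4 by lra.
  exists (Num.truncn (del / 4)^-1); rewrite invf_plt ?posrE//.
  exact: truncnS_gt.
have k0 : 0 < k.+1%:R^-1 :> R by rewrite invr_gt0.
have [i xi] := sP1 x.1 _ k0; have [j xj] := sP2 x.2 _ k0.
rewrite (dist_sym P1) in xi; rewrite (dist_sym P2) in xj.
exists i => //; exists j => //; exists k => //= y [/= yi yj].
have h2 : dist2 x.2 y.2 <= 2 * k.+1%:R^-1.
  rewrite (le_trans (dist_triangle P2 _ (s2 j) _))// mulr_natl mulr2n.
  by rewrite lerD// ltW// (dist_sym P2).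
have h1 : dist1 x.1 y.1 <= 2 * k.+1%:R^-1.
  rewrite (le_trans (dist_triangle P1 _ (s1 i) _))// mulr_natl mulr2n.
  by rewrite lerD// ltW// (dist_sym P1).
have le4 := dXr_le r1 h1 h2; move: kdel le4; set t := k.+1%:R^-1 => kdel le4.
have : dXr dist1 dist2 r x y < del by lra.
move/hdel; rewrite ltr_norml => /andP[]; lra.
Qed.

End product_metric.

(** * Convergence of the Sinkhorn iterates *)

Section rates_of_convergence.
Context {R : realType}.
Implicit Types (a K e : R) (f : nat -> \bar R).

Lemma powR_nat_small a e : 0 < a -> 0 < e ->
  exists N : nat, forall n, (N <= n)%N -> n%:R `^ (- a) <= e.
Proof.
move=> a0 e0; pose t := e `^ (- a^-1).
have t0 : 0 < t by rewrite powR_gt0.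
exists (Num.truncn t).+1 => n tn.
have tn' : t <= n%:R.
  by rewrite (le_trans (ltW (truncnS_gt t)))// ler_nat.
have <- : t `^ (- a) = e.
  by rewrite /t -powRrM mulrNN mulVf ?gt_eqF// powRr1// ltW.
rewrite !powRN lef_pV2 ?posrE ?powR_gt0//; last exact: lt_le_trans t0 tn'.
by apply: ge0_ler_powR; rewrite ?nnegrE ?(ltW a0) ?(ltW t0)//.
Qed.

Lemma cvge_powR_bound f (l K a : R) : 0 < a ->
  (forall n, (2 <= n)%N -> (`|l%:E - f n| <= (K * n%:R `^ (- a))%:E)%E) ->
  f n @[n --> \oo] --> l%:E.
Proof.
move=> a0 fb; apply/fine_cvgP.
have ffin n : (2 <= n)%N -> f n \is a fin_num.
  by move=> /fb; case: (f n).
split; first by exists 2%N => // n /=; exact: ffin.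
apply/cvgrPdist_le => e e0.
have K0 : 0 < `|K| + 1 by rewrite ltr_wpDl.
have [N NP] := powR_nat_small a0 (divr_gt0 e0 K0).
exists (maxn 2 N) => // n /=; rewrite geq_max => /andP[n2 nN].
have := fb n n2; rewrite -(fineK (ffin n n2)) -EFinB abse_EFin lee_fin /=.
move=> /le_trans; apply.
apply: (@le_trans _ _ ((`|K| + 1) * (e / (`|K| + 1)))); last first.
  by rewrite mulrCA divff ?gt_eqF// mulr1.
apply: (@le_trans _ _ ((`|K| + 1) * n%:R `^ (- a))).
  by rewrite ler_wpM2r ?powR_ge0// (le_trans (ler_norm K))// lerDl.
by rewrite ler_wpM2l ?(ltW K0)// NP.
Qed.

Lemma powR_quasi_triangle (q s t : R) : 0 <= q -> 0 <= s -> 0 <= t ->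
  (s + t) `^ q <= 2 `^ q * (s `^ q + t `^ q).
Proof.
move=> q0 s0 t0; have h (x y : R) : 0 <= x -> x <= y ->
    (x + y) `^ q <= 2 `^ q * (x `^ q + y `^ q).
  move=> x0 xy; have y0 := le_trans x0 xy.
  apply: (@le_trans _ _ ((2 * y) `^ q)).
    by apply: ge0_ler_powR; rewrite ?nnegrE ?addr_ge0 ?mulr_ge0//; lra.
  by rewrite powRM// ler_wpM2l ?powR_ge0// lerDr powR_ge0.
have [st|/ltW ts] := leP s t; first exact: h.
by rewrite addrC [s `^ q + _]addrC; exact: h.
Qed.

Lemma powR_le_1D (q p s : R) : 0 <= q <= p -> 0 <= s -> s `^ q <= 1 + s `^ p.
Proof.
move=> /andP[q0 qp] s0; have [s1|/ltW s1] := leP s 1.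
  have : s `^ q <= 1 `^ q by apply: ge0_ler_powR; rewrite ?nnegrE.
  by rewrite powR1; have := powR_ge0 s p; lra.
by have := ler_powR s1 qp; lra.
Qed.

End rates_of_convergence.

Section convergence.
Context {R : realType} {d1 d2 : measure_display}
  {X1 : measurableType d1} {X2 : measurableType d2}.
Variables (dist1 : X1 -> X1 -> R) (dist2 : X2 -> X2 -> R) (p : R)
  (mu1 : probability X1 R) (mu2 : probability X2 R) (alpha : R)
  (xh1 : X1) (xh2 : X2) (c : X1 * X2 -> R)
  (pistar : probability (X1 * X2)%type R)
  (pin : nat -> probability (X1 * X2)%type R) (C : R).
Hypotheses (P1 : polish_borel dist1) (P2 : polish_borel dist2)
  (alpha0 : 0 < alpha)
  (exp1 : (\int[mu1]_x1 (expR (alpha * dist1 xh1 x1 `^ p))%:E < +oo)%E)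
  (exp2 : (\int[mu2]_x2 (expR (alpha * dist2 xh2 x2 `^ p))%:E < +oo)%E)
  (coup : is_coupling mu1 mu2 pistar)
  (popt : Fent mu1 mu2 c pistar = Sent mu1 mu2 c)
  (iter : sinkhorn_iterates mu1 mu2 c pin)
  (mc : measurable_fun setT c) (c0 : forall z, 0 <= c z) (C0 : 0 <= C)
  (cC : forall z, c z <= C * (1 + dist1 xh1 z.1 `^ p + dist2 xh2 z.2 `^ p)).
Local Open Scope ereal_scope.

Let phi1 x := (dist1 xh1 x `^ p)%R.
Let phi2 x := (dist2 xh2 x `^ p)%R.
Let mphi1 : measurable_fun setT phi1.
Proof. by have := measurable_dist P1 xh1 => md; rewrite /phi1; mfun. Qed.
Let mphi2 : measurable_fun setT phi2.
Proof. by have := measurable_dist P2 xh2 => md; rewrite /phi2; mfun. Qed.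
Let phi10 x : (0 <= phi1 x)%R. Proof. exact: powR_ge0. Qed.
Let phi20 x : (0 <= phi2 x)%R. Proof. exact: powR_ge0. Qed.

Let I1 := \int[mu1]_x (expR (alpha * phi1 x))%:E.
Let I2 := \int[mu2]_x (expR (alpha * phi2 x))%:E.
Let M : R := Num.max (fine I1) (fine I2).
Let e1 : I1 <= M%:E.
Proof.
rewrite -(@fineK _ I1) ?lee_fin ?le_max ?lexx// ge0_fin_numE//.
by apply: integralR_ge0 => x; exact: expR_ge0.
Qed.
Let e2 : I2 <= M%:E.
Proof.
rewrite -(@fineK _ I2) ?lee_fin ?le_max ?lexx ?orbT// ge0_fin_numE//.
by apply: integralR_ge0 => x; exact: expR_ge0.
Qed.

Let Fent_density (P : probability (X1 * X2)%type R) H :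
  is_density P (mu1 \x mu2) H -> Fent mu1 mu2 c P = Jent mu1 mu2 c H.
Proof.
move=> dH; have [mH H0 PH] := dH.
rewrite /Fent (KL_density dH) (ge0_integral_density mH H0 PH mc c0).
by rewrite (JentE mu1 mu2 mc c0 mH H0) addeC.
Qed.

Let Sent_le (S : X1 * X2 -> R) : measurable_fun setT S -> (forall z, 0 <= S z)%R ->
  has_marg1 mu1 mu2 S (cst 1%R) -> has_marg2 mu1 mu2 S (cst 1%R) ->
  Sent mu1 mu2 c <= Jent mu1 mu2 c S.
Proof.
move=> mS S0 S1 S2.
have m1 : measurable_fun [set: X1] (cst 1%R : X1 -> R) by [].
have [|P PS] := probability_of_density mS S0 (M := (mu1 \x mu2)).
  by rewrite (integral_total1 mS S0 m1 S1) integral_cst_prob.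
apply: ge_ereal_inf; exists (Fent mu1 mu2 c P); last first.
  by rewrite (@Fent_density P S).
exists P => //; split => A mA; rewrite PS; try exact: measurableX.
  rewrite (sets_of_has_marg1 mS S0 m1 S1 mA)//.
  by rewrite (integral_cst mu1 mA 1) mul1e.
have mA1 : measurable_fun setT (\1_A : X2 -> R) by exact: measurable_indic.
rewrite integral_indicM.
transitivity (\int[mu1 \x mu2]_z (\1_A z.2 * S z)%:E).
  apply: eq_integral => z _; congr ((_ * _)%:E)%R.
  rewrite !indicE; congr ((_ : bool)%:R)%R.
  by apply/idP/idP; rewrite !inE /=; [case|].
rewrite (integral_marg2 mS S0 _ S2 mA1)//.
by rewrite -(integral_indicM mu2 (fun=> 1%R)) (integral_cst mu2 mA 1) mul1e.
Qed.

Let one_marg1 : has_marg1 mu1 mu2 (cst 1%R) (cst 1%R).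
Proof. by apply: aeW => x; rewrite integral_cst_prob. Qed.
Let one_marg2 : has_marg2 mu1 mu2 (cst 1%R) (cst 1%R).
Proof. by apply: aeW => x; rewrite integral_cst_prob. Qed.

(** The product coupling has finite value; so the optimum is finite and [pistar] has a density. *)
Let Jone : Jent mu1 mu2 c (cst 1%R) < +oo.
Proof.
have m1 : measurable_fun [set: X1 * X2] (cst 1%R : X1 * X2 -> R) by [].
have mw := measurable_wgt mphi1 mphi2.
rewrite /Jent; under eq_integral do rewrite klfun1 add0r.
apply: (@le_lt_trans _ _ (\int[mu1 \x mu2]_z (C * (wgt phi1 phi2 z ^+ 2 * 1))%:E)).
  apply: le_integralR; [by move=> z; rewrite mulr_ge0|by mfun|by mfun|] => z.
  rewrite !mulr1 (le_trans (cC z))// ler_wpM2l// -/(wgt phi1 phi2 z).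
  rewrite -[leLHS]mulr1 expr2 ler_wpM2l ?wgt_ge0//.
  by rewrite /wgt -addrA lerDl addr_ge0.
rewrite integralRZ//; [|by move=> z; rewrite mulr_ge0// sqr_ge0|by mfun].
rewrite lte_mul_pinfty//.
apply: le_lt_trans (wgt_sqr_moment mphi1 phi10 mphi2 phi20 alpha0 e1 e2 m1 _ one_marg1 one_marg2) _ => //.
by rewrite ltry.
Qed.

Let star : exists Hs, [/\ is_density pistar (mu1 \x mu2) Hs,
  has_marg1 mu1 mu2 Hs (cst 1%R), has_marg2 mu1 mu2 Hs (cst 1%R) &
  Fent mu1 mu2 c pistar = Jent mu1 mu2 c Hs].
Proof.
have Foo : Fent mu1 mu2 c pistar < +oo.
  by rewrite popt; apply: le_lt_trans (Sent_le _ _ one_marg1 one_marg2) Jone.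
have KLoo : KL pistar (mu1 \x mu2) < +oo.
  apply: le_lt_trans Foo; rewrite /Fent leeDr//; exact: integralR_ge0.
have [Hs dHs] := KL_lty_density KLoo; exists Hs; split => //; last exact: Fent_density.
  have [mH H0 PH] := dHs; apply: has_marg1_of_sets => //.
    by rewrite -PH// probability_setT ltry.
  move=> A mA; rewrite -PH; last exact: measurableX.
  by rewrite coup.1// (integral_cst mu1 mA 1) mul1e.
have [mH H0 PH] := dHs.
have mHt := measurable_pswap mH; have H0t z : (0 <= pswap Hs z)%R by exact: H0.
apply: (@has_marg1_of_sets _ _ _ _ _ mu2 mu1 (pswap Hs)) => //.
  by rewrite integral_pswap// -PH// probability_setT ltry.
move=> A mA; have mTA : measurable ([set: X1] `*` A) by exact: measurableX.
transitivity (pistar (setT `*` A)); last first.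
  by rewrite coup.2// (integral_cst mu2 mA 1) mul1e.
have m1 : measurable_fun setT (\1_([set: X1] `*` A) : X1 * X2 -> R).
  exact: measurable_indic.
rewrite PH// (integral_indicM _ Hs) -(integral_pswap mu1 mu2); last 2 first.
- by mfun.
- by move=> z; rewrite mulr_ge0.
rewrite integral_indicM; apply: eq_integral => z _; congr ((_ * _)%:E)%R.
rewrite !indicE; congr ((_ : bool)%:R)%R.
by apply/idP/idP; rewrite !inE /=; case.
Qed.

(** Going through the base point and using s^q <= 1 + s^p bounds the transport cost by w(x) + w(y)
    with w = 2^(q+1) wgt, so [tv_coupling] applies. One factor 2 comes from 2 + phi1 + phi2 <= 2
    wgt. *)
Let Wass_le (P P' : probability (X1 * X2)%type R) (H H' : X1 * X2 -> R) (q B : R) :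
  is_density P (mu1 \x mu2) H -> is_density P' (mu1 \x mu2) H' ->
  (1 <= q <= p)%R ->
  \int[mu1 \x mu2]_z (wgt phi1 phi2 z * `|H z - H' z|)%:E <= B%:E ->
  Wass dist1 dist2 q P P' <= ((2 `^ q * 2 * B) `^ q^-1)%:E.
Proof.
move=> dH dH' /andP[q1 qp] HB.
have q0 : (0 < q)%R by lra.
have q0' := ltW q0.
pose kappa (z : (X1 * X2) * (X1 * X2)) := (dXr dist1 dist2 q z.1 z.2 `^ q)%R.
have kE z : (kappa z = dist1 z.1.1 z.2.1 `^ q + dist2 z.1.2 z.2.2 `^ q)%R.
  exact: dXr_powR.
pose w z := (2 `^ q * 2 * wgt phi1 phi2 z)%R.
have mwg := measurable_wgt mphi1 mphi2.
have wg0 := wgt_ge0 phi10 phi20.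
have mw : measurable_fun setT w by rewrite /w; mfun.
have cst0 : (0 <= 2 `^ q * 2 :> R)%R by rewrite mulr_ge0// powR_ge0.
have w0 z : (0 <= w z)%R by rewrite /w mulr_ge0.
have k0 z : (0 <= kappa z)%R by exact: powR_ge0.
have mk : measurable_fun setT kappa.
  rewrite (funext kE).
  have md1 : measurable_fun setT (fun z : (X1 * X2) * (X1 * X2) => dist1 z.1.1 z.2.1).
    apply: (measurableT_comp (measurable_dist2 xh1 P1)
      (g := fun z : (X1 * X2) * (X1 * X2) => (z.1.1, z.2.1))).
    apply: measurable_fun_pair; exact: measurableT_comp measurable_fst _.
  have md2 : measurable_fun setT (fun z : (X1 * X2) * (X1 * X2) => dist2 z.1.2 z.2.2).
    apply: (measurableT_comp (measurable_dist2 xh2 P2)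
      (g := fun z : (X1 * X2) * (X1 * X2) => (z.1.2, z.2.2))).
    apply: measurable_fun_pair; exact: measurableT_comp measurable_snd _.
  by mfun.
have kxx x : kappa (x, x) = 0%R.
  by rewrite kE /= (dist_xx P1) (dist_xx P2) powR0 ?addr0// gt_eqF.
have dle d (T : measurableType d) (dist : T -> T -> R) (P0 : polish_borel dist) xh x y :
    (dist x y `^ q <= 2 `^ q * ((1 + dist xh x `^ p) + (1 + dist xh y `^ p)))%R.
  have a0 := dist_ge0 P0 xh x; have b0 := dist_ge0 P0 xh y.
  apply: (@le_trans _ _ ((dist xh x + dist xh y) `^ q)%R).
    apply: ge0_ler_powR; rewrite ?nnegrE ?addr_ge0 ?(dist_ge0 P0)//.
    by have := dist_triangle P0 x xh y; rewrite (dist_sym P0 x xh).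
  apply: (le_trans (powR_quasi_triangle q0' a0 b0)).
  by rewrite ler_wpM2l ?powR_ge0// lerD// powR_le_1D// q0' qp.
have kw z : (kappa z <= w z.1 + w z.2)%R.
  rewrite kE; have h1 := dle _ _ _ P1 xh1 z.1.1 z.2.1.
  have h2 := dle _ _ _ P2 xh2 z.1.2 z.2.2.
  apply: (le_trans (lerD h1 h2)); rewrite /w -!mulrDr -mulrA ler_wpM2l ?powR_ge0//.
  rewrite /wgt -/(phi1 z.1.1) -/(phi1 z.2.1) -/(phi2 z.1.2) -/(phi2 z.2.2).
  have := phi10 z.1.1; have := phi10 z.2.1; have := phi20 z.1.2; have := phi20 z.2.2.
  lra.
have [gam gcoup gle] := tv_coupling dH dH' mk k0 kxx mw w0 kw.
have [mH H0 _] := dH; have [mH' H0' _] := dH'.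
rewrite /Wass -poweR_EFin; apply: gt0_ler_poweR.
- by rewrite invr_ge0.
- rewrite in_itv /= leey andbT; apply: le_ereal_inf_tmp => _ [g _ <-].
  by apply: integralR_ge0 => z; exact: powR_ge0.
- rewrite in_itv /= leey andbT lee_fin mulr_ge0//.
  by rewrite -lee_fin (le_trans _ HB)//; apply: integralR_ge0 => z; rewrite mulr_ge0.
apply: ge_ereal_inf; exists (\int[gam]_z (kappa z)%:E); first by exists gam.
apply: (le_trans gle); rewrite /w.
under eq_integral do rewrite -mulrA.
rewrite integralRZ//; [|by move=> z; rewrite mulr_ge0|by mfun].
by rewrite [leRHS]EFinM; apply: lee_wpmul2l; rewrite ?lee_fin.
Qed.

(** With e = n^(-1/4), values differ by O(e^2), and the q-th root of the weighted total variation
    O(e) gives n^(-1/(4q)). Both orders of the arguments of [Wass] are recorded, since the two parts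
    of the theorem use different ones. *)
Lemma sinkhorn_convergence : exists K : R, [/\ (0 <= K)%R,
  Fent mu1 mu2 c pistar \is a fin_num &
  forall n, (2 <= n)%N ->
  `|Fent mu1 mu2 c pistar - Fent mu1 mu2 c (pin n)| <= (K * n%:R `^ (- 2^-1))%:E /\
  forall q, (1 <= q <= p)%R ->
    Wass dist1 dist2 q pistar (pin n) <=
      ((2 `^ q * 2 * K) `^ q^-1 * n%:R `^ (- (4 * q)^-1))%:E /\
    Wass dist1 dist2 q (pin n) pistar <=
      ((2 `^ q * 2 * K) `^ q^-1 * n%:R `^ (- (4 * q)^-1))%:E].
Proof.
have [Hs [dHs Hs1 Hs2 FHs]] := star; have [mHs Hs0 PHs] := dHs.
have Jfin : Jent mu1 mu2 c Hs < +oo.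
  by rewrite -FHs popt; apply: le_lt_trans (Sent_le _ _ one_marg1 one_marg2) Jone.
have opt (S : X1 * X2 -> R) : measurable_fun setT S -> (forall z, 0 <= S z)%R ->
    has_marg1 mu1 mu2 S (cst 1%R) -> has_marg2 mu1 mu2 S (cst 1%R) ->
    Jent mu1 mu2 c Hs <= Jent mu1 mu2 c S.
  by move=> *; rewrite -FHs popt; exact: Sent_le.
have J0 (H : X1 * X2 -> R) : (forall z, 0 <= H z)%R -> 0 <= Jent mu1 mu2 c H.
  by move=> H0; apply: integralR_ge0 => z; rewrite addr_ge0 ?mulr_ge0// klfun_ge0.
have [K0 KP] := sinkhorn_density_rates mphi1 phi10 mphi2 phi20 alpha0 e1 e2 mc c0 C0 cC
  mHs Hs0 Hs1 Hs2 opt Jfin.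
pose K := Num.max K0 0%R; exists K.
have K00 : (0 <= K)%R by rewrite /K le_max lexx orbT.
have K0K : (K0 <= K)%R by rewrite /K le_max lexx.
have Jsfin : Jent mu1 mu2 c Hs \is a fin_num by rewrite ge0_fin_numE// J0.
split => //; first by rewrite FHs.
move=> n n2; have dn : is_density (pin n) (mu1 \x mu2) (sinkhorn_density mu1 mu2 c n).
  exact: (sinkhorn_iterates_density mphi1 phi10 mphi2 phi20 alpha0 e1 e2 mc c0 C0 cC n iter).
have [mHn Hn0 _] := dn.
pose e : R := (n%:R `^ (- 4^-1))%R.
have n1 : (1 <= n%:R :> R)%R by rewrite ler1n (leq_trans _ n2).
have n0 : (0 <= n%:R :> R)%R by [].
have en : (0 < e <= 1)%R.
  rewrite /e powR_gt0 ?(lt_le_trans _ n1)//= -[leRHS](powRr0 n%:R) ler_powR//; lra.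
have e2E : (e ^+ 2 = n%:R `^ (- 2^-1))%R.
  rewrite -powR_mulrn ?powR_ge0// /e -powRrM; congr (_ `^ _)%R; lra.
have e4E : ((e ^+ 2) ^+ 2 = n%:R^-1)%R.
  rewrite e2E -powR_mulrn ?powR_ge0// -powRrM.
  rewrite (_ : - 2^-1 * 2%:R = -1)%R; last by lra.
  by rewrite powR_inv1.
have [h1 h2 h3] := KP n e n2 en e4E.
rewrite FHs (Fent_density dn).
have Jnfin : Jent mu1 mu2 c (sinkhorn_density mu1 mu2 c n) \is a fin_num.
  rewrite ge0_fin_numE ?J0//; apply: (le_lt_trans h1).
  by rewrite lte_add_pinfty// ltry.
split.
  move: h1 h2; rewrite -(fineK Jsfin) -(fineK Jnfin).
  set a := fine _; set b := fine _ => h1 h2.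
  have g1 : (b <= a + K0 * e ^+ 2)%R by rewrite -lee_fin EFinD.
  have g2 : (a <= b + K0 * e ^+ 2)%R by rewrite -lee_fin EFinD.
  rewrite (_ : `|b%:E - a%:E| = (`|b - a|%R)%:E)// lee_fin -e2E ler_norml.
  have : (K0 * e ^+ 2 <= K * e ^+ 2)%R by rewrite ler_wpM2r// sqr_ge0.
  by move=> h; apply/andP; split; lra.
move=> q /andP[q1 qp].
have q01 : (1 <= q <= p)%R by rewrite q1.
have hB : \int[mu1 \x mu2]_z (wgt phi1 phi2 z *
    `|sinkhorn_density mu1 mu2 c n z - Hs z|)%:E <= (K * e)%:E.
  apply: (le_trans h3); rewrite lee_fin ler_wpM2r//; by case/andP: en => /ltW.
have -> : ((2 `^ q * 2 * K) `^ q^-1 * n%:R `^ (- (4 * q)^-1) =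
    (2 `^ q * 2 * (K * e)) `^ q^-1)%R.
  rewrite [X in _ = (X `^ _)%R]mulrA [RHS]powRM ?powR_ge0 ?mulr_ge0 ?powR_ge0//.
  congr (_ * _)%R; rewrite /e -powRrM invfM mulNr//.
split; last exact: (Wass_le dn dHs q01 hB).
apply: (Wass_le dHs dn q01).
by under eq_integral do rewrite distrC.
Qed.

End convergence.

(** * Growth and continuity of the admissible costs *)

Section cost_conditions.
Context {R : realType} {d1 d2 : measure_display}
  {X1 : measurableType d1} {X2 : measurableType d2}.
Variables (dist1 : X1 -> X1 -> R) (dist2 : X2 -> X2 -> R) (p : R)
  (xh1 : X1) (xh2 : X2).
Hypotheses (P1 : polish_borel dist1) (P2 : polish_borel dist2) (p1 : 1 <= p).
Local Notation dX := (dXr dist1 dist2 p).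

Lemma growth_order_le c : (forall x, 0 <= c x) ->
  growth_order dist1 dist2 p p (xh1, xh2) c ->
  exists2 C, 0 <= C &
    forall z, c z <= C * (1 + dist1 xh1 z.1 `^ p + dist2 xh2 z.2 `^ p).
Proof.
move=> c0 [C cC]; have p0 : 0 < p by exact: lt_le_trans ltr01 p1.
exists `|C| => // z; have := cC z; rewrite ger0_norm// dXr_powR//=.
rewrite (dist_sym P1) (dist_sym P2) addrA => /le_trans; apply.
by rewrite ler_wpM2r ?ler_norm// !addr_ge0// powR_ge0.
Qed.

Lemma dX_lipschitz_continuous h : dX_lipschitz dist1 dist2 p h ->
  dX_continuous dist1 dist2 p h.
Proof.
move=> [L hL] x e e0; have L0 : 0 < `|L| + 1 by rewrite ltr_wpDl.
exists (e / (`|L| + 1)); first exact: divr_gt0.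
move=> y xy; apply: (le_lt_trans (hL x y)).
have d0 : 0 <= dX x y by exact: powR_ge0.
apply: (@le_lt_trans _ _ ((`|L| + 1) * dX x y)).
  by rewrite ler_wpM2r// (le_trans (ler_norm L))// lerDl.
by rewrite mulrC -ltr_pdivlMr.
Qed.

(** Two factors of growth p - 1 would only give 2 (p - 1). The Lipschitz bound makes f grow
    linearly, and 1 + (p - 1) = p; the 4 absorbs the four terms of (1 + D)(1 + D^(p-1)). *)
Lemma growth_order_mul c f g : (forall x, c x = f x * g x) ->
  dX_lipschitz dist1 dist2 p f ->
  growth_order dist1 dist2 p (p - 1) (xh1, xh2) g ->
  growth_order dist1 dist2 p p (xh1, xh2) c.
Proof.
move=> cfg [L fL] [C gC]; have p1' := p1; pose xh := (xh1, xh2).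
pose A := `|f xh| + `|L|.
exists (A * `|C| * 4) => x; rewrite cfg normrM.
set D := dX x xh.
have D0 : 0 <= D by exact: powR_ge0.
have Dp := powR_ge0 D p.
have D1 : D <= 1 + D `^ p by have := @powR_le_1D R 1 p D; rewrite powRr1//; apply; rewrite ?ler01.
have D2 : D `^ (p - 1) <= 1 + D `^ p by apply: powR_le_1D => //; apply/andP; split; lra.
have fb : `|f x| <= A * (1 + D).
  have := ler_normD (f x - f xh) (f xh); rewrite subrK => /le_trans; apply.
  have := fL x xh; have := ler_wpM2r D0 (ler_norm L); rewrite -/D /A.
  have := normr_ge0 (f xh); have := normr_ge0 L; nra.
have gb : `|g x| <= `|C| * (1 + D `^ (p - 1)).
  by rewrite (le_trans (gC x))// ler_wpM2r ?ler_norm// addr_ge0// powR_ge0.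
have A0 : 0 <= A by rewrite addr_ge0.
apply: (le_trans (ler_pM (normr_ge0 _) (normr_ge0 _) fb gb)).
rewrite mulrACA -!mulrA; do 2 rewrite ler_wpM2l//.
have DD : D * D `^ (p - 1) = D `^ p.
  have [D00|D00] := eqVneq D 0; first by rewrite D00 mul0r powR0// gt_eqF//; lra.
  rewrite -{1}(powRr1 D0) -powRD; last by rewrite D00 implybT.
  by congr (_ `^ _); ring.
by rewrite mulrDr mulr1 mulrDl mul1r DD; lra.
Qed.

End cost_conditions.

Unset Implicit Arguments.

Theorem mainTheorem10 (R : realType) (d1 d2 : measure_display)
  (X1 : measurableType d1) (X2 : measurableType d2)
  (dist1 : X1 -> X1 -> R) (dist2 : X2 -> X2 -> R)
  (p : R) (mu1 : probability X1 R) (mu2 : probability X2 R)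
  (alpha : R) (xh1 : X1) (xh2 : X2)
  (c : (X1 * X2)%type -> R)
  (pistar : probability (X1 * X2)%type R)
  (pin : nat -> probability (X1 * X2)%type R) :
  polish_borel dist1 -> polish_borel dist2 ->
  1 <= p ->
  0 < alpha ->
  (\int[mu1]_x1 (expR (alpha * dist1 xh1 x1 `^ p))%:E < +oo)%E ->
  (\int[mu2]_x2 (expR (alpha * dist2 xh2 x2 `^ p))%:E < +oo)%E ->
  (* pistar is the optimizer of S_ent(mu1, mu2, c) *)
  is_coupling mu1 mu2 pistar ->
  Fent mu1 mu2 c pistar = Sent mu1 mu2 c ->
  (* (pin) are the Sinkhorn iterates *)
  sinkhorn_iterates mu1 mu2 c pin ->
  (* (i) *)
  ((forall x, 0 <= c x) ->
   dX_continuous dist1 dist2 p c ->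
   growth_order dist1 dist2 p p (xh1, xh2) c ->
   (fun n => Fent mu1 mu2 c (pin n)) @ \oo --> Fent mu1 mu2 c pistar /\
   (fun n => Wass dist1 dist2 p (pin n) pistar) @ \oo --> 0%E)
  /\
  (* (ii) *)
  (forall (q : R) (f g : (X1 * X2)%type -> R),
   1 <= q -> q <= p ->
   (forall x, c x = f x * g x) ->
   (forall x, 0 <= c x) ->
   dX_lipschitz dist1 dist2 p f -> dX_lipschitz dist1 dist2 p g ->
   growth_order dist1 dist2 p (p - 1) (xh1, xh2) f ->
   growth_order dist1 dist2 p (p - 1) (xh1, xh2) g ->
   exists c0 : R, forall n : nat, (2 <= n)%N ->
     (`| Fent mu1 mu2 c pistar - Fent mu1 mu2 c (pin n) |
        <= (c0 * n%:R `^ (- (2 * p)^-1))%:E)%E /\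
     (Wass dist1 dist2 q pistar (pin n)
        <= (c0 * n%:R `^ (- (4 * p * q)^-1))%:E)%E).
Proof.
move=> P1 P2 p1 alpha0 exp1 exp2 coup popt iter; split.
- move=> c0 cc gc; have [C C0 cC] := growth_order_le P1 P2 p1 c0 gc.
  have mc := measurable_dX_continuous (xh1, xh2) P1 P2 p1 cc.
  have [K [K0 Ffin KP]] := sinkhorn_convergence P1 P2 alpha0 exp1 exp2 coup popt iter
    mc c0 C0 cC.
  split.
  + rewrite -(fineK Ffin); apply: (@cvge_powR_bound _ _ _ K 2^-1) => // n n2.
    by rewrite fineK//; exact: (KP n n2).1.
  + have p4 : 0 < (4 * p)^-1 by rewrite invr_gt0; lra.
    apply: (cvge_powR_bound p4) => n n2.
    have pp : 1 <= p <= p by rewrite p1 lexx.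
    rewrite sub0e abseN gee0_abs ?poweR_ge0//.
    exact: ((KP n n2).2 p pp).2.
- move=> q f g q1 qp cfg c0 fL gL fg gg.
  have gc := growth_order_mul p1 cfg fL gg.
  have [C C0 cC] := growth_order_le P1 P2 p1 c0 gc.
  have mf := measurable_dX_continuous (xh1, xh2) P1 P2 p1 (dX_lipschitz_continuous fL).
  have mg := measurable_dX_continuous (xh1, xh2) P1 P2 p1 (dX_lipschitz_continuous gL).
  have mc : measurable_fun setT c by rewrite (funext cfg); exact: measurable_funM.
  have [K [K0 Ffin KP]] := sinkhorn_convergence P1 P2 alpha0 exp1 exp2 coup popt iter
    mc c0 C0 cC.
  (* [K] serves the values and [B] the distances; both are independent of n. *)
  pose B := (2 `^ q * 2 * K) `^ q^-1.
  exists (Num.max K B) => n n2.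
  have [h1 h2] := KP n n2.
  have qp' : 1 <= q <= p by rewrite q1.
  have n1 : 1 <= n%:R :> R by rewrite ler1n (leq_trans _ n2).
  split.
  + apply: (le_trans h1); rewrite lee_fin ler_pM ?powR_ge0// ?le_max ?lexx//.
    by rewrite ler_powR// lerN2 lef_pV2 ?posrE; lra.
  + apply: (le_trans (h2 q qp').1); rewrite lee_fin ler_pM ?powR_ge0// ?le_max ?lexx ?orbT//.
    rewrite ler_powR// lerN2 lef_pV2 ?posrE; nra.
Qed.
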